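(* Let $n\ge 2$, let $\vec{k}=(k_1,\dots,k_m)$ with $1\le k_i\le n-1$, and let $F(\vec{k})$ be the set of untagged $\mathfrak{sl}_n$ webs with boundary weight vector $\vec{k}$. For each $G\in F(\vec{k})$, $$f(G)=\sum_{S\in\mathcal{S}tr(G)} (-q)^{x(S)-y(S)}\, x_S\ \in\ \mathrm{Inv}(\vec{k}),$$ and $f$ extends linearly to a map $\mathcal{F}(\vec{k})\to \mathrm{Inv}(\vec{k})$.
   Context: Webs. Fix $n\ge2$. An untagged $\mathfrak{sl}_n$ web is a finite directed plane graph embedded in the closed half-plane below a horizontal boundary axis, considered up to planar isotopy relative to the boundary, whose edges carry weights in $\{1,\dots,n-1\}$; boundary vertices are univalent and lie on the axis; all other (interior) vertices are trivalent; directed weighted closed loops without vertices are allowed as components. For a vertex $v$ and incident edge $e$ put $\sigma_v(e)=1$ if $e$ is directed into $v$ and $-1$ if out of $v$. At each interior vertex $v$ with incident edges $e_1,e_2,e_3$ of weights $\ell_1,\ell_2,\ell_3$ one requires $\sum_i\sigma_v(e_i)\ell_i\equiv 0 \pmod n$. If $v_1,\dots,v_m$ are the boundary vertices from left to right and $e_i$ is the edge at $v_i$, of weight $\ell_i$, the boundary weight vector is $\vec k=(k_1,\dots,k_m)$ with $k_i=\ell_i$ if $\sigma_{v_i}(e_i)=1$ and $k_i=n-\ell_i$ if $\sigma_{v_i}(e_i)=-1$. $F(\vec k)$ is the set of such webs and $\mathcal F(\vec k)$ the free $\mathbb C(q)$-vector space on $F(\vec k)$. Strandings. A stranding $S$ of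 $G$ is a collection of directed paths in $G$ (simple strands), each with a color in $\{1,\dots,n-1\}$, each either closed or with both endpoints on the boundary, paths of the same color being pairwise disjoint. For an edge $e$, $S_+(e)$ (resp. $S_-(e)$) is the set of colors of strands running along $e$ with (resp. against) its direction, $S(e)=S_+(e)\sqcup S_-(e)$, and $\alpha_c^\vee(e)=1,-1,0$ according to $c\in S_+(e)$, $c\in S_-(e)$, $c\notin S(e)$. $S$ is valid if for every edge $e$ of weight $\ell$: (1) the nonzero values $\alpha_c^\vee(e)$ alternate in sign as $c$ increases; (2) with $c_{\max}$ the largest color in $S(e)$, $\sum_{c=1}^{n-1}\alpha_c^\vee(e)c$ equals $\ell$ if $c_{\max}\in S_+(e)$ and $\ell-n$ if $c_{\max}\in S_-(e)$ (in particular $S(e)\neq\emptyset$). $\mathcal{S}tr(G)$ is the set of valid strandings. $(i,j)$-strands. For $1\le i<j\le n$ the sum $\sum_{c=i}^{j-1}\alpha_c^\vee(e)$ lies in $\{-1,0,1\}$. The $(i,j)$-strands of $S$ are the connected components of the directed graph consisting of the edges $e$ for which this sum is nonzero, directed as $e$ if the sum is $1$ and oppositely to $e$ if it is $-1$; each is a directed closed curve or a directed path with endpoints on the boundary. An open strand is clockwise (counterclockwise) if the closed curve obtained by joining its endpoints along the axis is; thus an open strand is clockwise if it runs from its right endpoint to its left endpoint and counterclockwise otherwise. $x(S)$ is the total number, over all $i<j$, of closed clockwise $(i,j)$-strands; $y(S)$ is the total number, over all $i<j$, of counterclockwise $(i,j)$-strands, both closed and open. Binary labels and monomials. For $S\in\mathcal{S}tr(G)$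 and an edge $e$, $b_S(e)\in\{0,1\}^n$ is defined by $b_S(e)_n=0$ if $\alpha^\vee_{c_{\max}}(e)=1$, $b_S(e)_n=1$ if $\alpha^\vee_{c_{\max}}(e)=-1$, and $b_S(e)_c-b_S(e)_{c+1}=\alpha_c^\vee(e)$ for $1\le c\le n-1$. For the boundary edge $e_j$ let $\hat b(e_j)=b_S(e_j)$ if $\sigma_{v_j}(e_j)=1$ and $\hat b(e_j)=\vec 1-b_S(e_j)$ if $\sigma_{v_j}(e_j)=-1$, where $\vec 1=(1,\dots,1)$. Put $x_S=x_{\hat b(e_1)}\otimes\cdots\otimes x_{\hat b(e_m)}\in V(\vec k)$. Representations. $U_q(\mathfrak{sl}_n)$ is the standard quantum group over $\mathbb C(q)$ with generators $E_i,F_i,K_i^{\pm1}$ ($1\le i<n$), coproduct $\Delta(E_i)=E_i\otimes K_i+1\otimes E_i$, $\Delta(F_i)=F_i\otimes1+K_i^{-1}\otimes F_i$, $\Delta(K_i)=K_i\otimes K_i$, counit $\epsilon(E_i)=\epsilon(F_i)=0$, $\epsilon(K_i)=1$. $V_k=\bigwedge_q^k\mathbb C_q^n$ has basis $x_{\vec b}$ indexed by $\vec b\in\{0,1\}^n$ with exactly $k$ ones ($x_{\vec b}=x_{t_1}\wedge_q\cdots\wedge_q x_{t_k}$ where $t_1>\cdots>t_k$ are the positions of the ones). Writing $s_i\vec b$ for $\vec b$ with entries $i,i+1$ swapped: $E_ix_{\vec b}=x_{s_i\vec b}$ if $(b_i,b_{i+1})=(0,1)$ and $0$ otherwise; $F_ix_{\vec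 b}=x_{s_i\vec b}$ if $(b_i,b_{i+1})=(1,0)$ and $0$ otherwise; $K_ix_{\vec b}=q^{b_i-b_{i+1}}x_{\vec b}$. $V(\vec k)=V_{k_1}\otimes\cdots\otimes V_{k_m}$ (equal to $\mathbb C(q)$ if $m=0$), and $\mathrm{Inv}(\vec k)=\{w\in V(\vec k): E_iw=F_iw=0,\ K_iw=w \text{ for all } i\}$. *)

(* Defs.v *)
From HB Require Import structures.
From mathcomp Require Import all_boot all_order all_algebra perm.
From mathcomp Require Import generic_quotient fraction.
From mathcomp Require Import boolp reals.
From mathcomp Require Import complex.
From mathcomp Require Import monalg.

Set Implicit Arguments.
Unset Strict Implicit.
Unset Printing Implicit Defensive.

Import GRing.Theory.

Local Open Scope ring_scope.
Local Open Scope quotient_scope.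

(* Conventions: colors 1, ..., n-1 are the elements of 'I_n.-1, the ordinal c
   standing for the color c.+1; the positions 1, ..., n of a binary vector are
   the elements of 'I_n, the ordinal p standing for the position p.+1; the
   boundary vertices v_1, ..., v_m are indexed by 'I_m. *)

(* A plane graph up to planar isotopy is recorded by its combinatorial map.
   A dart is an edge with a sense of traversal; it leaves its origin vertex.
     flip d   the same edge traversed in the other sense
     rot d   the next dart counterclockwise around the origin of d, so that
             vertices are the orbits of rot
     bd j    the dart leaving the boundary vertex v_j
     fwd     the darts whose sense is the direction of their edge
     wt      the weight of the underlying edge
     reg d   the region (connected component of the complement of the graph in
             the half-plane) to the left of d; the region ord0 is the unbounded
             one
   The rotation determines each connected component up to isotopy on the sphere;
   reg adds which of its faces is the outer one and how the components are
   nested, so that plane graphs are isotopic relative to the axis if and only if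
   these data agree up to renaming darts and regions (see isotopic below). A
   circle without vertices is the pair of darts d, flip d with a marker on it:
   rot exchanges d and flip d. *)
Record plane_map (m : nat) := PlaneMap {
  ndart : nat;
  flip : {perm 'I_ndart};
  rot : {perm 'I_ndart};
  bd : {ffun 'I_m -> 'I_ndart};
  fwd : {set 'I_ndart};
  wt : {ffun 'I_ndart -> nat};
  nreg : nat;
  reg : {ffun 'I_ndart -> 'I_nreg.+1}
}.

Section PlaneMaps.
Variables (n m : nat) (G : plane_map m).
Notation dart := 'I_(ndart G).
Notation region := 'I_(nreg G).+1.

Definition vtx (d : dart) : {set dart} := [set d' in porbit (rot G) d].

(* The closed half-plane with its axis contracted to one point, the hub, is a
   plane whose unbounded region meets the hub between v_m and v_1. The boundary
   edges hang down from the hub, so that left to right along the axis is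
   counterclockwise around the hub. hrot is the rotation of the resulting plane graph. *)
Definition hrot (d : dart) : dart :=
  if [pick j | bd G j == d] is Some j then bd G (ordS j) else rot G d.

Definition same_component : rel dart :=
  [rel d d' | [|| d' == flip G d, d' == hrot d | d == hrot d']].

(* Two regions are adjacent if an edge not traversed by K separates them. *)
Definition adjacent_off (K : {set dart}) : rel region :=
  [rel r r' | [exists d : dart,
     [&& d \notin K, flip G d \notin K, reg G d == r & reg G (flip G d) == r']]].

(* The regions on the unbounded side of K. *)
Definition outside (K : {set dart}) : pred region :=
  connect (adjacent_off K) ord0.

(* Euler's formula V - E + R = 1 + C for a plane graph with V vertices, E edges,
   C connected components and R regions. (When m = 0 the hub is an isolated
   vertex, which would add 1 to both V and C.) *)
Definition euler_formula : Prop :=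
  (fcard hrot predT + (nreg G).+1 = #|fwd G| + n_comp same_component predT + 1)%N.

(* Regions are well defined along the corner between two consecutive darts, the
   corner between v_m and v_1 is in the unbounded region, and one can reach
   every region from the unbounded one by crossing edges. *)
Definition is_plane : Prop :=
  [/\ forall d, reg G (flip G (hrot d)) = reg G d,
      forall j : 'I_m, j.+1 = m -> reg G (bd G j) = ord0,
      forall r, outside set0 r
    & euler_formula].

Definition is_circle (d : dart) : bool := vtx d == [set d; flip G d].

(* The sign at the origin of d of the edge of d. *)
Definition sgn_at (d : dart) : int := if d \in fwd G then -1 else 1.

Definition is_web : Prop :=
  [/\ forall d, flip G (flip G d) = d /\ flip G d != d,
      injective (bd G) /\ (forall j, vtx (bd G j) = [set bd G j]),
      is_plane,
      forall d, [/\ (d \in fwd G) != (flip G d \in fwd G),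
                    wt G (flip G d) = wt G d & (0 < wt G d < n)%N]
    & forall d, d \notin codom (bd G) -> ~~ is_circle d ->
        #|vtx d| = 3%N /\ (n %| \sum_(d' in vtx d) sgn_at d' * (wt G d')%:Z)%Z].

Definition boundary_weight (j : 'I_m) : nat :=
  if sgn_at (bd G j) == 1 then wt G (bd G j) else (n - wt G (bd G j))%N.

End PlaneMaps.

Definition has_boundary n m (k : 'I_m -> nat) (G : plane_map m) : Prop :=
  is_web n G /\ forall j, boundary_weight n G j = k j.

Record web n m (k : 'I_m -> nat) :=
  Web { web_map :> plane_map m; webP : has_boundary n k web_map }.

Definition isotopic m (G H : plane_map m) : Prop :=
  exists (h : 'I_(ndart G) -> 'I_(ndart H))
         (g : 'I_(nreg G).+1 -> 'I_(nreg H).+1),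
    [/\ bijective h, bijective g, g ord0 = ord0, (forall j, h (bd G j) = bd H j)
      & forall d, [/\ h (flip G d) = flip H (h d), h (rot G d) = rot H (h d),
                      (h d \in fwd H) = (d \in fwd G), wt H (h d) = wt G d
                    & reg H (h d) = g (reg G d)]].

Lemma isotopic_refl m (G : plane_map m) : isotopic G G.
Proof. by exists id, id; split=> //; exists id. Qed.

Lemma isotopic_sym m (G H : plane_map m) : isotopic G H -> isotopic H G.
Proof.
case=> h [g [[h' hK h'K] [g' gK g'K] g0 hbd hE]].
exists h', g'; split; [by exists h | by exists g | by rewrite -g0 gK | |].
  by move=> j; rewrite -hbd hK.
move=> d; have [hrev hrot hfwd hwt hreg] := hE (h' d).
rewrite !h'K in hrev hrot hfwd hwt hreg.
by split; rewrite -?hrev -?hrot -?hwt ?hreg ?gK ?hK.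
Qed.

Lemma isotopic_trans m (G H I : plane_map m) :
  isotopic G H -> isotopic H I -> isotopic G I.
Proof.
case=> h [g [bh bg g0 hbd hE]] [h2 [g2 [bh2 bg2 g20 h2bd h2E]]].
exists (h2 \o h), (g2 \o g); split; [exact: bij_comp | exact: bij_comp | | |].
- by rewrite /= g0.
- by move=> j; rewrite /= hbd.
move=> d /=; have [e1 e2 e3 e4 e5] := hE d.
have [f1 f2 f3 f4 f5] := h2E (h d).
by split; rewrite ?e1 ?e2 ?f3 ?f4 ?f5 ?e5.
Qed.

HB.instance Definition _ n m (k : 'I_m -> nat) := gen_eqMixin (web n k).
HB.instance Definition _ n m (k : 'I_m -> nat) := gen_choiceMixin (web n k).

Definition isotopicb n m (k : 'I_m -> nat) : rel (web n k) :=
  fun G H => `[< isotopic G H >].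

Lemma isotopicb_equiv n m (k : 'I_m -> nat) :
  equiv_class_of (@isotopicb n m k).
Proof.
split=> [G|G H|H G I].
- exact/asboolP/isotopic_refl.
- by apply/asboolP/asboolP; apply: isotopic_sym.
- by move=> /asboolP GH /asboolP HI; apply/asboolP/(isotopic_trans GH HI).
Qed.

Canonical isotopicb_equivRel n m (k : 'I_m -> nat) :=
  EquivRelPack (isotopicb_equiv n k).

(* The set F(k): isotopy classes of webs with boundary weight vector k. *)
Definition webs n m (k : 'I_m -> nat) := {eq_quot (isotopicb_equivRel n k)}.
HB.instance Definition _ n m (k : 'I_m -> nat) := Choice.on (webs n k).

Section Strandings.
Variables (n m : nat) (G : plane_map m).
Notation dart := 'I_(ndart G).

Definition follows : rel dart := [rel d d' | vtx (flip G d) == vtx d'].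

Definition closed_path (s : seq dart) : bool :=
  [&& s != [::], path.cycle follows s & uniq (map (@vtx m G) s)].

Definition open_path (s : seq dart) : bool :=
  if s is d :: s' then
    [&& path follows d s', d \in codom (bd G),
        flip G (last d s') \in codom (bd G)
      & uniq (rcons (map (@vtx m G) s) (vtx (flip G (last d s'))))]
  else false.

(* A directed path is represented by the set of darts it traverses, so that a
   closed path has no base point. It uses each edge at most once. *)
Definition is_simple_strand (A : {set dart}) : bool :=
  [forall d in A, flip G d \notin A] &&
  [exists s : #|A|.-tuple dart,
     (A == [set d in s]) && (closed_path s || open_path s)].

Definition touched (A : {set dart}) : {set {set dart}} :=
  (@vtx m G @: A) :|: [set vtx (flip G d) | d in A].

Definition colored_strands := {set 'I_n.-1 * {set dart}}.

Definition is_stranding (S : colored_strands) : bool :=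
  [forall cA in S, is_simple_strand cA.2] &&
  [forall cA in S, forall cB in S,
     (cA.1 == cB.1) && (cA != cB) ==> [disjoint touched cA.2 & touched cB.2]].

Definition in_color (S : colored_strands) (c : 'I_n.-1) (d : dart) : bool :=
  [exists cA in S, (cA.1 == c) && (d \in cA.2)].

(* The number alpha_c of the edge of d, relative to the sense of d: it is
   alpha_c^vee(e) when d is the edge e with its own direction. *)
Definition alpha (S : colored_strands) (d : dart) (c : 'I_n.-1) : int :=
  (in_color S c d : nat)%:Z - (in_color S c (flip G d) : nat)%:Z.

Definition is_cmax (S : colored_strands) (d : dart) (c : 'I_n.-1) : bool :=
  (alpha S d c != 0) && [forall c' : 'I_n.-1, (c < c')%N ==> (alpha S d c' == 0)].

Definition alternating (S : colored_strands) (d : dart) : bool :=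
  [forall c : 'I_n.-1, forall c' : 'I_n.-1,
     [&& (c < c')%N, alpha S d c != 0, alpha S d c' != 0
       & [forall c'' : 'I_n.-1, (c < c'' < c')%N ==> (alpha S d c'' == 0)]]
     ==> (alpha S d c' == - alpha S d c)].

Definition weight_condition (S : colored_strands) (d : dart) : bool :=
  [exists c : 'I_n.-1, is_cmax S d c &&
     (\sum_(c' < n.-1) alpha S d c' * c'.+1%:Z
        == if alpha S d c == 1 then (wt G d)%:Z else (wt G d)%:Z - n%:Z)].

Definition valid (S : colored_strands) : bool :=
  [forall d in fwd G, alternating S d && weight_condition S d].

Definition valid_strandings : {set colored_strands} :=
  [set S | is_stranding S && valid S].

Section IJStrands.
Variable S : colored_strands.

Definition ij_darts (i j : 'I_n) : {set dart} :=
  [set d | \sum_(c < n.-1 | (i <= c < j)%N) alpha S d c == 1].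

Definition linked (A : {set dart}) : rel dart :=
  [rel d d' | [&& d \in A, d' \in A
                & ~~ [disjoint touched [set d] & touched [set d']]]].

Definition ij_strands (i j : 'I_n) : {set {set dart}} :=
  equivalence_partition (connect (linked (ij_darts i j))) (ij_darts i j).

Definition starts_at (K : {set dart}) (a : 'I_m) : bool := bd G a \in K.
Definition ends_at (K : {set dart}) (a : 'I_m) : bool := flip G (bd G a) \in K.

Definition is_closed (K : {set dart}) : bool :=
  [forall a : 'I_m, ~~ starts_at K a && ~~ ends_at K a].

(* A closed curve is clockwise (counterclockwise) if the unbounded side is on
   its left (right). *)
Definition closed_clockwise (K : {set dart}) : bool :=
  is_closed K && [forall d in K, outside K (reg G d)].
Definition closed_counterclockwise (K : {set dart}) : bool :=
  is_closed K && [forall d in K, outside K (reg G (flip G d))].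

Definition open_counterclockwise (K : {set dart}) : bool :=
  [exists a : 'I_m, exists b : 'I_m,
     [&& starts_at K a, ends_at K b & (a < b)%N]].

Definition x_stat : nat :=
  \sum_(i < n) \sum_(j < n | (i < j)%N)
     #|[set K in ij_strands i j | closed_clockwise K]|.

Definition y_stat : nat :=
  \sum_(i < n) \sum_(j < n | (i < j)%N)
     #|[set K in ij_strands i j |
          closed_counterclockwise K || open_counterclockwise K]|.

(* The edge of d with its own direction. *)
Definition directed (d : dart) : dart := if d \in fwd G then d else flip G d.

(* The binary label b_S(e) of the edge e of d: its last entry is 1 exactly when
   alpha_(c_max) = -1, and the other entries are obtained from the last one by
   summing the differences b_c - b_(c+1) = alpha_c. *)
Definition last_bit (d : dart) : bool :=
  [exists c : 'I_n.-1, is_cmax S (directed d) c && (alpha S (directed d) c == -1)].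

Definition label (d : dart) : {ffun 'I_n -> bool} :=
  [ffun p : 'I_n =>
     (last_bit d : nat)%:Z
       + \sum_(c < n.-1 | (p <= c)%N) alpha S (directed d) c == 1].

Definition boundary_label (j : 'I_m) : {ffun 'I_n -> bool} :=
  [ffun p => if sgn_at (bd G j) == 1 then label (bd G j) p
             else ~~ label (bd G j) p].

End IJStrands.
End Strandings.

Definition bvec (n : nat) := {ffun 'I_n -> bool}.

Definition ones n (b : bvec n) : nat := #|[set p | b p]|.

Lemma succ_pos_proof n (i : 'I_n.-1) : (i.+1 < n)%N.
Proof. by rewrite -ltn_predRL ltn_ord. Qed.

Definition pos_i n (i : 'I_n.-1) : 'I_n := widen_ord (leq_pred n) i.
Definition pos_i1 n (i : 'I_n.-1) : 'I_n := Ordinal (succ_pos_proof i).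

Definition swap_bits n (i : 'I_n.-1) (b : bvec n) : bvec n :=
  [ffun p => b (tperm (pos_i i) (pos_i1 i) p)].

(* The direct sum of the V_k over all k, by coordinates in the basis x_b. *)
Definition ext (K : fieldType) n := {ffun bvec n -> K^o}.
(* The m-th tensor power of the previous space, by coordinates in the basis
   x_(b 0) (x) ... (x) x_(b (m-1)). *)
Definition tens (K : fieldType) n m := {ffun {ffun 'I_m -> bvec n} -> K^o}.
HB.instance Definition _ (K : fieldType) n :=
  GRing.Lmodule.copy (ext K n) {ffun bvec n -> K^o}.
HB.instance Definition _ (K : fieldType) n m :=
  GRing.Lmodule.copy (tens K n m) {ffun {ffun 'I_m -> bvec n} -> K^o}.

Section Representations.
Variables (K : fieldType) (q : K) (n m : nat).

Definition xvec (b : bvec n) : ext K n := [ffun b' => (b' == b)%:R].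

Definition xtens (b : {ffun 'I_m -> bvec n}) : tens K n m :=
  [ffun b' => (b' == b)%:R].

(* The actions on one factor are given by their values on the basis. *)
Definition act_1 (b : bvec n) : ext K n := xvec b.
Definition act_E (i : 'I_n.-1) (b : bvec n) : ext K n :=
  if ~~ b (pos_i i) && b (pos_i1 i) then xvec (swap_bits i b) else 0.
Definition act_F (i : 'I_n.-1) (b : bvec n) : ext K n :=
  if b (pos_i i) && ~~ b (pos_i1 i) then xvec (swap_bits i b) else 0.
Definition kexp (i : 'I_n.-1) (b : bvec n) : int :=
  (b (pos_i i) : nat)%:Z - (b (pos_i1 i) : nat)%:Z.
Definition act_K (i : 'I_n.-1) (b : bvec n) : ext K n :=
  q ^ kexp i b *: xvec b.
Definition act_Kinv (i : 'I_n.-1) (b : bvec n) : ext K n :=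
  q ^ (- kexp i b) *: xvec b.

(* v_0 (x) ... (x) v_(m-1) *)
Definition tensor (v : 'I_m -> ext K n) : tens K n m :=
  [ffun b' : {ffun 'I_m -> bvec n} => \prod_(l < m) v l (b' l)].

(* The tensor product of the operators A_0, ..., A_(m-1), extended linearly. *)
Definition tensor_op (A : 'I_m -> bvec n -> ext K n) (w : tens K n m) :
    tens K n m :=
  \sum_(b : {ffun 'I_m -> bvec n}) w b *: tensor (fun l => A l (b l)).

(* The m-fold iterations of the coproduct (the counit for m = 0):
     E_i |-> sum_j 1 (x) ... (x) 1 (x) E_i (x) K_i (x) ... (x) K_i
     F_i |-> sum_j K_i^-1 (x) ... (x) K_i^-1 (x) F_i (x) 1 (x) ... (x) 1
     K_i |-> K_i (x) ... (x) K_i *)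
Definition tensE (i : 'I_n.-1) (w : tens K n m) : tens K n m :=
  \sum_(j < m) tensor_op (fun l =>
     if (l < j)%N then act_1 else if l == j then act_E i else act_K i) w.
Definition tensF (i : 'I_n.-1) (w : tens K n m) : tens K n m :=
  \sum_(j < m) tensor_op (fun l =>
     if (l < j)%N then act_Kinv i else if l == j then act_F i else act_1) w.
Definition tensK (i : 'I_n.-1) (w : tens K n m) : tens K n m :=
  tensor_op (fun=> act_K i) w.

(* The subspace V(k) spanned by the basis vectors whose j-th factor is in
   V_(k j). *)
Definition in_V (k : 'I_m -> nat) (w : tens K n m) : Prop :=
  forall b, w b != 0 -> forall j, ones (b j) = k j.

Definition in_Inv (k : 'I_m -> nat) (w : tens K n m) : Prop :=
  in_V k w /\
  forall i, [/\ tensE i w = 0, tensF i w = 0 & tensK i w = w].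

Definition x_of (G : plane_map m) (S : colored_strands n G) : tens K n m :=
  xtens [ffun j => boundary_label S j].

Definition web_vector (G : plane_map m) : tens K n m :=
  \sum_(S in valid_strandings n G)
     (- q) ^ ((x_stat S)%:Z - (y_stat S)%:Z) *: x_of S.

End Representations.

(* The field C(q), with C = R[i]. *)
Definition Cq (R : realType) : fieldType := {fraction {poly R[i]}}.
Definition qvar (R : realType) : Cq R := tofrac 'X.

Definition free_webs (R : realType) n m (k : 'I_m -> nat) :=
  {malg (Cq R)[webs n k]}.
HB.instance Definition _ (R : realType) n m (k : 'I_m -> nat) :=
  GRing.Lmodule.copy (free_webs R n k) {malg (Cq R)[webs n k]}.

Definition free_web (R : realType) n m (k : 'I_m -> nat) (G : web n k) :
  free_webs R n k := mkmalgU (\pi_(webs n k) G) 1.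

(* Main.v *)
(* A valid stranding is determined by the binary labels of the edges. Reversing
   the open strand K for the positions i, i+1 that ends at a given boundary
   vertex swaps the bits i and i+1 along K. This defines an involution on the
   terms of E_i f(G) and of F_i f(G), and paired terms cancel because
   - the other strands for i, i+1 do not cross K, so that their contributions to
     the power of q coming from the boundary vertices between the ends of K
     cancel out;
   - x(S) - y(S) changes by exactly one.
   For the second point, the contribution of a strand to y(S) - x(S) is, by a
   discrete Gauss-Bonnet formula, the sum of a turning number at each of its
   vertices and of the enclosed curvature, which is a linear function of the flow
   along the strand. At each vertex of K the swap permutes the pairs of positions
   other than (i, i+1), so it preserves the sum of the turning numbers and of the
   flows over these pairs; only the orientation of K itself matters.
   Planarity is used in the form of Euler's formula: comparing the ranks of the
   incidence matrices of the graph and of its dual, it implies that a simple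
   closed curve separates the plane and that its bounded side has Euler
   characteristic 1. *)
Require Import Defs.
From HB Require Import structures.
From mathcomp Require Import all_boot all_order all_algebra perm.
From mathcomp Require Import generic_quotient fraction.
From mathcomp Require Import boolp reals.
From mathcomp Require Import complex.
From mathcomp Require Import finmap monalg.
From mathcomp Require Import zify ring lra.

Set Implicit Arguments.
Unset Strict Implicit.
Unset Printing Implicit Defensive.

(* [Defs] again: [rot] must not be [seq.rot]. *)
Import Defs GRing.Theory Num.Theory.

(** The obstacle is that an exchange along [K] does not match strands with strands. A strand for the
    positions [i] and [c] that follows [K] for a while is cut where it joins or leaves [K], and its
    pieces are reglued with pieces of strands for [i] and [c+1]. The winding therefore has to become
    a sum over darts whose terms see only the labels around one vertex. The turning part has this
    property by trivalence ([local_turn]); the enclosed curvature obtains it by duality, as a sum of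
    fixed weights [lam] on the darts that serve all curves at once. Open strands become closed
    curves when the axis is contracted to the hub. Several strands meet there, so strands are linked
    by [vtx], which keeps the boundary vertices apart, while curves, sides and Euler's formula use
    [hvtx]. A strand passes through the hub at most once, so the 1/2 counted there does not depend
    on the ends it joins. Labels sit on darts, complementary on the two darts of an edge. Vertex
    conditions then ignore edge directions, and every pair of positions gives a flow whose reversal
    belongs to the opposite pair. *)

Local Open Scope ring_scope.

(* The matrices [a] and [b] compose to zero, the rows of [a] are independent and
   the columns of [b] become independent once the rows in [T] are adjoined. *)
Lemma rank_bound (I J V : finType) (X : {set I}) (H : {set J}) (W T : {set V})
    (a : I -> J -> rat) (b : J -> V -> rat) :
  (forall i v, i \in X -> v \in W -> \sum_(j in H) a i j * b j v = 0) ->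
  (forall w : I -> rat, (forall j, j \in H -> \sum_(i in X) w i * a i j = 0) ->
     forall i, i \in X -> w i = 0) ->
  (forall g : V -> rat, (forall j, j \in H -> \sum_(v in W) b j v * g v = 0) ->
     (forall v, v \in T -> g v = 0) -> forall v, v \in W -> g v = 0) ->
  (#|X| + #|W| <= #|H| + #|T|)%N.
Proof.
move=> ab0 rowfree colfree.
pose A := \matrix_(i < #|X|, j < #|H|) a (enum_val i) (enum_val j).
pose B := \matrix_(j < #|H|, v < #|W|) b (enum_val j) (enum_val v).
pose D := \matrix_(t < #|T|, v < #|W|) ((enum_val t == enum_val v)%:R : rat).
have AB : A *m B = 0.
  apply/matrixP=> i v; rewrite !mxE.
  under eq_bigr do rewrite !mxE.
  by rewrite -(big_enum_val (fun j => a (enum_val i) j * b j (enum_val v)))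
     ab0 ?enum_valP.
have rA : \rank A = #|X|.
  apply/eqP; rewrite -/(row_free A) -kermx_eq0; apply/rowV0P=> u /sub_kermxP uA.
  pose w i := if [pick k : 'I_#|X| | enum_val k == i] is Some k then u 0 k
    else 0.
  have wE k : w (enum_val k) = u 0 k.
    rewrite /w; case: pickP => [k' /eqP/enum_val_inj -> //|/(_ k)].
    by rewrite eqxx.
  apply/rowP=> k; rewrite mxE -wE; apply: (rowfree w); last exact: enum_valP.
  move=> j jH; move/rowP/(_ (enum_rank_in jH j)): uA; rewrite !mxE => uAj.
  rewrite -[RHS]uAj (big_enum_val (fun i => w i * a i j));
    apply: eq_bigr => i _.
  by rewrite wE !mxE enum_rankK_in.
have rBD : \rank (col_mx B D) = #|W|.
  rewrite -mxrank_tr; apply/eqP; rewrite -/(row_free _) -kermx_eq0.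
  apply/rowV0P=> u /sub_kermxP; rewrite tr_col_mx mul_mx_row.
  move/eqP; rewrite row_mx_eq0 => /andP[/eqP uB /eqP uD].
  pose g v := if [pick k : 'I_#|W| | enum_val k == v] is Some k then u 0 k
    else 0.
  have gE k : g (enum_val k) = u 0 k.
    rewrite /g; case: pickP => [k' /eqP/enum_val_inj -> //|/(_ k)].
    by rewrite eqxx.
  apply/rowP=> k; rewrite mxE -gE; apply: colfree; last exact: enum_valP.
    move=> j jH; move/rowP/(_ (enum_rank_in jH j)): uB; rewrite !mxE => uBj.
    rewrite -[RHS]uBj (big_enum_val (fun v => b j v * g v));
      apply: eq_bigr => v _.
    by rewrite gE !mxE enum_rankK_in // mulrC.
  move=> v vT; move/rowP/(_ (enum_rank_in vT v)): uD; rewrite !mxE => uDv.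
  (* An element of [T] outside [W] gives a zero row of [D]; there [g] has its default value 0. *)
  have [vW|vW] := boolP (v \in W); last first.
    rewrite /g; case: pickP => // l /eqP lv.
    by rewrite -lv enum_valP in vW.
  rewrite -(enum_rankK_in vW vW) gE -{}[RHS]uDv (bigD1 (enum_rank_in vW v)) //=.
  rewrite !mxE !enum_rankK_in // eqxx mulr1 big1 ?addr0 // => l.
  rewrite !mxE enum_rankK_in // => lv; case: eqP => [e|]; last by rewrite mulr0.
  by case/eqP: lv; apply: enum_val_inj; rewrite enum_rankK_in.
(* The ranks of [A] and [B] add up to at most [#|H|], while the [#|T|] rows of [D] suffice to raise
   the rank of [B] to [#|W|]. *)
have le1 := mulmx0_rank_max AB; rewrite rA in le1.
have: (\rank (col_mx B D) <= \rank B + \rank D)%N.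
  by rewrite -addsmxE mxrank_adds_leqif.
by rewrite rBD => le2; have le3 := rank_leq_row D; lia.
Qed.

(** * Binary labels and colors *)

Section Bits.
Variable n : nat.
Implicit Types (v : bvec n) (c : 'I_n.-1) (p : 'I_n).

(** Indexing by natural numbers lets sums over colors telescope between [c] and [c.+1] without casts
    from ['I_n.-1] to ['I_n]. *)
Definition bitz v (k : nat) : int :=
  if insub k is Some p then (v p : nat)%:Z else 0.

Lemma bitz_val v p : bitz v p = (v p : nat)%:Z.
Proof. by rewrite /bitz valK. Qed.

Definition dbit v c : int := (v (pos_i c) : nat)%:Z - (v (pos_i1 c) : nat)%:Z.

Lemma dbitE v c : dbit v c = bitz v c - bitz v c.+1.
Proof. by rewrite /dbit -!bitz_val. Qed.

Lemma sum_dbit v (k l : nat) : (k <= l <= n.-1)%N ->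
  \sum_(c < n.-1 | (k <= c < l)%N) dbit v c = bitz v k - bitz v l.
Proof.
case/andP=> kl ln; under eq_bigr do rewrite dbitE.
rewrite -(@big_ord_widen_cond _ _ _ _ _ (fun c : nat => (k <= c)%N)
  (fun c : nat => bitz v c - bitz v c.+1) ln).
rewrite -(big_geq_mkord _ _ predT (fun c : nat => bitz v c - bitz v c.+1)).
rewrite -[LHS]opprK -sumrN; under eq_bigr do rewrite opprB.
by rewrite telescope_sumr // opprB.
Qed.

Lemma sum_dbit_ge v (k : nat) : (k <= n.-1)%N ->
  \sum_(c < n.-1 | (k <= c)%N) dbit v c = bitz v k - bitz v n.-1.
Proof.
move=> kn; rewrite -sum_dbit ?kn ?leqnn //; apply: eq_bigl => c.
by rewrite ltn_ord andbT.
Qed.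

Lemma onesE v : (ones v)%:Z = \sum_p (v p : nat)%:Z.
Proof.
rewrite /ones -sum1_card (big_morph Posz PoszD (erefl _)) big_mkcond.
by apply: eq_bigr => p _; rewrite inE; case: (v p).
Qed.

(** Abel summation. The correction by [n] times the last bit is the case distinction in
    [weight_condition]: the number of ones is the weight whichever sign the largest color has. *)
Lemma sum_dbit_weight v : (0 < n)%N ->
  \sum_(c < n.-1) dbit v c * c.+1%:Z = (ones v)%:Z - n%:Z * bitz v n.-1.
Proof.
move=> n0; have abel (u : nat -> int) M :
    \sum_(c < M) (u c - u c.+1) * c.+1%:Z = \sum_(c < M) u c - M%:Z * u M.
  elim: M => [|M IH]; first by rewrite !big_ord0 mul0r subrr.
  by rewrite !big_ord_recr /= IH -addn1 PoszD; ring.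
under eq_bigr do rewrite dbitE.
rewrite abel onesE; under [in RHS]eq_bigr do rewrite -bitz_val.
rewrite -(big_mkord predT (bitz v)) -(big_mkord predT (bitz v)) /=.
have -> : \sum_(0 <= k < n) bitz v k = \sum_(0 <= k < n.-1) bitz v k + bitz v
  n.-1.
  by rewrite -{1}(prednK n0) big_nat_recr.
have -> : n%:Z = n.-1%:Z + 1 by rewrite -PoszD addn1 prednK.
by ring.
Qed.

(** Between consecutive jumps the bits are constant, and a sequence of zeros and ones cannot rise
    twice, or fall twice, in a row. *)
Lemma dbit_alternate v c c' : (c < c')%N -> dbit v c != 0 -> dbit v c' != 0 ->
  (forall c'', (c < c'' < c')%N -> dbit v c'' = 0) -> dbit v c' = - dbit v c.
Proof.
move=> lt h h' h0; have : bitz v c.+1 - bitz v c' = 0.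
  have cc' : (c.+1 <= c' <= n.-1)%N by rewrite lt (ltnW (ltn_ord c')).
  by rewrite -(sum_dbit v cc') big1.
have -> : bitz v c.+1 = (v (pos_i1 c) : nat)%:Z by rewrite -bitz_val.
have -> : bitz v c' = (v (pos_i c') : nat)%:Z by rewrite -bitz_val.
by move: h h'; rewrite /dbit; do 4 case: (v _).
Qed.

(** Beyond the last jump all bits equal the last one, so the direction of that jump reveals it. *)
Lemma dbit_max v c : dbit v c != 0 ->
  (forall c', (c < c')%N -> dbit v c' = 0) ->
  (dbit v c == 1) = (bitz v n.-1 == 0) /\ (dbit v c == -1) = (bitz v n.-1 == 1).
Proof.
move=> h h0; have : bitz v c.+1 - bitz v n.-1 = 0.
  by rewrite -sum_dbit_ge //= big1.
move/eqP; rewrite subr_eq0 => /eqP <-.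
have -> : bitz v c.+1 = (v (pos_i1 c) : nat)%:Z by rewrite -bitz_val.
by move: h; rewrite /dbit; do 2 case: (v _).
Qed.

Lemma bitz01 v k : bitz v k = 0 \/ bitz v k = 1.
Proof. by rewrite /bitz; case: insubP => [p _ _|_]; [case: (v p)|]; auto. Qed.

Lemma dbit_ex v : (0 < ones v < n)%N -> exists c, dbit v c != 0.
Proof.
move=> /andP[h1 h2]; apply/existsP; apply: contraT => /existsPn h.
have := sum_dbit_weight v (ltn_trans h1 h2).
rewrite big1 => [|c _]; last by have := h c; rewrite negbK => /eqP ->;
  rewrite mul0r.
by case: (bitz01 v n.-1) => ->; lia.
Qed.

Lemma max_nonzero (A : 'I_n.-1 -> int) c0 : A c0 != 0 ->
  exists c, A c != 0 /\ forall c', (c < c')%N -> A c' = 0.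
Proof.
move=> h; have [c hc hm] := @arg_maxnP _ c0 (fun c => A c != 0) val h.
exists c; split=> // c' cc'; apply/eqP; apply: contraTT cc' => /hm.
by rewrite -leqNgt.
Qed.

Section Reconstruct.
Variables (A : 'I_n.-1 -> int) (cm : 'I_n.-1).
Hypothesis A01 : forall c, [\/ A c = 0, A c = 1 | A c = -1].
Hypothesis Aalt : forall c c', (c < c')%N -> A c != 0 -> A c' != 0 ->
  (forall c'', (c < c'' < c')%N -> A c'' = 0) -> A c' = - A c.
Hypothesis cm0 : A cm != 0.
Hypothesis cmax : forall c, (cm < c)%N -> A c = 0.

Let s (k : nat) : int := ((A cm == -1) : nat)%:Z + \sum_(c < n.-1 | (k <= c)%N)
  A c.

Lemma tail_sum_step c : s c = A c + s c.+1.
Proof.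
rewrite /s (bigD1 c) //= addrCA; congr (_ + (_ + _)).
by apply: eq_bigl => c'; rewrite andbC -(inj_eq val_inj) /= ltn_neqAle eq_sym.
Qed.

(* [s k] is 1 or 0 according to the sign of the first nonzero [A c] with
   [k <= c]; it is the last bit if there is none. *)
Lemma tail_sum01 k : (k <= n.-1)%N -> (s k = 0 \/ s k = 1) /\
  (forall c, (k <= c)%N -> A c != 0 ->
     (forall c', (k <= c' < c)%N -> A c' = 0) ->
   s k = ((A c == 1) : nat)%:Z).
Proof.
elim: {k}(n.-1 - k)%N {-2}k (erefl (n.-1 - k)%N) => [|d IH] k dk kn.
  have ke : k = n.-1 by apply/eqP; rewrite eqn_leq kn -subn_eq0 dk.
  split=> [|c]; last by rewrite ke leqNgt ltn_ord.
  rewrite /s big_pred0 => [|c]; last by rewrite ke leqNgt ltn_ord.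
  by rewrite addr0; case: (_ == _); auto.
have kn' : (k < n.-1)%N by rewrite -subn_gt0 dk.
pose c0 := Ordinal kn'; have [|h1 h2] := IH k.+1 _ kn';
  first by rewrite subnS dk.
have sE : s k = A c0 + s k.+1 := tail_sum_step c0.
have first c : (k <= c)%N -> A c != 0 -> (forall c', (k <= c' < c)%N ->
  A c' = 0) ->
    A c0 != 0 -> c = c0.
  move=> kc _ hz n0; apply: val_inj; apply/eqP; rewrite eqn_leq kc andbT leqNgt.
  by apply/negP=> lt; case/eqP: n0; apply: hz; rewrite leqnn.
have [z0|n0] := eqVneq (A c0) 0.
  rewrite sE z0 add0r; split=> // c kc nc hz; apply: h2 => //.
    rewrite ltn_neqAle kc andbT; apply: contraNneq nc => e.
    by rewrite (_ : c = c0) ?z0 //; apply: val_inj; rewrite /= e.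
  by move=> c' /andP[h h']; apply: hz; rewrite ltnW.
suff e : s k = ((A c0 == 1) : nat)%:Z.
  by split=> [|c kc nc hz]; [rewrite e; case: (_ == _);
    auto | rewrite (first c)].
case: (boolP [exists c : 'I_n.-1, (k < c)%N && (A c != 0)]).
  case/existsP=> c1 hc1.
  have [c /andP[kc nc] hm] := @arg_minnP _ c1 (fun c => (k < c)%N &&
    (A c != 0)) val hc1.
  have hz c' : (k < c' < c)%N -> A c' = 0.
    case/andP=> kc' c'c; apply/eqP; apply: contraTT c'c => nc'.
    by rewrite -leqNgt hm // kc' nc'.
  (* By alternation [A c0 = - A c], while [s k.+1] is 1 or 0 as [A c] is 1 or -1; the sum is again a
     bit. *)
  have e1 := Aalt (kc : (c0 < c)%N) n0 nc hz; rewrite sE (h2 c) //.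
  by rewrite e1; case: (A01 c0) n0 => -> // _.
(* With no nonzero value after [k], the color [k] is the largest one, and the constant term of [s]
   is the last bit. *)
move/existsPn=> h; have hz c : (k < c)%N -> A c = 0.
  by move=> kc; have := h c; rewrite kc /= negbK => /eqP.
have cm_c0 : cm = c0.
  apply: val_inj; apply/eqP; rewrite eqn_leq; apply/andP; split.
    by rewrite leqNgt; apply: contra cm0 => /hz ->.
  by rewrite leqNgt; apply: contra n0 => /cmax ->.
rewrite sE /s big1 ?addr0 => [|c kc]; last exact: hz.
by rewrite cm_c0; case: (A01 c0) n0 => -> // _.
Qed.

Definition bits_of : bvec n :=
  [ffun p : 'I_n => ((A cm == -1) : nat)%:Z + \sum_(c < n.-1 | (p <= c)%N) A c
    == 1].

Lemma bits_ofE p : (bits_of p : nat)%:Z = s p.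
Proof.
rewrite ffunE -/(s p); have pn : (p <= n.-1)%N by rewrite -ltnS prednK //
  (leq_ltn_trans _ (ltn_ord p)).
by have [[->|->] _] := tail_sum01 pn.
Qed.

Lemma dbit_bits_of c : dbit bits_of c = A c.
Proof. by rewrite /dbit !bits_ofE /= tail_sum_step addrK. Qed.

Lemma bitz_bits_of : bitz bits_of n.-1 = ((A cm == -1) : nat)%:Z.
Proof.
have n1 : (0 < n.-1)%N := leq_ltn_trans (leq0n cm) (ltn_ord cm).
have n0 : (n.-1 < n)%N by rewrite ltn_predL (leq_trans n1) ?leq_pred.
rewrite -[n.-1]/(val (Ordinal n0)) bitz_val bits_ofE /s big_pred0
  ?addr0 // => c.
by rewrite leqNgt ltn_ord.
Qed.

End Reconstruct.
End Bits.

(** * The action on tensor products of basis vectors *)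

Section TensorBasis.
Variables (F : fieldType) (q : F) (n m : nat).
Hypothesis q0 : q != 0.
Implicit Types (A : 'I_m -> bvec n -> ext F n) (B : {ffun 'I_m -> bvec n})
  (c : 'I_n.-1).

Lemma tensor_op_sum (I : finType) (P : pred I) A (a : I -> F) (w : I ->
  tens F n m) :
  tensor_op A (\sum_(i | P i) a i *: w i) = \sum_(i | P i) a i *: tensor_op A
    (w i).
Proof.
rewrite /tensor_op; under [RHS]eq_bigr do rewrite scaler_sumr.
rewrite exchange_big; apply: eq_bigr => b _; rewrite sum_ffunE scaler_suml.
by apply: eq_bigr => i _; rewrite ffunE scalerA.
Qed.

Lemma tensor_op_basis A B : tensor_op A (xtens F B) = tensor
  (fun l => A l (B l)).
Proof.
rewrite /tensor_op (bigD1 B) //= ffunE eqxx scale1r big1 ?addr0 // => b /negbTE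
  h.
by rewrite ffunE h scale0r.
Qed.

Lemma tensor_basis (a : 'I_m -> F) (v : 'I_m -> ext F n) B :
  (forall l, v l = a l *: xvec F (B l)) ->
  tensor v = (\prod_l a l) *: xtens F B.
Proof.
move=> vE; apply/ffunP=> b'; rewrite !ffunE.
rewrite (eq_bigr (fun l => a l * (b' l == B l)%:R)); last first.
  by move=> l _; rewrite vE !ffunE.
rewrite big_split /=; congr (_ * _).
case: eqP => [->|/eqP ne]; first by rewrite big1 // => l _; rewrite eqxx.
have [l hl] : exists l, b' l != B l.
  apply/existsP; apply: contraR ne => /existsPn h; apply/eqP/ffunP=> l.
  by apply/eqP; have := h l; rewrite negbK.
by rewrite (bigD1 l) //= (negbTE hl) mul0r.
Qed.

Lemma exprz_sum (I : finType) (P : pred I) (f : I -> int) :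
  q ^ (\sum_(i | P i) f i) = \prod_(i | P i) q ^ f i.
Proof. by apply: (big_morph (fun z => q ^ z)) => // x y; rewrite expfzDr. Qed.

Definition swap_at c B (j : 'I_m) : {ffun 'I_m -> bvec n} :=
  [ffun l => if l == j then swap_bits c (B l) else B l].

Lemma swap_atE c B j l p : swap_at c B j l p =
  if l == j then B l (tperm (pos_i c) (pos_i1 c) p) else B l p.
Proof. by rewrite ffunE; case: eqP => // _; rewrite ffunE. Qed.

Lemma tensE_basis c B : tensE q c (xtens F B) =
  \sum_(j | ~~ B j (pos_i c) && B j (pos_i1 c))
    q ^ (\sum_(l < m | (j < l)%N) kexp c (B l)) *: xtens F (swap_at c B j).
Proof.
rewrite [RHS]big_mkcond; apply: eq_bigr => j _; rewrite tensor_op_basis.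
pose cond := ~~ B j (pos_i c) && B j (pos_i1 c).
rewrite (tensor_basis (a := fun l : 'I_m => if (l < j)%N then 1 else
    if l == j then cond%:R else q ^ kexp c (B l)) (B := swap_at c B j));
      last first.
  move=> l; rewrite ffunE; have [->|lj] := eqVneq l j; last first.
    by case: ifP => _; rewrite ?scale1r.
  by rewrite ltnn /act_E -/cond; case: cond; rewrite ?scale1r ?scale0r.
rewrite (bigD1 j) //= ltnn eqxx -/cond; case: cond;
  last by rewrite mul0r scale0r.
rewrite mul1r exprz_sum; congr (_ *: _); rewrite big_mkcond [RHS]big_mkcond.
apply: eq_bigr => l _; rewrite -(inj_eq val_inj) /=.
by case: (ltngtP l j).
Qed.

Lemma tensF_basis c B : tensF q c (xtens F B) =
  \sum_(j | B j (pos_i c) && ~~ B j (pos_i1 c))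
    q ^ (- \sum_(l < m | (l < j)%N) kexp c (B l)) *: xtens F (swap_at c B j).
Proof.
rewrite [RHS]big_mkcond; apply: eq_bigr => j _; rewrite tensor_op_basis.
pose cond := B j (pos_i c) && ~~ B j (pos_i1 c).
rewrite (tensor_basis (a := fun l : 'I_m => if (l < j)%N
  then q ^ (- kexp c (B l)) else
    if l == j then cond%:R else 1) (B := swap_at c B j)); last first.
  move=> l; rewrite ffunE; have [->|lj] := eqVneq l j; last first.
    by case: ifP => _; rewrite ?scale1r.
  by rewrite ltnn /act_F -/cond; case: cond; rewrite ?scale1r ?scale0r.
rewrite (bigD1 j) //= ltnn eqxx -/cond; case: cond;
  last by rewrite mul0r scale0r.
rewrite mul1r -sumrN exprz_sum; congr (_ *: _);
  rewrite big_mkcond [RHS]big_mkcond.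
apply: eq_bigr => l _; rewrite -(inj_eq val_inj) /=.
by case: (ltngtP l j).
Qed.

Lemma tensK_basis c B : tensK q c (xtens F B) = q ^ (\sum_l kexp c (B l))
  *: xtens F B.
Proof.
rewrite /tensK tensor_op_basis (tensor_basis (a := fun l => q ^ kexp c (B l))
  (B := B)) //.
by rewrite exprz_sum.
Qed.

Lemma tensE_sum (I : finType) (P : pred I) c (a : I -> F) (w : I -> tens F n m)
  :
  tensE q c (\sum_(i | P i) a i *: w i) = \sum_(i | P i) a i *: tensE q c (w i).
Proof.
rewrite /tensE; under eq_bigr do rewrite tensor_op_sum.
by rewrite exchange_big; apply: eq_bigr => i _; rewrite scaler_sumr.
Qed.

Lemma tensF_sum (I : finType) (P : pred I) c (a : I -> F) (w : I -> tens F n m)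
  :
  tensF q c (\sum_(i | P i) a i *: w i) = \sum_(i | P i) a i *: tensF q c (w i).
Proof.
rewrite /tensF; under eq_bigr do rewrite tensor_op_sum.
by rewrite exchange_big; apply: eq_bigr => i _; rewrite scaler_sumr.
Qed.

(** Reindexing along [h] turns the sum into its opposite, so twice the sum vanishes. *)
Lemma sum_involution (I : finType) (V : lmodType F) (P : pred I) (h : I -> I)
  (f : I -> V) :
  2%:R != 0 :> F -> (forall i, P i -> P (h i)) ->
    (forall i, P i -> h (h i) = i) ->
  (forall i, P i -> f (h i) = - f i) -> \sum_(i | P i) f i = 0.
Proof.
move=> two hP hK hf; apply/eqP; suff: 2%:R *: \sum_(i | P i) f i == 0.
  by rewrite scaler_eq0 (negbTE two).
rewrite scaler_nat mulr2n {1}(reindex_onto h h hK) addr_eq0 -sumrN; apply/eqP.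
apply: eq_big => [i|i /andP[Pi /eqP e]].
  apply/andP/idP=> [[/hP + /eqP e]|Pi]; first by rewrite e.
  by rewrite hP ?hK ?eqxx.
by rewrite hf // -e; apply: hP.
Qed.

End TensorBasis.

(** * Planar maps *)

Section Planar.
Variables (n m : nat) (G : plane_map m).
Hypothesis webG : is_web n G.
Notation dart := 'I_(ndart G).
Notation region := 'I_(nreg G).+1.
Notation bdry := (codom (bd G)).
Implicit Types (d x y z : dart) (r : region) (K U : {set dart}) (j : 'I_m).

Lemma flipK : involutive (flip G).
Proof. by case: webG => h _ _ _ _ d; case: (h d). Qed.

Lemma flip_neq d : flip G d != d.
Proof. by case: webG => h _ _ _ _; case: (h d). Qed.

Lemma flip_inj : injective (flip G).
Proof. exact: perm_inj. Qed.

Lemma bd_inj : injective (bd G).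
Proof. by case: webG => _ [? _]. Qed.

Lemma fwd_flip d : (flip G d \in fwd G) = (d \notin fwd G).
Proof. by case: webG => _ _ _ h _; case: (h d); do 2 case: (_ \in _). Qed.

Lemma vtxE d : vtx d = porbit (rot G) d.
Proof. by apply/setP=> x; rewrite inE. Qed.

Lemma vtx_id d : d \in vtx d.
Proof. by rewrite vtxE porbit_id. Qed.

Lemma vtx_eq d d' : (vtx d == vtx d') = (d \in vtx d').
Proof. by rewrite !vtxE eq_porbit_mem. Qed.

Lemma vtx_mem d d' : d \in vtx d' -> vtx d = vtx d'.
Proof. by rewrite -vtx_eq => /eqP. Qed.

Lemma vtx_rot d : vtx (rot G d) = vtx d.
Proof.
by apply: vtx_mem; rewrite vtxE; have := mem_porbit (rot G) 1 d; rewrite expg1.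
Qed.

Lemma vtx_bd j : vtx (bd G j) = [set bd G j].
Proof. by case: webG => _ [_ h] _ _ _; apply: h. Qed.

Lemma vtx_bdry d d' : d \in bdry -> vtx d = vtx d' -> d = d'.
Proof.
case/codomP=> j ->; rewrite vtx_bd => e.
by move: (vtx_id d'); rewrite -e inE => /eqP.
Qed.

Lemma bd_codom j : bd G j \in bdry.
Proof. exact: codom_f. Qed.

Lemma rot_bd j : rot G (bd G j) = bd G j.
Proof. by move: (vtx_id (rot G (bd G j))); rewrite vtx_rot vtx_bd inE => /eqP.
  Qed.

Lemma rot_bdry d : (rot G d \in bdry) = (d \in bdry).
Proof.
apply/codomP/codomP=> [] [j e]; exists j; last by rewrite e rot_bd.
by apply: (@perm_inj _ (rot G)); rewrite rot_bd.
Qed.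

Lemma hrot_bd j : hrot (bd G j) = bd G (ordS j).
Proof.
rewrite /hrot; case: pickP => [j' /eqP/bd_inj -> //|/(_ j)].
by rewrite eqxx.
Qed.

Lemma hrot_nbd d : d \notin bdry -> hrot d = rot G d.
Proof.
by move=> h; rewrite /hrot; case: pickP => // j /eqP e;
  rewrite -e bd_codom in h.
Qed.

Lemma hrot_bdry d : (hrot d \in bdry) = (d \in bdry).
Proof.
have [/codomP[j ->]|h] := boolP (d \in bdry);
  first by rewrite hrot_bd !bd_codom.
by rewrite hrot_nbd // rot_bdry (negbTE h).
Qed.

Lemma hrot_inj : injective (@hrot m G).
Proof.
move=> d d' e; have := hrot_bdry d; rewrite e hrot_bdry.
have [/codomP[j dE]|h] := boolP (d \in bdry).
  move/codomP=> [j' d'E]; move: e; rewrite dE d'E !hrot_bd.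
  by move=> /bd_inj e; rewrite (can_inj (@ordSK _) e).
by move/negbT=> h'; move: e; rewrite !hrot_nbd //; apply: perm_inj.
Qed.

(* The vertex of [d] once the axis is contracted to the hub, represented by one
   of its darts. *)
Definition hvtx d : dart := froot (@hrot m G) d.

Lemma hvtx_sym : connect_sym (frel (@hrot m G)).
Proof. exact: fconnect_sym hrot_inj. Qed.

Lemma hvtx_eq d d' : (hvtx d == hvtx d') = fconnect (@hrot m G) d d'.
Proof. by rewrite /hvtx root_connect //; exact: hvtx_sym. Qed.

Lemma hvtx_hrot d : hvtx (hrot d) = hvtx d.
Proof. by apply/eqP; rewrite eq_sym hvtx_eq fconnect1. Qed.

Lemma hvtx_hvtx d : hvtx (hvtx d) = hvtx d.
Proof. exact: (root_root hvtx_sym). Qed.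

Lemma hvtx_bdry d d' : hvtx d = hvtx d' -> (d \in bdry) = (d' \in bdry).
Proof.
move/eqP; rewrite hvtx_eq; apply: fconnect_invariant => x.
by apply/eqP/hrot_bdry.
Qed.

Lemma hvtx_vtx d d' : d \notin bdry -> (hvtx d == hvtx d') = (vtx d == vtx d').
Proof.
move=> h; rewrite hvtx_eq; apply/idP/idP=> [c|].
  pose k x := if x \in bdry then set0 else vtx x.
  have kE x : k (hrot x) == k x.
    rewrite /k hrot_bdry; case: ifP => // /negbT hx.
    by rewrite hrot_nbd // vtx_rot.
  have := @fconnect_invariant _ _ _ k kE _ _ c.
  rewrite /k -(hvtx_bdry (d := d)) ?(negbTE h); last exact/eqP/etrans/c/hvtx_eq.
  by move=> ->.
rewrite eq_sym vtx_eq vtxE => /porbitP[i ->].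
elim: i => [|i IH]; first by rewrite expg0 perm1 connect0.
have hi : (rot G ^+ i)%g d \notin bdry.
  elim: i {IH} => [|i IH]; first by rewrite expg0 perm1.
  by rewrite expgSr permM rot_bdry.
apply: connect_trans IH _; rewrite expgSr permM -hrot_nbd //.
exact: fconnect1.
Qed.

Lemma hvtx_bd i j : hvtx (bd G i) = hvtx (bd G j).
Proof.
suff h (k : nat) : forall i : 'I_m, i = k :> nat ->
    forall j : 'I_m, j = 0 :> nat -> hvtx (bd G i) = hvtx (bd G j).
  have m0 : (0 < m)%N := leq_ltn_trans (leq0n i) (ltn_ord i).
  by rewrite (h _ i erefl (Ordinal m0)) ?(h _ j erefl (Ordinal m0)).
elim: k => [|k IH] {}i ik {}j j0.
  by congr (hvtx (bd G _)); apply: val_inj; rewrite /= ik j0.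
have km : (k < m)%N by rewrite -ltnS -ik ltnW // ltnS ltn_ord.
rewrite -(IH (Ordinal km) erefl j j0) -(hvtx_hrot (bd G (Ordinal km))) hrot_bd.
congr (hvtx (bd G _)); apply: val_inj; rewrite /= ik modn_small //.
by rewrite -ik ltn_ord.
Qed.

Lemma reg_hrot d : reg G (flip G (hrot d)) = reg G d.
Proof. by case: webG => _ _ [h _ _ _] _ _; apply: h. Qed.

Lemma reg_all r : outside set0 r.
Proof. by case: webG => _ _ [_ _ h _] _ _; apply: h. Qed.

Lemma euler : euler_formula G.
Proof. by case: webG => _ _ []. Qed.

Lemma reg_last (j : 'I_m) : j.+1 = m -> reg G (bd G j) = ord0.
Proof. by case: webG => _ _ [_ h _ _] _ _; apply: h. Qed.

Lemma adj_sym K : symmetric (adjacent_off K).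
Proof.
suff h r r' : adjacent_off K r r' -> adjacent_off K r' r.
  by move=> r r'; apply/idP/idP; apply: h.
case/existsP=> d /and4P[h1 h2 h3 h4]; apply/existsP; exists (flip G d).
by rewrite flipK h1 h2 h3 h4.
Qed.

Lemma adj_csym K : connect_sym (adjacent_off K).
Proof. exact: sym_connect_sym (adj_sym K). Qed.

Lemma adj_off K d : d \notin K -> flip G d \notin K ->
  adjacent_off K (reg G d) (reg G (flip G d)).
Proof. by move=> h1 h2; apply/existsP; exists d; rewrite h1 h2 !eqxx. Qed.

Lemma cadj_off K d : d \notin K -> flip G d \notin K ->
  connect (adjacent_off K) (reg G d) (reg G (flip G d)).
Proof. by move=> h1 h2; apply/connect1/adj_off. Qed.

(** * Curves and their sides *)

Definition reversal K : {set dart} := [set d | flip G d \in K].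

Lemma in_reversal K d : (d \in reversal K) = (flip G d \in K).
Proof. by rewrite inE. Qed.

Definition curve_link K : rel dart :=
  [rel x y | [&& x \in K, y \in K & (hvtx (flip G x) == hvtx y) ||
    (hvtx (flip G y) == hvtx x)]].

(* A simple directed closed curve in the plane graph obtained by contracting the
   axis to the hub. *)
Record is_curve K : Prop := IsCurve {
  curve_ex : exists d, d \in K;
  curve_anti : {in K, forall d, flip G d \notin K};
  curve_out : {in K &, injective hvtx};
  curve_in : {in K &, forall d d', hvtx (flip G d) = hvtx (flip G d') ->
    d = d'};
  curve_next : {in K, forall d, exists2 d', d' \in K & hvtx d' = hvtx
    (flip G d)};
  curve_conn : {in K &, forall d d', connect (curve_link K) d d'}
}.

Lemma curve_verts K : is_curve K ->
  [set hvtx x | x in K] = [set hvtx (flip G x) | x in K].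
Proof.
move=> cK; apply/esym/eqP; rewrite eqEcard; apply/andP; split.
  apply/subsetP=> _ /imsetP[x xK ->]; have [y yK <-] := curve_next cK xK.
  exact: imset_f.
rewrite (card_in_imset (curve_out cK)).
by rewrite (@card_in_imset _ _ (fun x => hvtx (flip G x)) (mem K)
  (curve_in cK)).
Qed.

Lemma curve_prev K : is_curve K ->
  {in K, forall d, exists2 d', d' \in K & hvtx (flip G d') = hvtx d}.
Proof.
move=> cK d dK; have: hvtx d \in [set hvtx x | x in K] by exact: imset_f.
by rewrite curve_verts // => /imsetP[x xK e]; exists x.
Qed.

Lemma curve_reversal K : is_curve K -> is_curve (reversal K).
Proof.
move=> cK; split.
- by have [d dK] := curve_ex cK; exists (flip G d); rewrite in_reversal flipK.
- by move=> d; rewrite !in_reversal => h;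
  apply: contraL (curve_anti cK h) => ->.
- move=> d d'; rewrite !in_reversal => dK d'K e; apply: flip_inj.
  by apply: (curve_in cK); rewrite ?flipK.
- move=> d d'; rewrite !in_reversal => dK d'K e; apply: flip_inj.
  exact: (curve_out cK).
- move=> d; rewrite in_reversal => dK; have [x xK e] := curve_prev cK dK.
  by exists (flip G x); rewrite ?in_reversal ?flipK.
move=> d d'; rewrite !in_reversal => dK d'K.
have /connectP[p] := curve_conn cK dK d'K.
elim: p d dK => [|y p IH] d dK /= => [_ /flip_inj -> //|].
case/andP=> /and3P[_ yK h] hp e.
apply: (@connect_trans _ _ (flip G y)); last first.
  by apply: IH; rewrite flipK.
apply: connect1; rewrite /curve_link /= !in_reversal dK flipK yK /=.
by rewrite flipK in h; rewrite orbC eq_sym (eq_sym (hvtx (flip G d))).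
Qed.

Lemma adj_reversal K : adjacent_off (reversal K) =2 adjacent_off K.
Proof.
move=> r r'; apply: eq_existsb => d.
by rewrite !in_reversal flipK [RHS]andbCA.
Qed.

Lemma cadj_reversal K : connect (adjacent_off (reversal K)) =2 connect
  (adjacent_off K).
Proof. exact: eq_connect (adj_reversal K). Qed.

(** Turning counterclockwise from the dart that leaves the vertex to the reverse of the one that
    enters it sweeps the corners on the left of [K]. The darts passed in between are off [K],
    because [K] leaves and enters the vertex only once. *)
Lemma curve_left_step K : is_curve K -> {in K &, forall d d', hvtx (flip G d)
  = hvtx d' ->
  connect (adjacent_off K) (reg G d') (reg G d)}.
Proof.
move=> cK d d' dK d'K e.
have c : fconnect (@hrot m G) d' (flip G d) by rewrite -hvtx_eq e.
set k := findex (@hrot m G) d' (flip G d).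
have kE : iter k (@hrot m G) d' = flip G d by exact: iter_findex.
have kmax : (k < order (@hrot m G) d')%N by exact: findex_max.
have off t : (0 < t < k)%N -> (iter t (@hrot m G) d' \notin K) /\
    (flip G (iter t (@hrot m G) d') \notin K).
  move=> /andP[t0 tk].
  have hvt : hvtx (iter t (@hrot m G) d') = hvtx d'.
    by elim: (t) => //= u <-; rewrite hvtx_hrot.
  have tE : findex (@hrot m G) d' (iter t (@hrot m G) d') = t.
    by rewrite findex_iter // (ltn_trans tk).
  split; apply/negP=> h.
    have e' := curve_out cK h d'K hvt.
    by rewrite e' findex0 in tE; rewrite -tE in t0.
  have e' : flip G (iter t (@hrot m G) d') = d.
    by apply: (curve_in cK) => //; rewrite flipK hvt.
  by move: tE; rewrite -[iter t _ _]flipK e' -/k => kt; rewrite kt ltnn in tk.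
have k0 : (0 < k)%N.
  rewrite lt0n findex_eq0; apply: contraNneq (curve_anti cK dK) => <-.
  exact: d'K.
have walk t : (t < k)%N ->
    connect (adjacent_off K) (reg G d') (reg G (iter t (@hrot m G) d')).
  elim: t => [|t IH] tk; first exact: connect0.
  apply: connect_trans (IH (ltnW tk)) _ => /=.
  rewrite -reg_hrot adj_csym; have [] := off t.+1; first by rewrite tk.
  exact: cadj_off.
have := walk k.-1; rewrite prednK // => /(_ (leqnn _)).
rewrite -[reg G (iter _ _ _)]reg_hrot.
have -> : hrot (iter k.-1 (@hrot m G) d') = flip G d by rewrite -kE
  -[in RHS](prednK k0).
by rewrite flipK.
Qed.

Lemma curve_left K : is_curve K -> {in K &, forall d d',
  connect (adjacent_off K) (reg G d) (reg G d')}.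
Proof.
move=> cK d d' dK d'K; have /connectP[p] := curve_conn cK dK d'K.
elim: p d dK => [|y p IH] d dK /= => [_ -> //|].
case/andP=> /and3P[_ yK h] hp e; apply: connect_trans (IH _ yK hp e).
case/orP: h => /eqP h; last exact: (curve_left_step cK).
by rewrite adj_csym; apply: (curve_left_step cK).
Qed.

Lemma curve_right K : is_curve K -> {in K &, forall d d',
  connect (adjacent_off K) (reg G (flip G d)) (reg G (flip G d'))}.
Proof.
move=> cK d d' dK d'K; rewrite -cadj_reversal.
by apply: (curve_left (curve_reversal cK)); rewrite in_reversal flipK.
Qed.

Definition on_left K r := [exists d in K, connect (adjacent_off K) (reg G d) r].

Lemma on_left_conn K r r' : connect (adjacent_off K) r r' -> on_left K r
  = on_left K r'.
Proof.
move=> c; apply: eq_existsb => d; congr (_ && _).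
exact: (same_connect_r (adj_csym K)).
Qed.

Lemma on_left_off K d : d \notin K -> flip G d \notin K ->
  on_left K (reg G (flip G d)) = on_left K (reg G d).
Proof. by move=> h h'; apply/esym/on_left_conn/cadj_off. Qed.

Lemma on_left_mem K d : d \in K -> on_left K (reg G d).
Proof. by move=> dK; apply/existsP; exists d; rewrite dK connect0. Qed.

Lemma on_left_reversal K r : on_left (reversal K) r = [exists d in K, connect
  (adjacent_off K) (reg G (flip G d)) r].
Proof.
apply/existsP/existsP=> [] [d /andP[h c]]; exists (flip G d);
  by rewrite ?in_reversal ?cadj_reversal ?flipK;
    rewrite ?in_reversal ?cadj_reversal in h c; rewrite h.
Qed.

(** Crossing an edge of [K] leads from one side to the other, crossing any other edge changes
    nothing, and all regions are connected by crossings. *)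
Lemma on_left_or K r : is_curve K -> on_left K r || on_left (reversal K) r.
Proof.
move=> cK; have [d dK] := curve_ex cK.
have h r1 r2 : adjacent_off set0 r1 r2 -> 
    r1 \in [pred r | on_left K r || on_left (reversal K) r] ->
    r2 \in [pred r | on_left K r || on_left (reversal K) r].
  case/existsP=> x /and4P[_ _ /eqP <- /eqP <-]; rewrite !inE.
  have [xK|xK] := boolP (x \in K).
    by rewrite (on_left_mem (K := reversal K) (d := flip G x)) ?orbT //
      in_reversal flipK.
  have [xK'|xK'] := boolP (flip G x \in K).
    by rewrite (on_left_mem (K := K) (d := flip G x)).
  by rewrite on_left_off // (on_left_off (K := reversal K)) // in_reversal
    ?flipK.
have cl := intro_closed (adj_csym set0) h.
have := closed_connect cl (reg_all (reg G d)).
by rewrite (closed_connect cl (reg_all r)) !inE on_left_mem.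
Qed.

(** * Cycles, incidences and the separation of the plane by a curve *)

Definition coboundary r d : rat := (reg G d == r)%:R - (reg G (flip G d)
  == r)%:R.
Definition curve_flow K d : rat := (d \in K)%:R - (flip G d \in K)%:R.
Definition incidence d x : rat := (hvtx d == x)%:R - (hvtx (flip G d) == x)%:R.
Definition hvertices : {set dart} := [set x | hvtx x == x].
Definition croot d : dart := fingraph.root (@same_component m G) d.
Definition croots : {set dart} := [set x | croot x == x].
Definition verts K : {set dart} := [set hvtx x | x in K].

Lemma same_comp_sym : connect_sym (@same_component m G).
Proof.
apply: sym_connect_sym => d d'; rewrite /same_component /=.
have -> : (d' == flip G d) = (d == flip G d') by apply/eqP/eqP=> ->;
  rewrite flipK.
by congr (_ || _); rewrite orbC.
Qed.

Lemma croot_flip d : croot (flip G d) = croot d.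
Proof.
apply/eqP; rewrite eq_sym /croot root_connect; last exact: same_comp_sym.
by apply: connect1; rewrite /same_component /= eqxx.
Qed.

Lemma croot_hrot d : croot (hrot d) = croot d.
Proof.
apply/eqP; rewrite eq_sym /croot root_connect; last exact: same_comp_sym.
by apply: connect1; rewrite /same_component /= eqxx orbT.
Qed.

Lemma croot_croot d : croot (croot d) = croot d.
Proof. exact: (root_root same_comp_sym). Qed.

Lemma croot_hvtx d d' : hvtx d = hvtx d' -> croot d = croot d'.
Proof.
move/eqP; rewrite hvtx_eq; apply: fconnect_invariant => x.
by apply/eqP/croot_hrot.
Qed.

Lemma comp_invariant (T : eqType) (k : dart -> T) :
  (forall d, k (flip G d) = k d) -> (forall d, k (hrot d) = k d) ->
  forall d d', croot d = croot d' -> k d = k d'.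
Proof.
move=> kf kh d d' /eqP; rewrite root_connect; last exact: same_comp_sym.
case/connectP=> p + ->; elim: p d => //= y p IH d /andP[h /IH <-].
by case/or3P: h => /eqP ->; rewrite ?kf ?kh.
Qed.

Lemma sum_fwd (V : nmodType) (F : dart -> V) :
  \sum_(d in fwd G) F d + \sum_(d in fwd G) F (flip G d) = \sum_d F d.
Proof.
rewrite [RHS](bigID (mem (fwd G))) /=; congr (_ + _).
rewrite [RHS](reindex_inj flip_inj); apply: eq_bigl => d.
by rewrite fwd_flip negbK.
Qed.

Lemma sum_pred1 (T : finType) (F : T -> rat) (y : T) : \sum_x F x
  * (y == x)%:R = F y.
Proof.
rewrite (bigD1 y) //= eqxx mulr1 big1 ?addr0 // => x /negbTE.
by rewrite eq_sym => ->; rewrite mulr0.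
Qed.

Lemma flow_incidence (phi : dart -> rat) x : (forall d, phi (flip G d) = - phi
  d) ->
  \sum_(d | hvtx d == x) phi d = 0 -> \sum_(d in fwd G) phi d * incidence d x
    = 0.
Proof.
move=> anti e; rewrite -[RHS]e [RHS]big_mkcond /= -sum_fwd -big_split /=.
apply: eq_bigr => d _; rewrite anti /incidence.
by do 2 case: (_ == x); rewrite ?(mulr0, mulr1, subr0, sub0r, subrr, addr0,
  add0r, mulrN).
Qed.

Lemma coboundary_anti r d : coboundary r (flip G d) = - coboundary r d.
Proof. by rewrite /coboundary flipK opprB. Qed.

Lemma curve_flow_anti K d : curve_flow K (flip G d) = - curve_flow K d.
Proof. by rewrite /curve_flow flipK opprB. Qed.

Lemma sum_reg_hrot (F : region -> rat) (P : pred dart) :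
  (forall d, P (hrot d) = P d) ->
  \sum_(d | P d) F (reg G (flip G d)) = \sum_(d | P d) F (reg G d).
Proof.
move=> PE; rewrite (reindex_inj hrot_inj) /=.
by apply: eq_big => [d|d _]; rewrite ?PE ?reg_hrot.
Qed.

(** The boundary of a face is a cycle: around a vertex, the region to the left of a dart is the
    region to the right of the next one, so the two sums agree after one rotation. *)
Lemma coboundary_cons r x : \sum_(d | hvtx d == x) coboundary r d = 0.
Proof.
rewrite /coboundary sumrB (sum_reg_hrot (fun r' => (r' == r)%:R)) ?subrr //
  => d.
by rewrite hvtx_hrot.
Qed.

Lemma curve_vert_sum K x : is_curve K ->
  \sum_(d | hvtx d == x) (d \in K)%:R = (x \in verts K)%:R :> rat.
Proof.
move=> cK; have [/imsetP[y yK ->]|h] := boolP (x \in _).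
  rewrite (bigD1 y) //= yK big1 ?addr0 // => d /andP[/eqP e ne].
  case: (boolP (d \in K)) => // dK.
  by rewrite (curve_out cK dK yK e) eqxx in ne.
rewrite big1 // => d /eqP e; case: (boolP (d \in K)) => // dK.
by case/negP: h; rewrite -e imset_f.
Qed.

Lemma verts_reversal K : is_curve K -> verts (reversal K) = verts K.
Proof.
move=> cK; rewrite /verts [RHS]curve_verts //; apply/setP=> x.
apply/imsetP/imsetP=> [] [y yK ->];
  exists (flip G y); rewrite ?in_reversal ?flipK //.
by rewrite in_reversal in yK.
Qed.

Lemma curve_flow_cons K x : is_curve K -> \sum_(d | hvtx d == x) curve_flow K d
  = 0.
Proof.
move=> cK; rewrite /curve_flow sumrB curve_vert_sum //.
under [X in _ - X]eq_bigr do rewrite -in_reversal.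
by rewrite curve_vert_sum ?verts_reversal ?subrr //; exact: curve_reversal.
Qed.

Lemma sum_coboundary (w : region -> rat) d :
  \sum_r w r * coboundary r d = w (reg G d) - w (reg G (flip G d)).
Proof.
rewrite /coboundary; under eq_bigr do rewrite mulrBr.
by rewrite sumrB !sum_pred1.
Qed.

Lemma sum_incidence (g : dart -> rat) (W : {set dart}) d : hvtx d \in W ->
  hvtx (flip G d) \in W ->
  \sum_(x in W) incidence d x * g x = g (hvtx d) - g (hvtx (flip G d)).
Proof.
move=> h1 h2; rewrite /incidence; under eq_bigr do rewrite mulrBl.
rewrite sumrB; congr (_ - _); rewrite big_mkcond /= -sum_pred1;
  by apply: eq_bigr => x _; rewrite [RHS]mulrC; case: eqP => [<-|];
  rewrite ?h1 ?h2 // mul0r if_same.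
Qed.

Lemma hvtx_hvertices d : hvtx d \in hvertices.
Proof. by rewrite inE hvtx_hvtx. Qed.

Lemma eulerE : (#|hvertices| + (nreg G).+1 = #|fwd G| + #|croots| + 1)%N.
Proof.
have e1 : fcard (@hrot m G) predT = #|hvertices|.
  by apply: eq_card => x; rewrite !inE /= ?andbT.
have e2 : n_comp (@same_component m G) predT = #|croots|.
  by apply: eq_card => x; rewrite !inE /= ?andbT.
by have := euler; rewrite /euler_formula e1 e2.
Qed.

(* If [K] did not separate its two sides, the flow along [K] would be linearly
   independent of the coboundaries of all regions but the unbounded one: too many
   cycles for Euler's formula. *)
Lemma curve_sep K : is_curve K ->
  {in K, forall d, ~~ connect (adjacent_off K) (reg G d) (reg G (flip G d))}.
Proof.
move=> cK d0 d0K; apply/negP=> conn.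
pose a r d := if r == ord0 then curve_flow K d else coboundary r d.
have : (#|[set: region]| + #|hvertices| <= #|fwd G| + #|[set hvtx c | c
  in croots]|)%N.
  apply: (@rank_bound _ _ _ _ _ _ _ a incidence).
  - move=> r x _ _; apply: flow_incidence => [d|]; rewrite /a; case: eqP => _.
    + exact: curve_flow_anti.
    + exact: coboundary_anti.
    + exact: curve_flow_cons.
    exact: coboundary_cons.
  - move=> w wE; pose w' r := if r == ord0 then 0 else w r.
    have sumE d : \sum_(r in [set: region]) w r * a r d =
        w ord0 * curve_flow K d + (w' (reg G d) - w' (reg G (flip G d))).
      rewrite -sum_coboundary (bigD1 ord0) ?inE //= {1}/a eqxx; congr (_ + _).
      rewrite [RHS](bigD1 ord0) //= {1}/w' eqxx mul0r add0r.
      apply: eq_big => [r|r /andP[_ /negbTE r0]]; first by rewrite inE.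
      by rewrite /w' /a r0.
    have all0 d : w ord0 * curve_flow K d + (w' (reg G d) - w'
      (reg G (flip G d))) = 0.
      have [df|df] := boolP (d \in fwd G); first by rewrite -sumE wE.
      have := wE (flip G d); rewrite fwd_flip sumE flipK curve_flow_anti
        => /(_ df).
      by move=> e; lra.
    (* Off [K] the flow of [K] vanishes, so [w'] is constant along paths that avoid [K]. The assumed
       path between the two sides of [d0] then kills the coefficient of that flow. *)
    have off r r' : connect (adjacent_off K) r r' -> w' r = w' r'.
      case/connectP=> p + ->; elim: p r => //= y p IH r /andP[h /IH <-].
      case/existsP: h => d /and4P[h1 h2 /eqP <- /eqP <-].
      have := all0 d; rewrite /curve_flow (negbTE h1) (negbTE h2) => e; lra.
    have w0 : w ord0 = 0.
      have := all0 d0; rewrite (off _ _ conn) /curve_flow d0K.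
      by rewrite (negbTE (curve_anti cK d0K)) /= => e; lra.
    have cst r : w' r = 0.
      have {1}<- : w' ord0 = 0 by rewrite /w' eqxx.
      case/connectP: (reg_all r) => p + ->; elim: p (ord0 : region) => //= y p
        IH r' /andP[h /IH ->].
      case/existsP: h => d /and4P[_ _ /eqP <- /eqP <-].
      by have := all0 d; rewrite w0 mul0r => e; lra.
    by move=> r _; have := cst r; rewrite /w'; case: eqP => [-> //|].
  (* [T] has one vertex per component: a function without jumps along edges is constant on each
     component. *)
  move=> g gE gT.
  have ge d : g (hvtx (flip G d)) = g (hvtx d).
    have [df|df] := boolP (d \in fwd G).
      by have := gE d df; rewrite sum_incidence ?hvtx_hvertices // => e; lra.
    have := gE (flip G d); rewrite fwd_flip => /(_ df).
    by rewrite sum_incidence ?hvtx_hvertices // flipK => e; lra.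
  move=> x; rewrite inE => /eqP <-.
  have -> : g (hvtx x) = g (hvtx (croot x)).
    apply: (@comp_invariant _ (fun z => g (hvtx z))) => [d|d|]; first exact: ge.
      by rewrite hvtx_hrot.
    by rewrite croot_croot.
  by apply: gT; apply: imset_f; rewrite inE croot_croot.
(* The bound says that vertices plus regions are at most edges plus components, one less than
   Euler's formula demands. *)
rewrite cardsT card_ord; move=> h;
  have := leq_trans h (leq_add (leqnn _) (leq_imset_card hvtx croots)).
by rewrite addnC eulerE addn1 ltnn.
Qed.

Lemma on_left_right K : is_curve K ->
  {in K, forall d, on_left K (reg G (flip G d)) = false}.
Proof.
move=> cK d dK; apply/existsP=> [] [x /andP[xK c]].
case/negP: (curve_sep cK dK); apply: connect_trans c.
exact: (curve_left cK).
Qed.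

Lemma on_left_not K r : is_curve K -> on_left (reversal K) r = ~~ on_left K r.
Proof.
move=> cK; have := on_left_or r cK;
  case: (boolP (on_left K r)) => //= /existsP[d /andP[dK c]] _.
apply/negbTE; rewrite on_left_reversal; apply/existsP=> [] [x /andP[xK c']].
case/negP: (curve_sep cK dK); apply: connect_trans c _.
rewrite adj_csym; apply: connect_trans c'; exact: (curve_right cK).
Qed.

Lemma on_left_hrot K d : is_curve K -> hvtx d \notin verts K ->
  on_left K (reg G (hrot d)) = on_left K (reg G d).
Proof.
move=> cK h; rewrite -[in RHS]reg_hrot on_left_off //; apply: contra h => h.
  by rewrite -hvtx_hrot imset_f.
by rewrite -verts_reversal // -hvtx_hrot imset_f // in_reversal.
Qed.

Lemma on_left_hvtx K d d' : is_curve K -> hvtx d \notin verts K ->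
  hvtx d = hvtx d' ->
  on_left K (reg G d) = on_left K (reg G d').
Proof.
move=> cK h e.
pose k x := (hvtx x \in verts K) || on_left K (reg G x).
have : k d = k d'.
  apply: (@fconnect_invariant _ (@hrot m G)); last by rewrite -hvtx_eq e.
  move=> x; apply/eqP; rewrite /k hvtx_hrot.
  by case: (boolP (_ \in _)) => //= /on_left_hrot ->.
by rewrite /k -e (negbTE h).
Qed.

Lemma curve_comp K : is_curve K -> {in K &, forall d d', croot d = croot d'}.
Proof.
move=> cK d d' dK d'K; have /connectP[p] := curve_conn cK dK d'K.
elim: p d dK => [|y p IH] d dK /= => [_ -> //|].
case/andP=> /and3P[_ yK h] hp e; rewrite -(IH _ yK hp e).
by case/orP: h => /eqP/croot_hvtx; rewrite croot_flip.
Qed.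

Lemma verts_comp K d d0 : is_curve K -> d0 \in K -> hvtx d \in verts K ->
  croot d = croot d0.
Proof. by move=> cK h /imsetP[x xK /croot_hvtx ->]; apply: (curve_comp cK). Qed.

Lemma on_left_comp K d0 d d' : is_curve K -> d0 \in K -> croot d != croot d0 ->
  croot d = croot d' ->
  on_left K (reg G d) = on_left K (reg G d').
Proof.
move=> cK d0K ne e; pose k x := (croot x == croot d0) || on_left K (reg G x).
have : k d = k d'.
  apply: comp_invariant e => x; rewrite /k ?croot_flip ?croot_hrot;
    case: eqP => //= /eqP nx.
    rewrite on_left_off //; apply: contra nx => h; last rewrite -croot_flip;
      exact/eqP/(curve_comp cK).
  by rewrite on_left_hrot //; apply: contra nx => h; exact/eqP/(verts_comp cK).
by rewrite /k -e (negbTE ne).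
Qed.

Lemma card_sum (T : finType) (A : {set T}) : #|A| = (\sum_x (x \in A))%N.
Proof. by rewrite -sum1_card big_mkcond; apply: eq_bigr => x _; case: ifP. Qed.

Definition left_regions K : {set region} := [set r | on_left K r].
Definition left_vertices K : {set dart} :=
  [set x in hvertices | (x \notin verts K) && on_left K (reg G x)].
Definition left_edges K : {set dart} :=
  [set d in fwd G | [&& d \notin K, flip G d \notin K & on_left K (reg G d)]].
Definition left_croots K d0 : {set dart} :=
  [set c in croots | (croot c != croot d0) && on_left K (reg G c)].

Lemma verts_hvertices K : verts K \subset hvertices.
Proof. by apply/subsetP=> _ /imsetP[x _ ->]; apply: hvtx_hvertices. Qed.

Lemma hvtx_verts K d : d \in K -> hvtx d \in verts K.
Proof. exact: imset_f. Qed.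

Lemma hvtx_verts_flip K d : is_curve K -> d \in K -> hvtx (flip G d) \in verts
  K.
Proof. by move=> cK dK; rewrite -verts_reversal // hvtx_verts // in_reversal
  flipK. Qed.

(* The left side of [K], closed by [K], carries [#|left_regions K|] independent
   cycles. *)
Lemma side_bound K d0 : is_curve K -> d0 \in K ->
  (#|left_regions K| + #|left_vertices K| <= #|left_edges K| + #|left_croots K
    d0| + 1)%N.
Proof.
move=> cK d0K.
pose H : {set dart} := [set d in fwd G | [|| d \in K, flip G d \in K | on_left
  K (reg G d)]].
pose W : {set dart} := [set x in hvertices | (x \in verts K) || on_left K
  (reg G x)].
(* One anchor on [K], and one on each other component that lies to the left of [K]. *)
pose T : {set dart} := hvtx d0 |: [set hvtx c | c in left_croots K d0].
have HW d : d \in H -> hvtx d \in W /\ hvtx (flip G d) \in W.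
  rewrite !inE !hvtx_hvtx !eqxx /= => /andP[_ h].
  have [d1|d1] := boolP (d \in K); first by rewrite hvtx_verts //
    hvtx_verts_flip.
  have [d2|d2] := boolP (flip G d \in K).
    by have := hvtx_verts_flip cK d2; rewrite flipK => ->; rewrite hvtx_verts.
  rewrite (negbTE d1) (negbTE d2) /= in h.
  split; apply/orP; case: (boolP (_ \in verts K)) => hd;
    [by left|right|by left|right].
    by rewrite (on_left_hvtx (d' := d)) ?hvtx_hvtx.
  by rewrite (on_left_hvtx (d' := flip G d)) ?hvtx_hvtx // on_left_off.
have : (#|left_regions K| + #|W| <= #|H| + #|T|)%N.
  apply: (@rank_bound _ _ _ _ _ _ _ coboundary incidence).
  - move=> r x rX _; rewrite -[RHS](@flow_incidence (coboundary r) x)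
    ?coboundary_cons //; last first.
      by move=> d; rewrite coboundary_anti.
    rewrite big_mkcond [RHS]big_mkcond; apply: eq_bigr => d _; rewrite inE.
    case: (boolP (d \in fwd G)) => //= df; case: ifP => // /negbT.
    rewrite !negb_or => /and3P[h1 h2 h3]; rewrite /coboundary.
    rewrite inE in rX; case: eqP => [e|_]; first by rewrite e rX in h3.
    case: eqP => [e|_]; last by rewrite subrr mul0r.
    by rewrite -e on_left_off // (negbTE h3) in rX.
  - move=> w wE; pose w' r := if on_left K r then w r else 0.
    have sumE d : \sum_(r in left_regions K) w r * coboundary r d
      = w' (reg G d) - w' (reg G (flip G d)).
      rewrite -sum_coboundary big_mkcond; apply: eq_bigr => r _;
        rewrite /w' inE.
      by case: ifP => //; rewrite mul0r.
    have all0 d : [|| d \in K, flip G d \in K | on_left K (reg G d)] ->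
        w' (reg G d) = w' (reg G (flip G d)).
      move=> h; have [df|df] := boolP (d \in fwd G).
        have := wE d; rewrite inE df h sumE => /(_ isT) => e; lra.
      have := wE (flip G d); rewrite inE fwd_flip df flipK /= sumE flipK => e.
      have {e}e := e _; suff: w' (reg G (flip G d)) - w' (reg G d) = 0
        by move=> *; lra.
      apply: e; move: h; case: (boolP (d \in K)) => d1; rewrite ?orbT //.
      by case: (boolP (_ \in K)) => d2 //; rewrite on_left_off.
    have off r r' : connect (adjacent_off K) r r' -> on_left K r ->
      w' r = w' r'.
      case/connectP=> p + ->; elim: p r => //= y p IH r /andP[h hp] lr.
      have ly : on_left K y by rewrite -(on_left_conn (connect1 h)).
      rewrite -(IH _ hp ly); case/existsP: h => d /and4P[h1 h2 /eqP er /eqP <-].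
      by rewrite -er; apply: all0; rewrite er lr !orbT.
    move=> r; rewrite inE => lr; have -> : w r = w' r by rewrite /w' lr.
    (* A left region is joined to one bordering [K], and across [K] lies the right side, where [w']
       is 0 by definition. *)
    case/existsP: (lr) => x /andP[xK c]; rewrite -(off _ _ c) ?on_left_mem //.
    by rewrite all0 ?xK // /w' on_left_right.
  move=> g gE gT.
  have ge d : [|| d \in K, flip G d \in K | on_left K (reg G d)] ->
      g (hvtx (flip G d)) = g (hvtx d).
    move=> h; have [df|df] := boolP (d \in fwd G).
      have dH : d \in H by rewrite inE df.
      by have [h1 h2] := HW d dH; have := gE d dH;
        rewrite sum_incidence // => e; lra.
    have dH : flip G d \in H.
      rewrite inE fwd_flip df flipK; move: h; case: (boolP (d \in K)) => d1;
        rewrite ?orbT //.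
      by case: (boolP (_ \in K)) => d2 //; rewrite on_left_off.
    have [h1 h2] := HW _ dH; have := gE _ dH;
      rewrite sum_incidence // flipK => e; lra.
  have gK x : x \in verts K -> g x = 0.
    case/imsetP=> d dK ->; have {1}<- : g (hvtx d0) = 0 by apply: gT;
      rewrite setU11.
    have /connectP[p] := curve_conn cK dK d0K.
    elim: p d dK => [|y p IH] d dK /= => [_ -> //|].
    case/andP=> /and3P[_ yK h] hp e; rewrite -(IH _ yK hp e).
    case/orP: h => /eqP <-; first by rewrite ge ?dK.
    by rewrite ge // yK.
  move=> v; rewrite inE => /andP[]; rewrite inE => /eqP vv h.
  have [/gK //|nv] := boolP (v \in verts K); rewrite (negbTE nv) /= in h.
  apply/eqP; apply: contraT => gv.
  (* A nonzero value at [v] spreads over its whole component, which therefore avoids [K], where [g]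
     is 0. But then that component has an anchor in [T]. *)
  pose k x := [&& hvtx x \notin verts K, on_left K (reg G x) & g (hvtx x) != 0].
  have ck x y : croot x = croot y -> k x = k y.
    have kf z : k z -> k (flip G z).
      case/and3P=> z1 z2 z3.
      have gz : g (hvtx (flip G z)) = g (hvtx z) by rewrite ge // z2 !orbT.
      rewrite /k gz z3 andbT; apply/andP; split.
        by apply: contra z3 => /gK; rewrite gz => ->.
      rewrite on_left_off //; first by apply: contra z1; apply: hvtx_verts.
      by apply: contra z1 => h'; rewrite -[z]flipK hvtx_verts_flip.
    apply: comp_invariant => z.
      by apply/idP/idP=> [/kf|]; [rewrite flipK | exact: kf].
    by rewrite /k hvtx_hrot; case: (boolP (_ \in _)) => //= /on_left_hrot ->.
  have kv : k v by rewrite /k vv nv h gv.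
  have ne : croot v != croot d0.
    apply/eqP => /ck; rewrite kv /k; case: (boolP (_ \in _)) => //=.
    by rewrite hvtx_verts.
  have kc : k (croot v) by rewrite (ck _ v) ?croot_croot.
  case/and3P: kc => _ kc; rewrite gT ?eqxx // in_setU imset_f ?orbT //.
  by rewrite !inE !croot_croot eqxx ne kc.
have -> : #|W| = (#|left_vertices K| + #|K|)%N.
  rewrite -[#|K|](card_in_imset (curve_out cK)) -/(verts K) !card_sum
    -big_split /=.
  apply: eq_bigr => x _; rewrite !inE; case: (boolP (x \in verts K)) => h /=.
    by move/subsetP: (verts_hvertices K) => /(_ _ h); rewrite inE => ->;
      rewrite andbF.
  by rewrite addn0.
have -> : #|H| = (#|left_edges K| + #|K|)%N.
  rewrite !card_sum -(sum_fwd (fun x => (x \in K : nat))) /= -big_split /=.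
  rewrite [X in _ = (X + _)%N](bigID (mem (fwd G))) /=.
  rewrite [X in _ = (_ + X + _)%N]big1 ?addn0; last first.
    by move=> x /negbTE h; rewrite inE h.
  rewrite -big_split [LHS](bigID (mem (fwd G))) /= [X in (_ + X)%N]big1 ?addn0;
    last first.
    by move=> x /negbTE h; rewrite inE h.
  apply: eq_bigr => x xf; rewrite !inE xf /=.
  case: (boolP (x \in K)) => xK /=;
    first by rewrite (negbTE (curve_anti cK xK)).
  by case: (boolP (_ \in K)); rewrite ?addn0.
have : (#|T| <= 1 + #|left_croots K d0|)%N.
  by rewrite cardsU1; apply: leq_add (leq_imset_card _ _); case: (_ \notin _).
by move=> *; lia.
Qed.

Lemma left_croots_reversal K d0 : left_croots (reversal K) d0 = left_croots
  (reversal K) (flip G d0).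
Proof. by rewrite /left_croots croot_flip. Qed.

(* The bounds for the two sides of [K] add up to Euler's formula, so both are
   equalities: a simple closed curve bounds disks. *)
Lemma curve_count K d0 : is_curve K -> d0 \in K ->
  (#|left_regions K| + #|left_vertices K| = #|left_edges K| + #|left_croots K
    d0| + 1)%N.
Proof.
move=> cK d0K; have cK' := curve_reversal cK.
have b1 := side_bound cK d0K.
have d0K' : flip G d0 \in reversal K by rewrite in_reversal flipK.
have b2 := side_bound cK' d0K'; rewrite -left_croots_reversal in b2.
have eX : (#|left_regions K| + #|left_regions (reversal K)| = (nreg G).+1)%N.
  rewrite -[RHS]card_ord -(cardsC (left_regions K));
    congr (_ + #|pred_of_set _|)%N.
  by apply/setP=> r; rewrite !inE on_left_not.
have eV : (#|left_vertices K| + #|left_vertices (reversal K)| + #|K|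
  = #|hvertices|)%N.
  rewrite -[#|K|](card_in_imset (curve_out cK)) -/(verts K) !card_sum
    -!big_split /=.
  apply: eq_bigr => x _; rewrite !inE verts_reversal // on_left_not //.
  case: (boolP (x \in verts K)) => h /=.
    by move/subsetP: (verts_hvertices K) => /(_ _ h); rewrite inE => ->.
  by case: (hvtx x == x); case: (on_left _ _).
have eE : (#|left_edges K| + #|left_edges (reversal K)| + #|K| = #|fwd G|)%N.
  rewrite !card_sum -(sum_fwd (fun x => (x \in K : nat))) /= -[X in (_ + X)%N
    = _]big_split /=.
  rewrite [X in (_ + X)%N = _]big_mkcond -!big_split /=; apply: eq_bigr => x _.
  rewrite !inE flipK on_left_not //; case: (boolP (x \in fwd G)) => //= _.
  case: (boolP (x \in K)) => xK /=;
    first by rewrite (negbTE (curve_anti cK xK)) ?andbF.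
  by case: (boolP (flip G x \in K)) => //= _; case: (on_left _ _).
have eC : (#|left_croots K d0| + #|left_croots (reversal K) d0| + 1
  = #|croots|)%N.
  rewrite !card_sum -[1%N](_ : (\sum_c (c == croot d0) = 1)%N); last first.
    by rewrite (bigD1 (croot d0)) //= eqxx big1 // => i /negbTE ->.
  rewrite -!big_split /=; apply: eq_bigr => x _; rewrite !inE on_left_not //.
  case: (x =P croot d0) => [->|ne]; first by rewrite !croot_croot !eqxx.
  case: eqP => //= e; rewrite e; case: eqP => //=; by case: (on_left _ _).
by have := eulerE; lia.
Qed.

(** * Turning and curvature *)

Definition deg d : rat := #|vtx d|%:R.
Definition left_corners K d : rat := \sum_(x in vtx d) (on_left K (reg G x))%:R.

Lemma deg_neq0 d : deg d != 0.
Proof.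
rewrite /deg pnatr_eq0 -lt0n; apply/card_gt0P; exists d; exact: vtx_id.
Qed.

(* A region that touches the component of [c] and can be reached from the
   unbounded one without crossing this component. *)
Lemma outer_region_ex c : exists r, outside [set d | croot d == croot c] r &&
  [exists d, (croot d == croot c) && (reg G d == r)].
Proof.
case: (boolP [exists r, outside [set d | croot d == croot c] r &&
  [exists d, (croot d == croot c) && (reg G d == r)]]) => [/existsP //|].
move=> /existsPn h; exfalso.
(* If no reachable region bordered the component, reachability would never be obstructed by it:
   every region would be reachable, including one that borders [c]. *)
have cl r1 r2 : adjacent_off set0 r1 r2 ->
   r1 \in outside [set d | croot d == croot c] ->
     r2 \in outside [set d | croot d == croot c].
  case/existsP=> d /and4P[_ _ /eqP er /eqP <-] o1.
  have dn : croot d != croot c.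
    apply/eqP=> e; have := h r1; rewrite [outside _ _]o1 /= => /existsPn/(_ d).
    by rewrite e er !eqxx.
  apply: connect_trans o1 _; rewrite -er; apply: cadj_off;
    by rewrite inE ?croot_flip.
have := closed_connect (intro_closed (adj_csym set0) cl) (reg_all (reg G c)).
have o0 : ord0 \in outside [set d | croot d == croot c] by exact: connect0.
rewrite o0 => /esym oc; have := h (reg G c).
rewrite [outside _ _]oc /= => /existsPn/(_ c); by rewrite !eqxx.
Qed.

Definition outer_region c : region := xchoose (outer_region_ex c).

Lemma outer_regionP c : outside [set d | croot d == croot c] (outer_region c) /\
  exists2 d, croot d = croot c & reg G d = outer_region c.
Proof.
have /andP[h /existsP[d /andP[/eqP e /eqP e']]] := xchooseP (outer_region_ex c).
by split=> //; exists d.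
Qed.

(* For the indicator [w] of the bounded side of a curve, this counts the regions
   minus the edges plus the vertices of that side, where an edge on the curve
   counts 1/2 and a vertex on the curve counts as the proportion of its corners
   on that side; the hub is not counted. The last sum corrects the Euler
   characteristic of the regions that enclose other components. *)
Definition curvature (w : region -> rat) : rat :=
  \sum_r w r - 2^-1 * (\sum_d w (reg G d))
  + \sum_(d | d \notin bdry) w (reg G d) / deg d - \sum_(c in croots) w
    (outer_region c).

Lemma sum_vtx d (F : dart -> rat) : d \notin bdry ->
  \sum_(x | hvtx x == hvtx d) F x = \sum_(x in vtx d) F x.
Proof. by move=> h; apply: eq_bigl => x; rewrite eq_sym hvtx_vtx // eq_sym
  vtx_eq. Qed.

Lemma vtx_nbd d x : d \notin bdry -> x \in vtx d -> x \notin bdry.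
Proof.
move=> h xd; rewrite -(hvtx_bdry (d := d)) //; apply/eqP.
by rewrite hvtx_vtx // eq_sym vtx_eq.
Qed.

Lemma sum_bdry d (F : dart -> rat) : d \in bdry ->
  \sum_(x | hvtx x == hvtx d) (if x \notin bdry then F x else 0) = 0.
Proof. by move=> h; apply: big1 => x /eqP/hvtx_bdry ->; rewrite h. Qed.

(** If [K] misses the hub, all corners at the hub are on one side of [K], and one of these corners
    is unbounded. *)
Lemma hub_out K : is_curve K -> on_left K ord0 = false ->
  forall d, d \in bdry -> hvtx d \notin verts K -> on_left K (reg G d) = false.
Proof.
move=> cK l0 d /codomP[j ->] h.
have m0 : (m.-1 < m)%N by rewrite ltn_predL (leq_ltn_trans (leq0n j)).
have <- : on_left K (reg G (bd G (Ordinal m0))) = false.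
  by rewrite reg_last //= prednK // (leq_ltn_trans (leq0n j)).
by apply: on_left_hvtx => //; apply: hvtx_bd.
Qed.

Lemma sum_set (T : finType) (A : {set T}) : \sum_x (x \in A)%:R = #|A|%:R :>
  rat.
Proof. by rewrite card_sum natr_sum. Qed.

(** By [curve_count] the open left side would contribute exactly 1. The sum on the right collects
    what the edges and vertices of [K] itself contribute, each vertex being charged to the dart of
    [K] that leaves it. *)
Lemma curvature_on_left K : is_curve K -> on_left K ord0 = false ->
  curvature (fun r => (on_left K r)%:R) =
  1 - \sum_(d in K) (if d \in bdry then 2^-1 else 2^-1 - left_corners K d / deg
    d).
Proof.
move=> cK l0; have [d0 d0K] := curve_ex cK; rewrite /curvature.
have -> : \sum_r (on_left K r)%:R = #|left_regions K|%:R :> rat.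
  by rewrite -sum_set; apply: eq_bigr => r _; rewrite inE.
have -> : \sum_d (on_left K (reg G d))%:R = #|left_edges K|%:R + #|left_edges
  K|%:R + #|K|%:R :> rat.
  have -> : #|left_edges K|%:R = \sum_(d in fwd G) (d \in left_edges K)%:R :>
    rat.
    rewrite -sum_set [RHS]big_mkcond; apply: eq_bigr => d _; rewrite inE.
    by case: (d \in fwd G).
  rewrite -sum_set -!sum_fwd -!big_split /=; apply: eq_bigr => d df.
  rewrite !inE df /=; case: (boolP (d \in K)) => dK /=.
    by rewrite on_left_mem // on_left_right // (negbTE (curve_anti cK dK)) /=;
      lra.
  case: (boolP (flip G d \in K)) => dK' /=; last by rewrite on_left_off //= ;
    lra.
  by rewrite (on_left_mem dK') -[X in on_left K (reg G X)]flipK on_left_right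
    //=; lra.
have -> : \sum_(d | d \notin bdry) (on_left K (reg G d))%:R / deg d =
    #|left_vertices K|%:R + \sum_(d in K) (if d \in bdry then 0
      else left_corners K d / deg d).
  rewrite -sum_set big_mkcond /= (partition_big hvtx (mem hvertices)) /=;
    last first.
    by move=> d _; exact: hvtx_hvertices.
  pose g x := if x \in verts K then if x \in bdry then 0 else left_corners K x
    / deg x else 0.
  rewrite (eq_bigr (fun x => (x \in left_vertices K)%:R + g x)); last first.
    move=> x xV; have xx : hvtx x = x by move: xV; rewrite inE => /eqP.
    rewrite inE xV /= /g -[in LHS]xx.
    have [xb|xb] := boolP (x \in bdry).
      rewrite sum_bdry // if_same addr0;
        case: (boolP (x \in verts K)) => //= xK.
      by rewrite (hub_out cK l0) // xx.
    rewrite sum_vtx // (eq_bigr (fun y => (on_left K (reg G y))%:R / deg x));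
      last first.
      move=> y yx; rewrite (vtx_nbd xb yx); congr (_ / _).
      by rewrite /deg (vtx_mem yx).
    rewrite -mulr_suml -/(left_corners K x);
      case: (boolP (x \in verts K)) => xK /=.
      by rewrite add0r.
    rewrite addr0 /left_corners (eq_bigr (fun=> (on_left K (reg G x))%:R));
      last first.
      move=> y yx; rewrite (on_left_hvtx (d' := y)) ?xx // -{1}xx; apply/eqP.
      by rewrite hvtx_vtx // eq_sym vtx_eq.
    by rewrite sumr_const -[_ *+ #|_|]mulr_natr -/(deg x) mulfK ?deg_neq0.
  rewrite big_split /=; congr (_ + _).
    rewrite big_mkcond; apply: eq_bigr => x _; case: ifP => // h.
    by rewrite [RHS](_ : _ = 0) // [x \in left_vertices K]inE h.
  rewrite [LHS](_ : _ = \sum_(x in verts K) if x \in bdry then 0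
    else left_corners K x / deg x); last first.
    rewrite -big_mkcondr /=; apply: eq_bigl => x; rewrite andb_idl //.
    by move/subsetP: (verts_hvertices K); apply.
  rewrite /verts big_imset /=; last exact: (curve_out cK).
  apply: eq_bigr => d dK; rewrite (hvtx_bdry (hvtx_hvtx d));
    case: (boolP (_ \in _)) => // db.
  have e : vtx (hvtx d) = vtx d by apply/eqP; rewrite eq_sym -hvtx_vtx //
    hvtx_hvtx.
  by rewrite /left_corners /deg e.
have -> : \sum_(c in croots) (on_left K (outer_region c))%:R = #|left_croots K
  d0|%:R :> rat.
  rewrite -sum_set big_mkcond; apply: eq_bigr => c _; rewrite !inE.
  case: eqP => //= cc; have [out [d dc dr]] := outer_regionP c.
  rewrite cc in dc; case: eqP => [e|/eqP ne] /=; last first.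
    by rewrite -dr -(on_left_comp cK d0K ne) // dc.
  (* The outer region of the component of [K] is reached from [ord0] without crossing [K], hence is
     on the unbounded side. *)
  suff -> : on_left K (outer_region c) = false by [].
  rewrite -l0; apply/esym/on_left_conn; move: out; apply: connect_sub => r r'.
  case/existsP=> x /and4P[h1 h2 /eqP <- /eqP <-]; apply: cadj_off.
    apply: contra h1 => xK; rewrite inE e; apply/eqP.
    by rewrite (curve_comp cK xK d0K).
  apply: contra h2 => xK; rewrite inE e; apply/eqP.
  by rewrite (curve_comp cK xK d0K).
have -> : \sum_(d in K) (if d \in bdry then 2^-1 else 2^-1 - left_corners K d /
  deg d) =
    2^-1 * #|K|%:R - \sum_(d in K) (if d \in bdry then 0 else left_corners K d
      / deg d).
  rewrite -sum1_card natr_sum mulr_sumr -sumrB; apply: eq_bigr => d _.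
  by rewrite mulr1; case: ifP => _; rewrite ?subr0.
have := curve_count cK d0K; move/(congr1 (fun k => k%:R : rat));
  rewrite !natrD => e.
lra.
Qed.

(** [mu] counts, with signs, the edges crossed by a path from the unbounded region to [r]. *)
Lemma dual_path r : exists mu : dart -> rat, forall w : region -> rat,
  w r - w ord0 = \sum_d mu d * (w (reg G d) - w (reg G (flip G d))).
Proof.
case/connectP: (reg_all r) => p + ->; elim: p (ord0 : region) => [|y p IH]
  r0 /=.
  exists (fun=> 0) => w; rewrite subrr big1 // => d _; exact: mul0r.
case/andP=> /existsP[d0 /and4P[_ _ /eqP e0 /eqP e1]] /IH[mu muE].
(* The first crossing goes from the left of [d0] to its right, against the sign convention for
   jumps. *)
exists (fun d => mu d - (d == d0)%:R) => w.
under eq_bigr do rewrite mulrBl.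
rewrite sumrB -muE (bigD1 d0) //= eqxx big1 ?addr0; last first.
  by move=> d /negbTE ->; rewrite mul0r.
by rewrite e0 e1 /=; lra.
Qed.

(* The value of [w] on a region is the sum of its jumps along a path from the
   unbounded region, so the curvature is a linear function of these jumps. *)
Lemma curvature_dual : exists lam : dart -> rat, (forall d, lam (flip G d)
  = - lam d) /\
  forall w (F : {set dart}), w ord0 = 0 ->
   (forall d, w (reg G d) - w (reg G (flip G d)) = (d \in F)%:R - (flip G d
     \in F)%:R) ->
   curvature w = \sum_(d in F) lam d.
Proof.
have /choice[mu muE] := dual_path.
(* The curvature applied to the coefficient of [d] in [mu]. Antisymmetrizing accounts for the jump
   across [flip d] being opposite to that across [d]. *)
pose l0 d := \sum_r mu r d - 2^-1 * (\sum_x mu (reg G x) d)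
  + \sum_(x | x \notin bdry) mu (reg G x) d / deg x - \sum_(c in croots) mu
    (outer_region c) d.
exists (fun d => l0 d - l0 (flip G d)); split=> [d|w F w0 wF].
  by rewrite flipK [RHS](opprB (l0 d)).
have wE r : w r = \sum_d mu r d * ((d \in F)%:R - (flip G d \in F)%:R).
  by rewrite -[LHS]subr0 -[in LHS]w0 muE; apply: eq_bigr => d _; rewrite wF.
have -> : curvature w = \sum_d l0 d * ((d \in F)%:R - (flip G d \in F)%:R).
  rewrite /curvature /l0; under [in RHS]eq_bigr do rewrite mulrBl mulrDl mulrBl.
  rewrite sumrB big_split /= sumrB; congr (_ - _ + _ - _).
  - under eq_bigr do rewrite wE; rewrite exchange_big.
    by apply: eq_bigr => d _; rewrite mulr_suml.
  - under eq_bigr do rewrite wE; rewrite exchange_big mulr_sumr.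
    by apply: eq_bigr => d _; rewrite -mulrA mulr_suml.
  - under eq_bigr do rewrite wE mulr_suml; rewrite exchange_big.
    by apply: eq_bigr => d _; rewrite mulr_suml; apply: eq_bigr => x _;
      rewrite mulrAC.
  under eq_bigr do rewrite wE; rewrite exchange_big.
  by apply: eq_bigr => d _; rewrite mulr_suml.
under eq_bigr do rewrite mulrBr.
rewrite [RHS]big_mkcond /= sumrB [X in _ - X](reindex_inj flip_inj) /= -sumrB.
apply: eq_bigr => d _; rewrite flipK -mulrBl.
by case: (d \in F); rewrite ?mulr1 ?mulr0.
Qed.

Definition is_open K : bool := [exists j, bd G j \in K].

(* In full turns; the two right angles at the hub make the 1/2. *)
Definition turn K d : rat := if d \in bdry then 2^-1 else 2^-1 - left_corners K
  d / deg d.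

(* An open curve, closed along the axis, counts 1 if it is counterclockwise and 0
   otherwise, as in [y_stat]. *)
Definition winding K : rat :=
  if is_open K then (~~ on_left K ord0)%:R else (-1) ^+ on_left K ord0.

Lemma sum_open K : is_curve K ->
  \sum_(d in K) (if d \in bdry then 1 else 0) = (is_open K)%:R :> rat.
Proof.
move=> cK; case: (boolP (is_open K)) => [/existsP[j jK]|h].
  rewrite (bigD1 (bd G j)) //= bd_codom big1 ?addr0 // => d /andP[dK ne].
  case: ifP => // /codomP[i di]; case/eqP: ne; apply: (curve_out cK) => //.
  by rewrite di; apply: hvtx_bd.
rewrite big1 // => d dK; case: ifP => // /codomP[i di].
by case/negP: h; apply/existsP; exists i; rewrite -di.
Qed.

Lemma turn_hvtx K d : turn K (hvtx d) = turn K d.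
Proof.
rewrite /turn (hvtx_bdry (hvtx_hvtx d)); case: (boolP (_ \in _)) => // db.
have e : vtx (hvtx d) = vtx d by apply/eqP; rewrite eq_sym -hvtx_vtx //
  hvtx_hvtx.
by rewrite /left_corners /deg e.
Qed.

(** At an interior vertex the left corners of [K] and of its reversal make up the whole vertex, so
    the two turns cancel; at the hub each of them is 1/2. *)
Lemma sum_turn_reversal K : is_curve K ->
  \sum_(d in K) turn K d + \sum_(d in reversal K) turn (reversal K) d
    = (is_open K)%:R.
Proof.
move=> cK; have cK' := curve_reversal cK.
rewrite -sum_open // -(eq_bigr _ (fun d _ => turn_hvtx K d)).
rewrite -(eq_bigr _ (fun d _ => turn_hvtx (reversal K) d)).
rewrite -(big_imset _ (curve_out cK)) -(big_imset _ (curve_out cK')) /=.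
rewrite -/(verts K) -/(verts (reversal K)) verts_reversal // -big_split /=.
rewrite [RHS](eq_bigr (fun d => if hvtx d \in bdry then 1 else 0)); last first.
  by move=> d _; rewrite (hvtx_bdry (hvtx_hvtx d)).
rewrite -[RHS](big_imset (fun x => if x \in bdry then 1 else 0) (curve_out cK))
  /=.
apply: eq_bigr => x _; rewrite /turn; case: ifP => _; first lra.
have -> : left_corners (reversal K) x = deg x - left_corners K x.
  rewrite /left_corners /deg -sum1_card natr_sum -sumrB; apply: eq_bigr => y _.
  by rewrite on_left_not //; case: (on_left _ _); rewrite ?subrr ?subr0.
rewrite mulrBl divff ?deg_neq0 //; lra.
Qed.

Lemma on_left_coboundary K d : is_curve K ->
  (on_left K (reg G d))%:R - (on_left K (reg G (flip G d)))%:R =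
  (d \in K)%:R - (flip G d \in K)%:R :> rat.
Proof.
move=> cK; case: (boolP (d \in K)) => dK.
  by rewrite on_left_mem // on_left_right // (negbTE (curve_anti cK dK)).
case: (boolP (flip G d \in K)) => dK'; last by rewrite on_left_off // !subrr.
by rewrite (on_left_mem dK') -[X in on_left K (reg G X)]flipK on_left_right.
Qed.

(* The winding of a curve is its turning plus the curvature it encloses. *)
Theorem gauss_bonnet : exists lam : dart -> rat, forall K, is_curve K ->
  winding K = \sum_(d in K) (lam d + turn K d).
Proof.
have [lam [lamN lamE]] := curvature_dual; exists lam => K cK.
have ccw F : is_curve F -> on_left F ord0 = false ->
    \sum_(d in F) lam d + \sum_(d in F) turn F d = 1.
  move=> cF l0; rewrite -(lamE (fun r => (on_left F r)%:R)) ?l0 //.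
    by rewrite curvature_on_left //; lra.
  by move=> d; apply: on_left_coboundary.
rewrite big_split /= /winding; case: (boolP (on_left K ord0)) => l0; last first.
  by rewrite ccw ?(negbTE l0) //; case: ifP.
(* A clockwise curve is treated through its reversal. As [lam] is odd and the turns of both curves
   add up to [is_open K], the value 1 becomes -1 for a closed curve and 0 for an open one. *)
have := ccw _ (curve_reversal cK); rewrite on_left_not // l0 => /(_ erefl).
have -> : \sum_(d in reversal K) lam d = - \sum_(d in K) lam d.
  rewrite (reindex_inj flip_inj) /= -sumrN; apply: eq_big => d.
    by rewrite in_reversal flipK.
  by rewrite lamN.
have := sum_turn_reversal cK; case: (is_open K) => /=; rewrite ?expr1 => *; lra.
Qed.

(** * Flows and strands *)

Record is_flow U : Prop := IsFlow {
  flow_anti : {in U, forall d, flip G d \notin U};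
  flow_cons : forall d, d \notin bdry -> \sum_(x in vtx d) curve_flow U x = 0
}.

Lemma flow_reversal U : is_flow U -> is_flow (reversal U).
Proof.
move=> [an co]; split=> [d|d /co e].
  by rewrite !in_reversal => h; apply: contraL (an _ h) => ->.
rewrite -[RHS]oppr0 -[in RHS]e -sumrN; apply: eq_bigr => x _.
by rewrite /curve_flow !in_reversal flipK opprB.
Qed.

Lemma vtx_le3 d : (#|vtx d| <= 3)%N.
Proof.
case: webG => _ [_ hb] _ _ h.
have [/codomP[j ->]|db] := boolP (d \in bdry); first by rewrite hb cards1.
case: (boolP (is_circle d)) => [/eqP ->|/(h _ db)[-> //]].
by rewrite cards2; case: (_ != _).
Qed.

Lemma sum_mem (T : finType) (A B : {set T}) :
  \sum_(x in A) (x \in B)%:R = #|A :&: B|%:R :> rat.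
Proof.
rewrite -sum_set [LHS]big_mkcond; apply: eq_bigr => x _; rewrite inE.
by case: (x \in A).
Qed.

Lemma flow_card U d : is_flow U -> d \notin bdry -> #|vtx d :&: U| = #|vtx
  d :&: reversal U|.
Proof.
move=> fU db; have := flow_cons fU db; rewrite /curve_flow sumrB sum_mem.
under [X in _ - X]eq_bigr do rewrite -in_reversal.
by rewrite sum_mem => /eqP; rewrite subr_eq0 eqr_nat => /eqP.
Qed.

(** Conservation makes the darts of [U] entering an interior vertex as numerous as those leaving it,
    and together they are at most three: hence at most one of each. This is why strands of a flow
    never meet off the axis. *)
Lemma flow_out U : is_flow U -> {in U &, forall x y, vtx x = vtx y -> x = y}.
Proof.
move=> fU x y xU yU e; have [xb|xb] := boolP (x \in bdry);
  first exact: vtx_bdry.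
have : (#|vtx x :&: U| + #|vtx x :&: reversal U| <= 3)%N.
  apply: leq_trans (vtx_le3 x); rewrite -cardsUI -setIUr.
  have -> : vtx x :&: U :&: (vtx x :&: reversal U) = set0.
    apply/setP=> z; rewrite !inE; apply/negbTE/negP.
    by case/andP=> /andP[_ zU] /andP[_]; apply/negP/(flow_anti fU).
  by rewrite cards0 addn0 subset_leq_card // subsetIl.
rewrite -flow_card // => le; have {le} : (#|vtx x :&: U| <= 1)%N by lia.
by move/card_le1_eqP; apply; rewrite !in_setI ?xU ?yU ?vtx_id // e vtx_id.
Qed.

Lemma flow_in U : is_flow U -> {in U &, forall x y, vtx (flip G x)
  = vtx (flip G y) -> x = y}.
Proof.
move=> /flow_reversal fU x y xU yU e; apply: flip_inj.
by apply: (flow_out fU); rewrite ?in_reversal ?flipK.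
Qed.

Lemma flow_next U d : is_flow U -> d \in U -> flip G d \notin bdry ->
  exists2 y, y \in U & vtx y = vtx (flip G d).
Proof.
move=> fU dU db; have : (0 < #|vtx (flip G d) :&: U|)%N.
  rewrite flow_card // card_gt0; apply/set0Pn; exists (flip G d).
  by rewrite in_setI vtx_id in_reversal flipK.
by rewrite card_gt0 => /set0Pn[y]; rewrite in_setI => /andP[/vtx_mem]; exists y.
Qed.

Lemma touched1 d : touched [set d] = [set vtx d; vtx (flip G d)].
Proof. by rewrite /touched !imset_set1. Qed.

Lemma touched_flip d : touched [set flip G d] = touched [set d].
Proof. by rewrite !touched1 flipK setUC. Qed.

Lemma linked_sym U : symmetric (linked U).
Proof. by move=> x y; rewrite /linked /= andbCA disjoint_sym. Qed.

Lemma linked_csym U : connect_sym (linked U).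
Proof. exact: sym_connect_sym (linked_sym U). Qed.

Lemma linkedE U x y : is_flow U -> linked U x y ->
  [/\ x \in U, y \in U & [\/ x = y, vtx (flip G x) = vtx y | vtx (flip G y)
    = vtx x]].
Proof.
move=> fU /and3P[xU yU]; rewrite !touched1 -setI_eq0 => /set0Pn[v].
rewrite !inE => /andP[/orP[]/eqP -> /orP[]/eqP e]; split=> //.
- by constructor 1; apply: (flow_out fU).
- by constructor 3.
- by constructor 2.
by constructor 1; apply: (flow_in fU).
Qed.

Lemma linked_vtx U x y : x \in U -> y \in U -> vtx (flip G x) = vtx y ->
  linked U x y.
Proof.
move=> xU yU e; apply/and3P; split=> //; rewrite !touched1 -setI_eq0.
by apply/set0Pn; exists (vtx y); rewrite !inE e eqxx orbT.
Qed.

Lemma linked_map U U' (h : dart -> dart) :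
  {in U, forall x, h x \in U'} -> (forall x, touched [set h x] = touched
    [set x]) ->
  forall x y, connect (linked U) x y -> connect (linked U') (h x) (h y).
Proof.
move=> hU ht x y /connectP[p + ->]; elim: p x => [|z p IH] x /=;
  first by rewrite connect0.
case/andP=> /and3P[xU zU l] /IH; apply: connect_trans.
by apply/connect1/and3P; rewrite !hU // !ht.
Qed.

Definition strand U x : {set dart} := [set y in U | connect (linked U) x y].

Definition strands U : {set {set dart}} := equivalence_partition
  (connect (linked U)) U.

Lemma strandsP U K : reflect (exists2 x, x \in U & K = strand U x)
  (K \in strands U).
Proof. exact: imsetP. Qed.

Lemma strands_partition U : partition (strands U) U.
Proof.
apply: equivalence_partitionP; split=> [|h]; first exact: connect0.
exact: (same_connect (linked_csym U)).
Qed.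

Lemma strand_reversal U x : strand (reversal U) (flip G x) = reversal
  (strand U x).
Proof.
apply/setP=> y; rewrite in_reversal !inE; congr (_ && _).
apply/idP/idP=> h.
  have := @linked_map (reversal U) U (flip G) _ touched_flip _ _ h.
  by rewrite flipK; apply=> z; rewrite in_reversal.
have := @linked_map U (reversal U) (flip G) _ touched_flip _ _ h.
by rewrite flipK; apply=> z; rewrite in_reversal flipK.
Qed.

(** In a flow, a dart that runs into the axis is its own successor, so iterating along an open
    strand stops at its last dart. *)
Definition next_dart U d : dart := odflt d [pick y in U | vtx y == vtx
  (flip G d)].

Lemma next_dartP U d : d \in U -> next_dart U d \in U /\
  (next_dart U d = d \/ vtx (next_dart U d) = vtx (flip G d)).
Proof.
by move=> dU; rewrite /next_dart; case: pickP => [y /andP[yU /eqP e]|_] /=;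
  auto.
Qed.

Lemma next_dart_eq U x y : is_flow U -> y \in U -> vtx (flip G x) = vtx y ->
  next_dart U x = y.
Proof.
move=> fU yU e; rewrite /next_dart; case: pickP => [u /andP[uU /eqP e']|/(_ y)]
  /=.
  by apply: (flow_out fU); rewrite // e' e.
by rewrite yU -e eqxx.
Qed.

Lemma iter_next_dart U k d : d \in U -> iter k (next_dart U) d \in U.
Proof. by move=> dU; elim: k => //= k IH; case: (next_dartP IH). Qed.

(** Links are undirected, but a backward link only undoes the previous iteration, since a single
    dart of [U] enters each interior vertex, and no backward link exists at the start. *)
Lemma strand_iter U i y : is_flow U -> bd G i \in U -> connect (linked U)
  (bd G i) y ->
  exists k, y = iter k (next_dart U) (bd G i).
Proof.
move=> fU iU /connectP[p + ->].
have: exists k, bd G i = iter k (next_dart U) (bd G i) by exists 0%N.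
elim: p {1 3 4}(bd G i) => //= {}y p IH z [k zk] /andP[l hp]; apply: IH hp.
have [zU yU] := linkedE fU l; case=> [<-|e|e]; first by exists k.
  by exists k.+1; rewrite /= -zk (next_dart_eq fU yU e).
elim: k => [|k IHk] /= in zk *.
  move: e; rewrite zk => /esym/(vtx_bdry (bd_codom i)) e.
  by move: (flow_anti fU yU); rewrite -e iU.
have kU := iter_next_dart k iU; case: (next_dartP kU) => _ [e'|e'].
  by apply: IHk; rewrite zk e'.
by exists k; apply: (flow_in fU) => //; rewrite e zk e'.
Qed.

Lemma strand_start U x i j : is_flow U ->
  bd G i \in strand U x -> bd G j \in strand U x -> bd G i = bd G j.
Proof.
move=> fU; rewrite !inE => /andP[iU ci] /andP[jU cj].
have {ci cj x} : connect (linked U) (bd G i) (bd G j).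
  by apply: connect_trans cj; rewrite linked_csym.
case/strand_iter=> // k; elim: k => //= k IH; have kU := iter_next_dart k iU.
case: (next_dartP kU) => _ [-> //|e] ej.
move: (e); rewrite -ej => /(vtx_bdry (bd_codom j)) ej'.
by move: jU; rewrite ej' (negbTE (flow_anti fU kU)).
Qed.

Lemma strand_end U x i j : is_flow U ->
  flip G (bd G i) \in strand U x -> flip G (bd G j) \in strand U x ->
    bd G i = bd G j.
Proof.
move=> /flow_reversal fU; rewrite -!in_reversal -strand_reversal;
  exact: strand_start.
Qed.

Lemma strand_vtx U x y z : is_flow U -> (y \in strand U x) ||
  (flip G y \in strand U x) ->
  vtx y = vtx z -> (z \in U -> z \in strand U x) /\ (flip G z \in U ->
    flip G z \in strand U x).
Proof.
move=> fU h e.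
have ext u w : u \in strand U x -> w \in U -> linked U u w -> w \in strand U x.
  rewrite !inE => /andP[_ c] -> l; exact: connect_trans c (connect1 l).
have sU u : u \in strand U x -> u \in U by rewrite inE => /andP[].
case/orP: h => yK; split=> zU; have yU := sU _ yK.
- by rewrite -(flow_out fU _ _ e).
- by apply: (ext _ _ yK zU); rewrite linked_sym linked_vtx ?flipK.
- by apply: (ext _ _ yK zU); rewrite linked_vtx ?flipK.
by rewrite -(@flow_in _ fU (flip G y) (flip G z)) ?flipK.
Qed.

Lemma strand_flow U x : is_flow U -> is_flow (strand U x).
Proof.
move=> fU; split=> [d|d db].
  by rewrite !inE => /andP[dU _]; rewrite (negbTE (flow_anti fU dU)).
case: (boolP [exists y in vtx d, (y \in strand U x) || (flip G y \in strand U
  x)]).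
  case/exists_inP=> y yd h; rewrite -[RHS](flow_cons fU db);
    apply: eq_bigr => z zd.
  have e : vtx y = vtx z by rewrite (vtx_mem yd) (vtx_mem zd).
  have [h1 h2] := strand_vtx fU h e; rewrite /curve_flow.
  have -> : (z \in strand U x) = (z \in U).
    by apply/idP/idP=> //; rewrite inE => /andP[].
  have -> // : (flip G z \in strand U x) = (flip G z \in U).
  by apply/idP/idP=> //; rewrite inE => /andP[].
move/exists_inPn=> h; rewrite big1 // => y /h; rewrite negb_or /curve_flow.
by case/andP=> /negbTE -> /negbTE ->; rewrite subrr.
Qed.

(** Conservation for the part of the flow selected by [P]. The total over all darts vanishes by
    antisymmetry, and each interior vertex contributes 0 since [P] does not vary along the flow. It
    is used with [P] one side of a strand. *)
Lemma flow_bdry U (P : pred dart) : is_flow U ->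
  {in U, forall d, P (flip G d) = P d} ->
  (forall d d', d \notin bdry -> vtx d = vtx d' -> curve_flow U d != 0 ->
     curve_flow U d' != 0 -> P d = P d') ->
  \sum_(d in bdry | P d) curve_flow U d = 0.
Proof.
move=> fU Pf Pv; pose F d := if P d then curve_flow U d else 0.
have F0 : \sum_d F d = 0.
  suff : \sum_d F d = - \sum_d F d by move=> *; lra.
  rewrite {1}(reindex_inj flip_inj) /= -sumrN; apply: eq_bigr => d _.
  rewrite /F curve_flow_anti; case: (boolP (d \in U)) => dU.
    by rewrite Pf //; case: (P d); rewrite ?oppr0.
  case: (boolP (flip G d \in U)) => dU'.
    by rewrite -(Pf _ dU') flipK; case: (P d); rewrite ?oppr0.
  rewrite /curve_flow (negbTE dU) (negbTE dU') subrr oppr0.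
  by rewrite !if_same oppr0.
have Fn : \sum_(d | d \notin bdry) F d = 0.
  rewrite (partition_big hvtx predT) //= big1 // => x _.
  case: (boolP [exists d, [&& d \notin bdry, hvtx d == x & curve_flow U d
    != 0]]).
    case/existsP=> d /and3P[db /eqP dx dn].
    rewrite -[RHS](mul0r ((P d)%:R)) -[in RHS](flow_cons fU db) mulr_suml
      -sum_vtx //.
    apply: eq_big => [y|y /andP[yb /eqP yx]].
      rewrite dx; case: eqP => [yx|]; rewrite ?andbF // andbT.
      by rewrite -(hvtx_bdry (d := d)) ?dx.
    rewrite /F; case: (eqVneq (curve_flow U y) 0) => [->|yn];
      first by rewrite mul0r if_same.
    rewrite (Pv d y) //; first by case: (P y); rewrite ?mulr1 ?mulr0.
    by apply/eqP; rewrite -hvtx_vtx // dx yx.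
  move=> /existsPn h; apply: big1 => d /andP[db dx]; rewrite /F.
  by have := h d; rewrite db dx negbK => /eqP ->; rewrite if_same.
rewrite big_mkcondr /= -[RHS]F0 [RHS](bigID (mem bdry)) /= [X in _ + X]Fn addr0.
by [].
Qed.

Lemma sum_codom (F : dart -> rat) : \sum_(d in bdry) F d = \sum_(j < m) F
  (bd G j).
Proof.
have -> : \sum_(j < m) F (bd G j) = \sum_(d in [set bd G j | j in 'I_m]) F d.
  by rewrite big_imset //= => i j _ _; apply: bd_inj.
by apply: eq_bigl => d; apply/codomP/imsetP=> [[j ->]|[j _ ->]]; exists j.
Qed.

Lemma flow_ends U : is_flow U ->
  \sum_(j < m) ((bd G j \in U)%:R - (flip G (bd G j) \in U)%:R) = 0 :> rat.
Proof.
move=> fU; rewrite -[RHS](@flow_bdry U predT) // (eq_bigl (mem bdry))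
  ?sum_codom //.
by move=> d; rewrite /= andbT.
Qed.

Lemma flow_start_end U : is_flow U ->
  [exists j, bd G j \in U] = [exists j, flip G (bd G j) \in U].
Proof.
suff h V : is_flow V -> [exists j, bd G j \in V] ->
  [exists j, flip G (bd G j) \in V].
  move=> fU; apply/idP/idP; first exact: h.
  case/existsP=> j jU.
  have h2 : [exists j, flip G (bd G j) \in reversal U].
    by apply: (h _ (flow_reversal fU)); apply/existsP;
      exists j; rewrite in_reversal.
  case/existsP: h2 => i; rewrite in_reversal flipK => iU.
  by apply/existsP; exists i.
move=> fV /existsP[i iV]; apply: contraT => /existsPn h.
have := flow_ends fV; rewrite (eq_bigr (fun j => (bd G j \in V)%:R)); last
  first.
  by move=> j _; rewrite (negbTE (h j)) subr0.
rewrite (bigD1 i) //= iV => e; have : 0 <= \sum_(j < m | j != i)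
  (bd G j \in V)%:R :> rat.
  by apply: sumr_ge0 => j _; rewrite ler0n.
by move: e; set S := \sum_(_ | _) _ => e; have : 1 + S = 0 by []; lra.
Qed.

(** Away from the hub these are the properties of a flow; at the hub they say that a strand has at
    most one start and one end. *)
Lemma strand_curve U x : is_flow U -> x \in U -> is_curve (strand U x).
Proof.
move=> fU xU; have fK := strand_flow x fU.
have hvE d d' : hvtx d = hvtx d' -> vtx d = vtx d' \/
    exists i j, d = bd G i /\ d' = bd G j.
  move=> e; have [db|db] := boolP (d \in bdry); last by left; apply/eqP;
    rewrite -hvtx_vtx // e.
  right; move: (db); rewrite (hvtx_bdry e) => /codomP[j ->];
    case/codomP: db => i ->.
  by exists i, j.
split.
- by exists x; rewrite inE xU connect0.
- exact: flow_anti fK.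
- move=> d d' dK d'K /hvE[|[i [j [di d'j]]]]; first exact: (flow_out fK).
  by rewrite di d'j; apply: (@strand_start U x); rewrite -?di -?d'j.
- move=> d d' dK d'K /hvE[|[i [j [di d'j]]]]; first exact: (flow_in fK).
  apply: flip_inj; rewrite di d'j.
  by apply: (@strand_end U x); rewrite -?di -?d'j ?flipK.
(* A dart that reaches the axis is followed, through the hub, by the start of the same strand. *)
- move=> d dK; have [/codomP[j dj]|db] := boolP (flip G d \in bdry).
    have : [exists j, flip G (bd G j) \in strand U x].
      by apply/existsP; exists j; rewrite -dj flipK.
    rewrite -flow_start_end // => /existsP[i iK]; exists (bd G i) => //.
    by rewrite dj; apply: hvtx_bd.
  have [y yK e] := flow_next fK dK db; exists y => //.
  by apply/eqP; rewrite eq_sym hvtx_vtx // e.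
move=> d d' dK d'K.
have : connect (linked U) d d'.
  move: dK d'K; rewrite !inE => /andP[_ c] /andP[_]; apply: connect_trans.
  by rewrite linked_csym.
case/connectP=> p + e; elim: p d dK e => [|y p IH] d dK /= => [-> _ //|e].
case/andP=> l hp; have yK : y \in strand U x.
  have [dU yU _] := linkedE fU l; move: dK; rewrite !inE yU => /andP[_ c] /=.
  exact: connect_trans c (connect1 l).
apply: connect_trans (IH y yK e hp); have [dU yU] := linkedE fU l.
have vh u w : vtx u = vtx w -> hvtx u == hvtx w.
  move=> euw; have [ub|ub] := boolP (u \in bdry);
    first by rewrite (vtx_bdry ub euw).
  by rewrite hvtx_vtx // euw.
case=> [->|/vh e'|/vh e']; first exact: connect0.
  by apply/connect1/and3P; rewrite dK yK e'.
by apply/connect1/and3P; rewrite dK yK e' orbT.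
Qed.

Lemma strand_sub U x : strand U x \subset U.
Proof. by apply/subsetP=> y; rewrite inE => /andP[]. Qed.

(** The values of [turn]: 1/2 - 1/2 at the marker of a circle, 1/2 - 1/3 or 1/2 - 2/3 at a trivalent
    vertex with one or two corners on the left. Testing [U] instead of the curve makes the value
    depend only on the labels around the vertex. *)
Definition local_turn U d : rat :=
  if d \in bdry then 2^-1 else
  if #|vtx d| == 3%N then (if flip G (rot G d) \in U then 6^-1 else - 6^-1)
    else 0.

Lemma curve_prev_vtx K d : is_curve K -> d \in K -> d \notin bdry ->
  exists2 e, e \in K & flip G e \in vtx d.
Proof.
move=> cK dK db; have [e eK h] := curve_prev cK dK; exists e => //.
by rewrite -vtx_eq eq_sym -hvtx_vtx // h.
Qed.

Lemma turn_local U K d : is_flow U -> is_curve K -> K \subset U -> d \in K ->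
  turn K d = local_turn U d.
Proof.
move=> fU cK sKU dK; rewrite /turn /local_turn; case: ifPn => // db.
have [e eK ev] := curve_prev_vtx cK dK db; have eU := subsetP sKU _ eK.
have ed : flip G e != d by apply: contraNneq (curve_anti cK eK) => ->.
case: (boolP (is_circle d)) => [/eqP circ|nc].
  have c2 : #|vtx d| = 2%N by rewrite circ cards2 eq_sym flip_neq.
  rewrite c2 /= /deg c2 /left_corners circ.
  rewrite big_setU1 ?big_set1 /=; last by rewrite inE eq_sym flip_neq.
  by rewrite on_left_mem // on_left_right //=; lra.
have [v3 _] : #|vtx d| = 3%N /\ (n %| \sum_(d' in vtx d) sgn_at d'
  * (wt G d')%:Z)%Z.
  by case: webG => _ _ _ _; apply.
rewrite v3 /= /deg v3.
have o3 : #|porbit (rot G) d| = 3%N by rewrite -vtxE.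
have r3 : rot G (rot G (rot G d)) = d by have := iter_porbit (rot G) d;
  rewrite o3.
have u3 : uniq [:: d; rot G d; rot G (rot G d)].
  by have := uniq_traject_porbit (rot G) d; rewrite o3.
have vE : vtx d =i [:: d; rot G d; rot G (rot G d)].
  by move=> y; rewrite vtxE porbit_traject o3.
have -> : left_corners K d = (on_left K (reg G d))%:R + (on_left K
  (reg G (rot G d)))%:R
    + (on_left K (reg G (rot G (rot G d))))%:R.
  rewrite /left_corners (eq_bigl _ _ vE) -big_uniq // !big_cons big_nil /=; lra.
have rE y : y \notin bdry -> reg G (flip G (rot G y)) = reg G y.
  by move=> yb; rewrite -hrot_nbd // reg_hrot.
rewrite on_left_mem // -[reg G (rot G (rot G d))]rE ?rot_bdry // r3
  on_left_right //.
move: ev; rewrite vE !inE (negbTE ed) /= => /orP[]/eqP eE.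
  by rewrite -eE flipK eU on_left_right //=; lra.
rewrite -rE ?rot_bdry // -eE flipK on_left_mem //=.
(* Here [K] enters along the second dart after [d]; a dart of [U] entering along the first would be
   another one entering this vertex. *)
case: ifP => [rU|_]; last lra.
have : flip G (rot G d) = e.
  apply: (flow_in fU) => //; rewrite flipK eE !vtx_rot //.
move/(congr1 (flip G)); rewrite flipK eE => e'.
by move: u3; rewrite /= -e' !inE eqxx andbF.
Qed.

Theorem winding_formula : exists lam : dart -> rat, forall U K,
  is_flow U -> is_curve K -> K \subset U -> winding K = \sum_(d in K)
    (lam d + local_turn U d).
Proof.
have [lam lamE] := gauss_bonnet; exists lam => U K fU cK sKU.
by rewrite lamE //; apply: eq_bigr => d dK; rewrite (turn_local fU cK).
Qed.

(** * Regions met along the axis *)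

Lemma hub_step j j' : j'.+1 = j -> reg G (flip G (bd G j)) = reg G (bd G j').
Proof.
move=> e; have -> : bd G j = hrot (bd G j').
  rewrite hrot_bd; congr (bd G _); apply: val_inj => /=.
  by rewrite e modn_small // ltn_ord.
exact: reg_hrot.
Qed.

Definition off_curve K j := (bd G j \notin K) && (flip G (bd G j) \notin K).

Lemma on_left_bd K j : off_curve K j -> on_left K (reg G (flip G (bd G j)))
  = on_left K (reg G (bd G j)).
Proof. by case/andP=> *; apply: on_left_off. Qed.

Lemma hub_walk0 K j : (forall i : 'I_m, (i < j)%N -> off_curve K i) ->
  on_left K (reg G (flip G (bd G j))) = on_left K ord0.
Proof.
case: j => k; elim: k => [|k IH] km h; last first.
  have km' := ltnW km; rewrite (@hub_step _ (Ordinal km')) //.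
  by rewrite -on_left_bd ?IH //; [move=> i ik; apply: h;
    rewrite ltnS ltnW | apply: h].
(* Around the hub, the corner before [v_1] is the corner after [v_m], which is unbounded. *)
have mm : (m.-1 < m)%N by rewrite ltn_predL.
have -> : bd G (Ordinal km) = hrot (bd G (Ordinal mm)).
  rewrite hrot_bd; congr (bd G _); apply: val_inj => /=.
  by rewrite prednK // modnn.
by rewrite reg_hrot reg_last //= prednK.
Qed.

Lemma hub_walk K (i j : 'I_m) : (i <= j)%N ->
  (forall l : 'I_m, (i < l <= j)%N -> off_curve K l) ->
  on_left K (reg G (bd G j)) = on_left K (reg G (bd G i)).
Proof.
case: j => k; elim: k => [|k IH] km /= ij h.
  by congr (on_left K (reg G (bd G _))); apply/val_inj/esym/eqP; rewrite -leqn0.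
move: ij; rewrite leq_eqVlt => /orP[/eqP e|ik].
  by congr (on_left K (reg G (bd G _))); apply: val_inj.
have km' := ltnW km; rewrite -on_left_bd ?h /= ?ik ?leqnn //
  (@hub_step _ (Ordinal km')) //.
by apply: IH => // l /andP[il lk]; apply: h; rewrite il ltnW.
Qed.

Section OneStrand.
Variables (U : {set dart}) (x : dart).
Hypotheses (fU : is_flow U) (xU : x \in U).
Let K := strand U x.
Let cK : is_curve K := strand_curve fU xU.

Lemma strand_off a b i : bd G a \in K -> flip G (bd G b) \in K -> i != a ->
  i != b ->
  off_curve K i.
Proof.
move=> aK bK ia ib; apply/andP; split; apply/negP=> h.
  by case/eqP: ia; apply: bd_inj; apply: strand_start h aK.
by case/eqP: ib; apply: bd_inj; apply: strand_end h bK.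
Qed.

Lemma strand_ends_neq a b : bd G a \in K -> flip G (bd G b) \in K -> a != b.
Proof. by move=> aK bK; apply: contraNneq (curve_anti cK aK) => ->. Qed.

(** Coming from the far left along the axis, the first end met decides: the region before a start is
    on the right of [K], the region before an end on its left. *)
Lemma on_left_open a b : bd G a \in K -> flip G (bd G b) \in K ->
  on_left K ord0 = (b < a)%N.
Proof.
move=> aK bK; have ab := strand_ends_neq aK bK.
have [lt|lt|e] := ltngtP a b; last by rewrite (val_inj e) eqxx in ab.
  rewrite -(@hub_walk0 K a) ?on_left_right // => i ia.
  by apply: (strand_off aK bK); apply/eqP=> e; rewrite e ?ltnn // in ia;
    move: lt; rewrite ltnNge ltnW.
rewrite -(@hub_walk0 K b) ?on_left_mem // => i ib.
by apply: (strand_off aK bK); apply/eqP=> e; rewrite e ?ltnn // in ib;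
  move: lt; rewrite ltnNge ltnW.
Qed.

Lemma is_closedE : is_closed K = ~~ is_open K.
Proof.
rewrite /is_closed /is_open; apply/forallP/idP=> [h|h a].
  by apply/existsPn=> j; have /andP[] := h j.
move: (h); rewrite negb_exists => /forallP/(_ a) h1.
by move: h; rewrite (flow_start_end (strand_flow x fU)) negb_exists
  => /forallP/(_ a) h2; apply/andP.
Qed.

Lemma outside_left : [forall d in K, outside K (reg G d)] = on_left K ord0.
Proof.
apply/forall_inP/existsP=> [h|[y /andP[yK c]] d dK].
  by have [d dK] := curve_ex cK; exists d; rewrite dK /= adj_csym; apply: h.
by rewrite /outside adj_csym; apply: connect_trans c; apply: (curve_left cK).
Qed.

Lemma outside_right : [forall d in K, outside K (reg G (flip G d))]
  = ~~ on_left K ord0.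
Proof.
rewrite -on_left_not // on_left_reversal.
apply/forall_inP/existsP=> [h|[y /andP[yK c]] d dK].
  by have [d dK] := curve_ex cK; exists d; rewrite dK /= adj_csym; apply: h.
by rewrite /outside adj_csym; apply: connect_trans c; apply: (curve_right cK).
Qed.

Lemma open_ccwE : is_open K -> open_counterclockwise K = ~~ on_left K ord0.
Proof.
move=> o; case/existsP: (o) => a aK.
move: (o); rewrite /is_open (flow_start_end (strand_flow x fU)) => /existsP[b
  bK].
rewrite (on_left_open aK bK) -leqNgt leq_eqVlt.
rewrite (_ : (_ == _) = false) /=; last exact/negbTE/(strand_ends_neq aK bK).
apply/existsP/idP=> [[a' /existsP[b' /and3P[h1 h2 h3]]]|ab].
  have e1 : a' = a by apply: bd_inj; apply: strand_start h1 aK.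
  have e2 : b' = b by apply: bd_inj; apply: strand_end h2 bK.
  by rewrite -e1 -e2.
by exists a; apply/existsP; exists b; apply/and3P.
Qed.

Lemma winding_strand : winding K =
  (closed_counterclockwise K || open_counterclockwise K)%:R - (closed_clockwise
    K)%:R.
Proof.
rewrite /winding /closed_clockwise /closed_counterclockwise is_closedE.
case: (boolP (is_open K)) => [o|o] /=.
  by rewrite open_ccwE // subr0.
rewrite outside_left outside_right.
have -> : open_counterclockwise K = false.
  apply/existsP=> [] [a /existsP[b /and3P[h _ _]]].
  by case/negP: o; apply/existsP; exists a.
by rewrite orbF; case: (on_left K ord0); rewrite /= ?expr1 ?expr0; lra.
Qed.

(* The strands of [U] other than [K] do not cross [K]. *)
Lemma hub_between_lt a b : bd G a \in K -> flip G (bd G b) \in K -> (a < b)%N ->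
  \sum_(i < m | (a < i < b)%N) ((bd G i \in U)%:R - (flip G (bd G i) \in U)%:R)
    = 0 :> rat.
Proof.
move=> aK bK ab; pose V := U :\: K.
have aU := subsetP (strand_sub U x) _ aK; have bU := subsetP (strand_sub U x) _
  bK.
have fV : is_flow V.
  have fK := strand_flow x fU; split=> [d|d db].
    by rewrite !inE => /andP[_ dU]; rewrite (negbTE (flow_anti fU dU)) andbF.
  rewrite (eq_bigr (fun y => curve_flow U y - curve_flow K y)).
    by rewrite sumrB !flow_cons // subrr.
  move=> y _; rewrite /curve_flow !in_setD.
  have s z : (z \in K) ==> (z \in U) by apply/implyP/(subsetP (strand_sub U x)).
  have := s y; have := s (flip G y).
  by do 4 case: (_ \in _) => //= ; rewrite ?subr0 ?subrr ?sub0r // => _ _; lra.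
have nK y : y \in V -> y \notin K /\ flip G y \notin K.
  rewrite in_setD => /andP[-> yU]; split=> //.
  by apply: contra (flow_anti fU yU); apply/subsetP/strand_sub.
(* No dart of [V] shares an interior vertex with [K], so the side of [K] is constant along the
   strands of [V]. *)
have : \sum_(d in bdry | on_left K (reg G d)) curve_flow V d = 0.
  apply: (flow_bdry fV) => [d /nK[h1 h2]|d d' db e h h'];
    first exact: on_left_off.
  apply: on_left_hvtx => //; last by apply/eqP; rewrite hvtx_vtx // e.
  apply: contra h => /imsetP[y yK /eqP]; rewrite hvtx_vtx // => /eqP/esym ey.
  have [h1 h2] := strand_vtx fU (introT orP (or_introl yK)) ey.
  rewrite /curve_flow !in_setD.
  case: (boolP (d \in U)) => [/h1 dK|_];
    case: (boolP (flip G d \in U)) => [/h2 dK'|_];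
    by rewrite -/K ?dK ?dK' ?andbF.
rewrite [LHS]big_mkcondr /= sum_codom => e; rewrite -{}[RHS]e [LHS]big_mkcond.
apply: eq_bigr => i _.
have Va : curve_flow V (bd G a) = 0.
  by rewrite /curve_flow !in_setD -/K aK (negbTE (flow_anti fU aU)) andbF.
have Vb : curve_flow V (bd G b) = 0.
  by rewrite /curve_flow !in_setD -/K bK -[bd G b]flipK
    (negbTE (flow_anti fU bU)) andbF.
have [->|ia] := eqVneq i a; first by rewrite ltnn /= Va if_same.
have [->|ib] := eqVneq i b; first by rewrite ltnn andbF Vb if_same.
have offi := strand_off aK bK ia ib.
have -> : curve_flow V (bd G i) = (bd G i \in U)%:R - (flip G (bd G i)
  \in U)%:R.
  by case/andP: offi => h1 h2; rewrite /curve_flow !in_setD h1 h2.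
(* On the axis, the left side of [K] is exactly the stretch between its ends. *)
suff -> : on_left K (reg G (bd G i)) = (a < i < b)%N by [].
have [lt|lt|e] := ltngtP i a; last by rewrite (val_inj e) eqxx in ia.
  rewrite /= -on_left_bd // (@hub_walk0 K i) ?(on_left_open aK bK) ?ltnNge
    ?(ltnW ab) // => l li.
  by apply: (strand_off aK bK); apply/eqP=> e; rewrite e in li; move: lt ab li;
    lia.
have [lt'|lt'|e] := ltngtP i b; last by rewrite (val_inj e) eqxx in ib.
  rewrite /= (@hub_walk K a i) ?on_left_mem ?(ltnW lt) // => l li.
  by apply: (strand_off aK bK); apply/eqP=> e; rewrite e in li; move: lt ab li;
    lia.
rewrite /= (@hub_walk K b i) ?(ltnW lt') //.
  by rewrite -[bd G b]flipK on_left_right.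
move=> l li; apply: (strand_off aK bK); apply/eqP=> e; rewrite e in li;
  move: lt lt' ab li; lia.
Qed.

End OneStrand.

Lemma hub_between U x a b : is_flow U -> x \in U ->
  bd G a \in strand U x -> flip G (bd G b) \in strand U x ->
  \sum_(i < m | (minn a b < i < maxn a b)%N)
    ((bd G i \in U)%:R - (flip G (bd G i) \in U)%:R) = 0 :> rat.
Proof.
move=> fU xU aK bK; have := strand_ends_neq fU xU aK bK.
have [lt|lt|e] := ltngtP a b; last by rewrite (val_inj e) eqxx.
  by move=> _; exact: (hub_between_lt fU xU aK bK).
move=> _; have xU' : flip G x \in reversal U by rewrite in_reversal flipK.
have := @hub_between_lt _ _ (flow_reversal fU) xU' b a.
rewrite strand_reversal !in_reversal flipK => /(_ bK aK lt) e.
rewrite -[RHS]oppr0 -[in RHS]e -sumrN; apply: eq_bigr => i _.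
by rewrite !in_reversal flipK opprB.
Qed.

(** * Reversing a strand *)

Definition strand_winding K : int :=
  (closed_counterclockwise K || open_counterclockwise K : nat)%:Z -
    (closed_clockwise K : nat)%:Z.

Definition strands_winding U : int := \sum_(K in strands U) strand_winding K.

Lemma strand_windingE U K : is_flow U -> K \in strands U ->
  (strand_winding K)%:~R = winding K.
Proof.
move=> fU /strandsP[x xU ->]; rewrite winding_strand // /strand_winding intrD
  rmorphN /=.
by [].
Qed.

(** After the sum over strands has become a sum over darts, it no longer matters how the darts join
    up into strands. *)
Lemma strands_windingE : exists lam : dart -> rat,
  (forall U K, is_flow U -> is_curve K -> K \subset U ->
     winding K = \sum_(d in K) (lam d + local_turn U d)) /\
  (forall U, is_flow U ->
     (strands_winding U)%:~R = \sum_(d in U) (lam d + local_turn U d)).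
Proof.
have [lam lamE] := winding_formula; exists lam; split=> // U fU.
rewrite (set_partition_big _ (strands_partition U)) /= /strands_winding
  rmorph_sum /=.
apply: eq_bigr => K KU; rewrite (strand_windingE fU KU).
case/strandsP: KU => x xU ->; apply: lamE => //; first exact: strand_curve.
exact: strand_sub.
Qed.

Lemma linked_flip U x : x \in U -> flip G x \in U -> linked U x (flip G x).
Proof.
move=> h h'; apply/and3P; rewrite touched_flip; split=> //.
by rewrite -setI_eq0 setIid touched1; apply/set0Pn;
  exists (vtx x); rewrite !inE eqxx.
Qed.

(** Forgetting directions merges no strands: replacing each dart by the one of its edge in [U]
    carries links to links. *)
Lemma strand_undirected U x : is_flow U -> x \in U ->
  strand (U :|: reversal U) x = strand U x :|: reversal (strand U x).
Proof.
move=> fU xU; pose S := U :|: reversal U.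
have key y : y \in U -> connect (linked S) x y = connect (linked U) x y.
  move=> yU; apply/idP/idP=> [c|].
    pose h d := if d \in U then d else flip G d.
    have := @linked_map S U h _ _ x y c; rewrite /h xU yU; apply=> d.
      by rewrite in_setU; case: ifP => //= _; rewrite in_reversal.
    by case: ifP => // _; rewrite touched_flip.
  by apply: (@linked_map U S id) => // d; rewrite in_setU => ->.
apply/setP=> y; rewrite in_setU in_reversal !inE.
case: (boolP (y \in U)) => yU /=.
  by rewrite key // (negbTE (flow_anti fU yU)) orbF.
case: (boolP (flip G y \in U)) => //= yU'.
rewrite -key //; apply: (same_connect_r (linked_csym S)); apply: connect1.
by apply: linked_flip; rewrite in_setU !in_reversal ?flipK yU' ?orbT.
Qed.

(* [b d] stands for the binary label of the edge of [d] if [d] has the direction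
   of this edge, and for its complement otherwise. *)
Definition labeling := {ffun dart -> bvec n}.
Implicit Types (b : labeling) (c : 'I_n.-1) (p : 'I_n).

(** The vertex condition is conservation in a form symmetric in the positions, hence stable under
    permuting them; comparing two positions turns it into a flow. *)
Definition good b : bool :=
  [&& [forall d, forall p, b (flip G d) p == ~~ b d p],
      [forall d in fwd G, ones (b d) == wt G d]
    & [forall d, (d \notin bdry) ==> [forall p, forall p',
         (\sum_(x in vtx d) b x p == \sum_(x in vtx d) b x p')%N]]].

Lemma goodP b : reflect [/\ forall d p, b (flip G d) p = ~~ b d p,
   {in fwd G, forall d, ones (b d) = wt G d} &
   forall d, d \notin bdry -> forall p p',
     (\sum_(x in vtx d) b x p = \sum_(x in vtx d) b x p')%N] (good b).
Proof.
apply: (iffP and3P) => [[h1 h2 h3]|[h1 h2 h3]]; split.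
- by move=> d p; apply/eqP; move/forallP/(_ d)/forallP/(_ p): h1.
- by move=> d df; apply/eqP; move/forall_inP/(_ d df): h2.
- move=> d db p p'; apply/eqP.
  by move/forallP/(_ d)/implyP/(_ db)/forallP/(_ p)/forallP/(_ p'): h3.
- by apply/forallP=> d; apply/forallP=> p; rewrite h1.
- by apply/forall_inP=> d df; rewrite h2.
apply/forallP=> d; apply/implyP=> db; apply/forallP=> p; apply/forallP=> p'.
by apply/eqP/h3.
Qed.

Definition label_flow b p p' : {set dart} := [set d | b d p && ~~ b d p'].

Lemma label_flow_reversal b p p' : good b -> reversal (label_flow b p p')
  = label_flow b p' p.
Proof.
by case/goodP=> h _ _; apply/setP=> d; rewrite !inE !h negbK andbC.
Qed.

Lemma label_flow_curve_flow b p p' d : good b ->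
  curve_flow (label_flow b p p') d = (b d p)%:R - (b d p')%:R.
Proof.
move=> gb; rewrite /curve_flow -in_reversal label_flow_reversal // !inE.
by case: (b d p); case: (b d p').
Qed.

Lemma label_flow_flow b p p' : good b -> is_flow (label_flow b p p').
Proof.
move=> gb; split=> [d|d db].
  by rewrite -in_reversal label_flow_reversal // !inE => /andP[-> /negbTE ->].
under eq_bigr do rewrite label_flow_curve_flow //.
case/goodP: gb => _ _ /(_ d db p p') e.
by rewrite sumrB -!natr_sum e subrr.
Qed.

(** * Exchanging two adjacent positions along a strand *)

Lemma swap_bitsE c (v : bvec n) p : swap_bits c v p
  = v (tperm (pos_i c) (pos_i1 c) p).
Proof. by rewrite ffunE. Qed.

Lemma swap_bitsK c : involutive (@swap_bits n c).
Proof. by move=> v; apply/ffunP=> p; rewrite !swap_bitsE tpermK. Qed.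

Lemma swap_bits_id c (v : bvec n) : v (pos_i c) = v (pos_i1 c) -> swap_bits c v
  = v.
Proof. by move=> e; apply/ffunP=> p; rewrite swap_bitsE;
  case: tpermP => // ->. Qed.

Lemma pos_lt c : (pos_i c < pos_i1 c)%N.
Proof. exact: leqnn. Qed.

(** A simple transposition has a single inversion. *)
Lemma tperm_lt c (u v : 'I_n) : (u < v)%N -> (u, v) != (pos_i c, pos_i1 c) ->
  (tperm (pos_i c) (pos_i1 c) u < tperm (pos_i c) (pos_i1 c) v)%N.
Proof.
have vE (w : 'I_n) : tperm (pos_i c) (pos_i1 c) w =
    (if w == c :> nat then c.+1 else if w == c.+1 :> nat then c : nat else w)
      :> nat.
  case: tpermP => [->|->|/eqP + /eqP]; rewrite /= ?eqxx //.
    by rewrite gtn_eqF.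
  by rewrite -!val_eqE /= => /negbTE -> /negbTE ->.
move=> uv; rewrite xpair_eqE -!val_eqE /= !vE; move: uv.
by do ?[case: eqP => /= ?]; lia.
Qed.

Section Exchange.
Variable c : 'I_n.-1.
Notation p0 := (pos_i c).
Notation p1 := (pos_i1 c).

Definition color_support b : {set dart} := label_flow b p0 p1 :|: label_flow b
  p1 p0.

Lemma in_color_support b d : (d \in color_support b) = (b d p0 != b d p1).
Proof. by rewrite !inE; case: (b d p0); case: (b d p1). Qed.

Definition exchange_set b j : {set dart} := strand (color_support b) (bd G j).

(* Reverses the open strand for the positions [p0], [p1] that ends at [v_j]. The
   support of the strand is unchanged, which makes this an involution. *)
Definition exchange b j : labeling :=
  [ffun d => if d \in exchange_set b j then swap_bits c (b d) else b d].

Definition other_end b j : 'I_m :=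
  odflt j [pick l | (l != j) && (bd G l \in exchange_set b j)].

Lemma color_support_exchange b j : color_support (exchange b j) = color_support
  b.
Proof.
apply/setP=> d; rewrite !in_color_support ffunE; case: ifP => // _.
by rewrite !swap_bitsE tpermL tpermR eq_sym.
Qed.

Section OneExchange.
Variables (b : labeling) (a e : 'I_m).
Hypothesis gb : good b.
Let U := label_flow b p0 p1.
Hypothesis aU : bd G a \in U.
Let K := strand U (bd G a).
Hypothesis eK : flip G (bd G e) \in K.
Let fU : is_flow U := label_flow_flow p0 p1 gb.
Let cK : is_curve K := strand_curve fU aU.

Let aK : bd G a \in K.
Proof. by rewrite inE aU connect0. Qed.

Let ae : a != e.
Proof. exact: strand_ends_neq aK eK. Qed.

Lemma color_supportE : color_support b = U :|: reversal U.
Proof. by rewrite /color_support label_flow_reversal. Qed.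

Lemma exchange_set_start : exchange_set b a = K :|: reversal K.
Proof. by rewrite /exchange_set color_supportE strand_undirected. Qed.

Lemma exchange_set_end : exchange_set b e = K :|: reversal K.
Proof.
rewrite -exchange_set_start /exchange_set; apply/setP=> d; rewrite !inE;
  congr (_ && _).
apply: (same_connect (linked_csym _)); rewrite linked_csym.
have : bd G e \in exchange_set b a by rewrite exchange_set_start in_setU
  [X in _ || X]in_reversal eK orbT.
by rewrite inE => /andP[].
Qed.

Lemma in_exchange_set l : (bd G l \in exchange_set b a) = (l == a) || (l == e).
Proof.
rewrite exchange_set_start in_setU in_reversal;
  apply/idP/idP=> [/orP[h|h]|/orP[]/eqP ->].
- by rewrite (bd_inj (strand_start fU h aK)) eqxx.
- by rewrite (bd_inj (strand_end fU h eK)) eqxx orbT.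
- by rewrite aK.
by rewrite eK orbT.
Qed.

Lemma other_end_start : other_end b a = e.
Proof.
rewrite /other_end; case: pickP => [l|/(_ e)]; rewrite in_exchange_set.
  by case/andP=> /negbTE -> /eqP.
by rewrite eq_sym ae eqxx orbT.
Qed.

Lemma other_end_end : other_end b e = a.
Proof.
rewrite /other_end exchange_set_end -exchange_set_start;
  case: pickP => [l|/(_ a)]; rewrite in_exchange_set.
  by case/andP=> /negbTE ->; rewrite orbF => /eqP.
by rewrite ae eqxx.
Qed.

Lemma exchange_end : exchange b e = exchange b a.
Proof. by apply/ffunP=> d; rewrite !ffunE exchange_set_end exchange_set_start.
  Qed.

Let meets d := [exists x in vtx d, x \in K :|: reversal K].

Lemma meets_vtx d d' : vtx d = vtx d' -> meets d = meets d'.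
Proof. by move=> ev; rewrite /meets ev. Qed.

(** A dart at a vertex of [K] whose edge is not on [K] has equal bits at [p0] and [p1], so swapping
    them does nothing. Hence one permutation of positions serves all darts at a vertex. *)
Lemma exchange_vtx d : exchange b a d = if meets d then swap_bits c (b d)
  else b d.
Proof.
rewrite ffunE exchange_set_start; case: ifPn => [dK|dK].
  by rewrite ifT //; apply/exists_inP; exists d => //; exact: vtx_id.
case: ifP => // /exists_inP[x xd xK]; rewrite swap_bits_id //; apply/eqP.
apply: contraT; rewrite -in_color_support color_supportE => dU.
rewrite in_setU in_reversal in xK.
have [h1 h2] := strand_vtx fU xK (vtx_mem xd).
by move: dK; rewrite in_setU in_reversal; case/setUP: dU => [/h1 -> //|];
  rewrite in_reversal => /h2 ->; rewrite orbT.
Qed.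

Let sig d p : 'I_n := if meets d then tperm p0 p1 p else p.

Lemma exchange_sig d p : exchange b a d p = b d (sig d p).
Proof. by rewrite exchange_vtx /sig; case: ifP => // _; rewrite swap_bitsE. Qed.

Lemma exchange_good : good (exchange b a).
Proof.
case/goodP: (gb) => h1 h2 h3; apply/goodP; split.
- move=> d p; rewrite !ffunE exchange_set_start !in_setU !in_reversal flipK
  orbC.
  by case: ifP => _; rewrite ?swap_bitsE h1.
- move=> d df; rewrite -h2 // ffunE; case: ifP => // _.
  rewrite /ones -[RHS](card_imset _ (@perm_inj _ (tperm p0 p1))) /=.
  apply: eq_card => p; rewrite inE swap_bitsE -[p in RHS](tpermK p0 p1).
  by rewrite mem_imset ?inE //; exact: perm_inj.
move=> d db p p'; rewrite (eq_bigr (fun x => b x (sig d p) : nat)); last first.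
  by move=> x /vtx_mem ev; rewrite exchange_sig /sig (meets_vtx ev).
rewrite [RHS](eq_bigr (fun x => b x (sig d p') : nat)); last first.
  by move=> x /vtx_mem ev; rewrite exchange_sig /sig (meets_vtx ev).
exact: h3.
Qed.

Let U' := label_flow (exchange b a) p0 p1.

Lemma label_flow_exchange : U' = (U :\: K) :|: reversal K.
Proof.
have sK d : d \in K -> b d p0 && ~~ b d p1.
  by move/(subsetP (strand_sub _ _)); rewrite inE.
apply/setP=> d; rewrite inE ffunE exchange_set_start !in_setU in_setD
  in_reversal.
case: (boolP (d \in K)) => /= dK.
  rewrite !swap_bitsE tpermL tpermR (negbTE (curve_anti cK dK)).
  by case/andP: (sK _ dK) => -> /negbTE ->.
case: (boolP (flip G d \in K)) => /= dK'; last by rewrite orbF inE.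
rewrite !swap_bitsE tpermL tpermR orbT.
by have := sK _ dK'; case/goodP: gb => h _ _; rewrite !h negbK andbC => ->.
Qed.

Lemma exchange_eU : bd G e \in U'.
Proof. by rewrite label_flow_exchange in_setU [in X in _ || X]in_reversal eK
  orbT. Qed.

Lemma exchangeK : exchange (exchange b a) e = b.
Proof.
apply/ffunP=> d; rewrite ffunE /exchange_set color_support_exchange
  -/(exchange_set b e) exchange_set_end -exchange_set_start.
by rewrite [exchange b a d]ffunE; case: (d \in exchange_set b a);
  rewrite ?swap_bitsK.
Qed.

Lemma exchange_aK : flip G (bd G a) \in strand U' (bd G e).
Proof.
have : bd G a \in exchange_set (exchange b a) e.
  by rewrite /exchange_set color_support_exchange -/(exchange_set b e)
    exchange_set_end in_setU aK.
have gb' := exchange_good; have fU' : is_flow U' := label_flow_flow p0 p1 gb'.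
rewrite /exchange_set /color_support -(label_flow_reversal p0 p1 gb')
  strand_undirected ?exchange_eU // in_setU in_reversal.
case/orP=> // h; case/eqP: ae; apply: bd_inj; apply: (strand_start fU') h _.
by rewrite inE exchange_eU connect0.
Qed.

Lemma exchange_bd l : l != a -> l != e -> exchange b a (bd G l) = b (bd G l).
Proof. by move=> la le; rewrite ffunE in_exchange_set (negbTE la) (negbTE le).
  Qed.

Lemma exchange_bd_ends l : (l == a) || (l == e) -> exchange b a (bd G l)
  = swap_bits c (b (bd G l)).
Proof. by move=> h; rewrite ffunE in_exchange_set h. Qed.

(* At each vertex the exchange permutes the positions of all labels by the same
   permutation, so it permutes the turning contributions of the pairs of
   positions; and it preserves the sum of the corresponding flows. *)
Lemma winding_exchange_other : 
  \sum_(pp : 'I_n * 'I_n | (pp.1 < pp.2)%N && (pp != (p0, p1))) strands_winding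
    (label_flow (exchange b a) pp.1 pp.2) =
  \sum_(pp : 'I_n * 'I_n | (pp.1 < pp.2)%N && (pp != (p0, p1))) strands_winding
    (label_flow b pp.1 pp.2).
Proof.
have [lam [_ lamE]] := strands_windingE.
apply: (@intr_inj rat); rewrite !rmorph_sum /=.
have fl b' pp : good b' -> is_flow (label_flow b' pp.1 pp.2) by move=> ?;
  apply: label_flow_flow.
have wE b' (pp : 'I_n * 'I_n) : good b' ->
  (strands_winding (label_flow b' pp.1 pp.2))%:~R =
    \sum_d (if d \in label_flow b' pp.1 pp.2 then lam d + local_turn
      (label_flow b' pp.1 pp.2) d else 0).
  by move=> gb'; rewrite (lamE _ (fl _ pp gb')); apply: big_mkcond.
rewrite (eq_bigr _ (fun pp _ => wE _ pp exchange_good)).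
rewrite [RHS](eq_bigr _ (fun pp _ => wE _ pp gb)).
(* The darts are fixed first, because the permutation of the pairs varies from vertex to vertex. *)
rewrite exchange_big [RHS]exchange_big; apply: eq_bigr => d _ /=.
pose h (pp : 'I_n * 'I_n) : 'I_n * 'I_n := (sig d pp.1, sig d pp.2).
have hK : involutive h.
  by case=> u v; rewrite /h /sig /=; case: (meets d); rewrite ?tpermK.
have hP (pp : 'I_n * 'I_n) : (pp.1 < pp.2)%N && (pp != (p0, p1)) ->
    ((h pp).1 < (h pp).2)%N && (h pp != (p0, p1)).
  case: pp => u v; rewrite /h /sig /=; case: (meets d) => // /andP[uv ne].
  apply/andP; split; last first.
    apply: contraTneq uv => -[eu ev]; rewrite -leqNgt.
    by rewrite -(tpermK p0 p1 u) -(tpermK p0 p1 v) eu ev tpermL tpermR ltnW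
      ?pos_lt.
  exact: tperm_lt.
rewrite [RHS](reindex_inj (inv_inj hK)) /=; apply: eq_big => [pp|pp _].
  by apply/idP/idP=> [/hP //|/hP]; rewrite hK.
have lE y q q' : vtx y = vtx d -> (y \in label_flow (exchange b a) q q')
  = (y \in label_flow b (sig d q) (sig d q')).
  by move=> /meets_vtx ev; rewrite !inE !exchange_sig /sig ev.
rewrite lE //; case: ifP => // _; congr (_ + _); rewrite /local_turn;
  case: ifP => // _; case: ifP => // _.
rewrite -!in_reversal !label_flow_reversal ?exchange_good // lE //;
  exact: vtx_rot.
Qed.

(** [K] is a strand before the exchange and is present reversed after it, so the order of its ends
    gives both windings. The other darts of [U] start at no vertex of [K], so their [local_turn]
    does not notice the reversal. *)
Lemma winding_exchange_main : strands_winding U' = strands_winding U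
  + (e < a)%N%:Z - (a < e)%N%:Z.
Proof.
have fU' : is_flow U' := label_flow_flow p0 p1 exchange_good.
have cK' := curve_reversal cK.
have sKU : K \subset U := strand_sub _ _.
have sKU' : reversal K \subset U' by rewrite label_flow_exchange subsetUr.
have [lam [lamE totE]] := strands_windingE.
have wK : winding K = (a < e)%N%:R.
  rewrite /winding ifT; last by apply/existsP; exists a.
  rewrite (on_left_open fU aU aK eK) -leqNgt leq_eqVlt.
  by rewrite (_ : (_ == _) = false) //; exact/negbTE/ae.
have wK' : winding (reversal K) = (e < a)%N%:R.
  rewrite /winding ifT; last by apply/existsP; exists e; rewrite in_reversal.
  by rewrite on_left_not // negbK (on_left_open fU aU aK eK).
have eU : \sum_(d in U) (lam d + local_turn U d) =
    \sum_(d in U :\: K) (lam d + local_turn U d) + winding K.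
  by rewrite (big_setID K) /= (setIidPr sKU) -lamE // addrC.
have eU' : \sum_(d in U') (lam d + local_turn U' d) =
    \sum_(d in U :\: K) (lam d + local_turn U' d) + winding (reversal K).
  rewrite (big_setID (reversal K)) /= (setIidPr sKU') -lamE // addrC;
    congr (_ + _).
  apply: eq_bigl => d; rewrite label_flow_exchange !(in_setD, in_setU,
    in_reversal).
  case: (boolP (flip G d \in K)) => //= dK; last by rewrite orbF.
  apply/esym/negbTE/negP=> /andP[_ dU]; move/negP: (flow_anti fU dU); apply.
  exact: (subsetP sKU).
have eD : \sum_(d in U :\: K) (lam d + local_turn U' d) = \sum_(d in U :\: K)
  (lam d + local_turn U d).
  apply: eq_bigr => d; rewrite in_setD => /andP[dK dU]; congr (_ + _).
  rewrite /local_turn; case: ifP => // _; case: ifP => // _.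
  rewrite label_flow_exchange in_setU in_setD in_reversal flipK.
  have nv y : vtx y = vtx d -> (y \in K) || (flip G y \in K) = false.
    move=> ev; apply/negP=> h; have [h1 _] := strand_vtx fU h ev.
    by move: dK; rewrite h1.
  have := nv _ (vtx_rot d).
  by move/negbT; rewrite negb_or => /andP[/negbTE -> /negbTE ->]; rewrite orbF.
apply: (@intr_inj rat); rewrite !rmorphD rmorphN /= !totE // eU eU' eD wK wK'.
by rewrite -!pmulrn; lra.
Qed.

Lemma winding_exchange :
  \sum_(pp : 'I_n * 'I_n | (pp.1 < pp.2)%N) strands_winding
    (label_flow (exchange b a) pp.1 pp.2) =
  \sum_(pp : 'I_n * 'I_n | (pp.1 < pp.2)%N) strands_winding (label_flow b pp.1
    pp.2)
   + (e < a)%N%:Z - (a < e)%N%:Z.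
Proof.
rewrite (bigD1 (p0, p1)) ?pos_lt //= winding_exchange_other -/U'
  winding_exchange_main.
by rewrite [in RHS](bigD1 (p0, p1)) ?pos_lt //=; lra.
Qed.

End OneExchange.
End Exchange.

(** * Strandings and labelings *)

Lemma touched_mem U v : v \in touched U -> exists2 x, x \in U & v \in touched
  [set x].
Proof.
rewrite in_setU => /orP[] /imsetP[x xU ->]; exists x => //;
  rewrite touched1 !inE eqxx ?orbT //.
Qed.

Lemma touched_sub U x : x \in U -> touched [set x] \subset touched U.
Proof.
move=> xU; rewrite touched1; apply/subsetP=> v; rewrite !inE => /orP[] /eqP ->.
  by rewrite imset_f.
by rewrite [X in _ || X](imset_f (fun d => vtx (flip G d))) ?orbT.
Qed.

Lemma strands_disjoint U K L : K \in strands U -> L \in strands U -> K != L ->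
  [disjoint touched K & touched L].
Proof.
case/strandsP=> x xU -> /strandsP[y yU ->]; apply: contraR.
rewrite -setI_eq0 => /set0Pn[v];
  rewrite inE => /andP[/touched_mem[z zx vz] /touched_mem[w wy vw]].
move: zx wy; rewrite !inE => /andP[zU cz] /andP[wU cw].
have c : connect (linked U) x y.
  apply: connect_trans cz _; rewrite linked_csym; apply: connect_trans cw _.
  apply: connect1; rewrite linked_sym; apply/and3P; split=> //.
  by rewrite -setI_eq0; apply/set0Pn; exists v; rewrite inE vz.
by apply/eqP/setP=> u; rewrite !inE (same_connect (linked_csym U) c).
Qed.

Lemma strand_mem U x y : y \in strand U x -> strand U y = strand U x.
Proof.
rewrite inE => /andP[_ c]; apply/setP=> u.
by rewrite !inE (same_connect (linked_csym U) c).
Qed.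

Lemma simple_strandI K (s : seq dart) : {in K, forall d, flip G d \notin K} ->
  uniq s -> K =i s -> closed_path s || open_path s -> is_simple_strand K.
Proof.
move=> an us Ks h; apply/andP; split; first exact/forall_inP.
have sz : size s == #|K| by rewrite (eq_card Ks) (card_uniqP us).
apply/existsP; exists (Tuple sz); rewrite h andbT.
by apply/eqP/setP=> d; rewrite inE Ks.
Qed.

(** The orbit of [next_dart] lists the darts of the strand in order, from its start if it is open
    and from any dart if it is closed. *)
Lemma strand_simple U x : is_flow U -> x \in U -> is_simple_strand (strand U x).
Proof.
move=> fU xU; set K := strand U x; have fK : is_flow K := strand_flow x fU.
have cK : is_curve K := strand_curve fU xU.
have an := flow_anti fK.
have sKU : K \subset U := strand_sub U x.
have uvtx s : {subset s <= K} -> uniq s -> uniq (map (@vtx m G) s).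
  move=> sK us; rewrite map_inj_in_uniq // => y z /sK yK /sK zK.
  exact: (flow_out fK).
have next_dartE y : y \in K -> next_dart U y = next_dart K y.
  move=> yK; rewrite /next_dart; case: pickP => [z /andP[zU /eqP e]|h] /=.
    have h : (flip G y \in K) || (flip G (flip G y) \in K) by rewrite flipK yK
      orbT.
    have [h1 _] := strand_vtx fU h (esym e).
    by rewrite -/(next_dart K y) (next_dart_eq fK (h1 zU)).
  case: pickP => // z /andP[zK /eqP e]; have := h z.
  by rewrite (subsetP sKU _ zK) e eqxx.
have nU y : y \in K -> next_dart U y \in K by move=> yK; rewrite next_dartE //;
  case: (next_dartP yK).
have orbK y : y \in K -> {subset orbit (next_dart U) y <= K}.
  move=> yK z; rewrite -fconnect_orbit => /iter_findex <-.
  by elim: (findex _ _ _) => //= k; apply: nU.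
case: (boolP (is_open K)) => [o|no].
  case/existsP: (o) => a aK; have aU := subsetP sKU _ aK.
  move: (o); rewrite /is_open flow_start_end // => /existsP[e eK].
  pose s := orbit (next_dart U) (bd G a).
  have sK : K =i s.
    move=> y; apply/idP/idP=> [yK|]; last exact: orbK.
    have : connect (linked U) (bd G a) y.
      by move: yK; rewrite /K -(strand_mem aK) inE => /andP[].
    by case/strand_iter=> // k ->; rewrite /s -fconnect_orbit fconnect_iter.
  have us : uniq s by exact: orbit_uniq.
  apply: (simple_strandI an us sK); apply/orP; right.
  have enxt : next_dart U (flip G (bd G e)) = flip G (bd G e).
    rewrite next_dartE //; case: (next_dartP eK) => h [-> //|]; rewrite flipK.
    move/esym/(vtx_bdry (bd_codom e)) => h'; rewrite -h' in h.
    by move: (an _ h); rewrite eK.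
  have se : s = bd G a :: behead s by rewrite /s /orbit -orderSpred.
  have fp : fpath (next_dart U) (bd G a) (behead s).
    by rewrite /s /orbit -orderSpred /= fpath_traject.
  have le : last (bd G a) (behead s) = flip G (bd G e).
    have : flip G (bd G e) \in bd G a :: behead s by rewrite -se -sK.
    (* [next_dart] fixes the dart that reaches the axis, and an orbit has no repetition, so nothing
       follows that dart. *)
    case/splitPl Ep: _ / => [p1 p2 lp]; rewrite Ep in fp se;
      rewrite last_cat lp.
    case: p2 Ep fp se => //= z p2 Ep fp se; move: fp;
      rewrite cat_path lp /= => /and3P[_ /eqP ez _].
    move: us; rewrite se -ez enxt -lp -cat_cons cat_uniq /= => /and3P[_ + _].
    by rewrite negb_or mem_last.
  rewrite se; apply/and4P; split.
  - have sub : {subset behead s <= K} by move=> y yb; rewrite sK se inE yb orbT.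
    move: fp us; rewrite se; elim: (behead s) (bd G a) aK sub {se le} => //= z
      p IH y yK sub.
    case/andP=> /eqP ez fp /andP[+ uz]; rewrite inE negb_or => /andP[yz _].
    have zK : z \in K by apply: sub; rewrite mem_head.
    rewrite IH // ?andbT; last by move=> w wp; apply: sub; rewrite inE wp orbT.
    case: (next_dartP yK) => _ [h|h]; first by rewrite -next_dartE // ez in h;
      rewrite h eqxx in yz.
    by rewrite /follows /= -ez next_dartE // h.
  - exact: bd_codom.
  - by rewrite le flipK bd_codom.
  rewrite -se le flipK rcons_uniq uvtx ?andbT //; last by move=> y; rewrite sK.
  apply/mapP=> -[y ys ey]; rewrite -(vtx_bdry (bd_codom e) ey) -sK in ys.
  by move: (an _ ys); rewrite eK.
have noe d : d \in K -> flip G d \notin bdry.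
  move=> dK; apply: contra no => /codomP[j ej].
  by rewrite /is_open flow_start_end //; apply/existsP;
    exists j; rewrite -ej flipK.
have fol y : y \in K -> vtx (next_dart U y) = vtx (flip G y).
  move=> yK; have [z zK e] := flow_next fK yK (noe _ yK).
  by rewrite (next_dart_eq fU (subsetP sKU _ zK)).
have injn : {in K &, injective (next_dart U)}.
  by move=> y z yK zK e; apply: (flow_in fK) => //; rewrite -!fol // e.
have xK : x \in K by rewrite inE xU connect0.
pose s := orbit (next_dart U) x.
have us : uniq s by exact: orbit_uniq.
have sK : K =i s.
  move=> y; apply/idP/idP=> [yK|]; last exact: orbK.
  rewrite -fconnect_orbit; have : connect (linked U) x y by move: yK;
    rewrite inE => /andP[].
  case/connectP=> p + e; elim/last_ind: p y yK e => [|p z IH] y yK.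
    by move=> -> _; exact: connect0.
  rewrite last_rcons rcons_path => ez; rewrite {y}ez in yK * => /andP[hp l];
    have [wU zU h] := linkedE fU l.
  set w := last x p in l wU h; have wK : w \in K.
    move: yK; rewrite !inE wU => /andP[_ cz];
      apply: connect_trans cz (connect1 _).
    by rewrite linked_sym.
  have {}IH := IH w wK erefl hp; apply: connect_trans IH _.
  case: h => [->|h|h]; first exact: connect0.
    by rewrite -(next_dart_eq fU zU h) fconnect1.
  (* [next_dart] is injective on the closed strand, so its orbits are cycles and a backward link
     stays in the orbit. *)
  rewrite (fconnect_sym_in (S := mem K)) //.
  by rewrite -(next_dart_eq fU wU h) fconnect1.
apply: (simple_strandI an us sK); apply/orP; left; apply/and3P; split.
- by rewrite /s /orbit -orderSpred.
- have := cycle_orbit_in (S := mem K) nU injn xK; rewrite -/s.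
  apply: (@sub_in_cycle _ (mem K)); last by apply/allP=> y; rewrite -sK.
  by move=> y z yK _ /eqP <-; rewrite /follows /= fol.
by apply: uvtx => // y; rewrite sK.
Qed.

Notation strandings := (colored_strands n G).
Implicit Types (S : strandings) (A B : {set dart}).

Definition stranding_of b : strandings :=
  [set cA | cA.2 \in strands (label_flow b (pos_i cA.1) (pos_i1 cA.1))].

Lemma in_color_stranding_of b c d :
  in_color (stranding_of b) c d = (d \in label_flow b (pos_i c) (pos_i1 c)).
Proof.
apply/existsP/idP=> [[[c' A]]|dU].
  rewrite inE /= => /and3P[AU /eqP cc dA]; rewrite cc in AU.
  by case/strandsP: AU dA => x xU ->; apply/subsetP/strand_sub.
exists (c, strand (label_flow b (pos_i c) (pos_i1 c)) d); rewrite inE /= eqxx.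
apply/andP; split; first by apply/strandsP; exists d.
by rewrite inE dU connect0.
Qed.

Lemma alpha_stranding_of b d c : good b -> alpha (stranding_of b) d c = dbit
  (b d) c.
Proof.
move=> gb; rewrite /alpha !in_color_stranding_of -in_reversal
  label_flow_reversal // !inE /dbit.
by case: (b d _); case: (b d _).
Qed.

Lemma stranding_of_stranding b : good b -> is_stranding (stranding_of b).
Proof.
move=> gb; apply/andP; split.
  apply/forall_inP=> -[c A]; rewrite inE => /strandsP[x xU ->].
  by apply: strand_simple => //; apply: label_flow_flow.
apply/forall_inP=> -[c A]; rewrite inE /= => AU; apply/forall_inP=> -[c' B];
  rewrite inE /= => BU.
apply/implyP=> /andP[/eqP cc ne]; rewrite -cc in BU ne.
by apply: (strands_disjoint AU BU); apply: contraNneq ne => ->.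
Qed.

Lemma wt_bounds d : (0 < wt G d < n)%N.
Proof. by case: webG => _ _ _ h _; case: (h d). Qed.

Lemma good_dbit_ex b d : good b -> d \in fwd G -> exists c, dbit (b d) c != 0.
Proof. by case/goodP=> _ h _ /h e; apply: dbit_ex; rewrite e wt_bounds. Qed.

Lemma is_cmaxP S d c : reflect
  (alpha S d c != 0 /\ forall c', (c < c')%N -> alpha S d c' = 0)
    (is_cmax S d c).
Proof.
apply: (iffP andP) => [[h1 /forallP h2]|[h1 h2]]; split=> //.
  by move=> c' cc'; apply/eqP/(implyP (h2 c')).
by apply/forallP=> c'; apply/implyP=> /h2 ->.
Qed.

Lemma is_cmax_uniq S d c c' : is_cmax S d c -> is_cmax S d c' -> c = c'.
Proof.
case/is_cmaxP=> h1 h2 /is_cmaxP[h1' h2']; apply: val_inj => /=.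
case: (ltngtP c c') => // [/h2|/h2'] e; first by rewrite e eqxx in h1'.
by rewrite e eqxx in h1.
Qed.

Lemma stranding_of_valid b : good b -> valid (stranding_of b).
Proof.
move=> gb; apply/forall_inP=> d df; apply/andP; split.
  apply/forallP=> c; apply/forallP=> c';
    apply/implyP=> /and4P[cc' h h' /forallP h0].
  rewrite !alpha_stranding_of // in h h' *; apply/eqP/dbit_alternate => // c''
    h''.
  by have := h0 c''; rewrite h'' alpha_stranding_of // => /eqP.
have [c0 /max_nonzero[c [hc hm]]] := good_dbit_ex gb df.
apply/existsP; exists c; apply/andP; split.
  by apply/is_cmaxP; split=> [|c' /hm]; rewrite alpha_stranding_of.
under eq_bigr do rewrite alpha_stranding_of //.
have [w1 w2] := andP (wt_bounds d).
rewrite sum_dbit_weight; last exact: leq_ltn_trans w2.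
case/goodP: (gb) => _ h _; rewrite h // alpha_stranding_of //; have [e1 e2] :=
  dbit_max hc hm.
by rewrite e1; case: (bitz01 (b d) n.-1) => ->; rewrite ?mulr0 ?mulr1 ?subr0.
Qed.

Lemma last_bit_stranding_of b d : good b -> d \in fwd G ->
  (last_bit (stranding_of b) d : nat)%:Z = bitz (b d) n.-1.
Proof.
move=> gb df; rewrite /last_bit /directed df.
have [c0 /max_nonzero[c [hc hm]]] := good_dbit_ex gb df.
have [e1 e2] := dbit_max hc hm.
have -> : [exists c, is_cmax (stranding_of b) d c &&
  (alpha (stranding_of b) d c == -1)] = (bitz (b d) n.-1 == 1).
  rewrite -e2; apply/existsP/idP=> [[c' /andP[/is_cmaxP[h1 h2]]]|e].
    have cc : c' = c.
      apply: (@is_cmax_uniq (stranding_of b) d); apply/is_cmaxP;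
        split=> // [|c'' /hm].
        by rewrite alpha_stranding_of.
      by rewrite alpha_stranding_of.
    by rewrite cc alpha_stranding_of.
  exists c; rewrite alpha_stranding_of // e andbT; apply/is_cmaxP.
  by split=> [|c' /hm]; rewrite alpha_stranding_of.
by case: (bitz01 (b d) n.-1) => ->.
Qed.

Definition labeling_of S : labeling :=
  [ffun d => [ffun p => if d \in fwd G then label S d p else ~~ label S d p]].

Lemma label_flip S d : label S (flip G d) = label S d.
Proof.
have e : directed (flip G d) = directed d :> dart.
  by rewrite /directed fwd_flip flipK; case: (d \in fwd G).
by rewrite /label /last_bit e.
Qed.

Lemma labeling_ofE S d p : labeling_of S d p = if d \in fwd G then label S d p
  else ~~ label S d p.
Proof. by rewrite ffunE ffunE. Qed.

Lemma labeling_of_flip S d p : labeling_of S (flip G d) p = ~~ labeling_of S d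
  p.
Proof. by rewrite !labeling_ofE label_flip fwd_flip;
  case: (d \in fwd G) => //=; rewrite negbK. Qed.

Lemma stranding_ofK b : good b -> labeling_of (stranding_of b) = b.
Proof.
move=> gb; have fwdE d : d \in fwd G -> labeling_of (stranding_of b) d = b d.
  move=> df; apply/ffunP=> p; rewrite !ffunE df.
  rewrite last_bit_stranding_of // /directed df (eq_bigr (dbit (b d)));
    last by move=> c _; rewrite alpha_stranding_of.
  rewrite sum_dbit_ge; last by rewrite -ltnS prednK //
    (leq_ltn_trans _ (ltn_ord p)).
  by rewrite addrC subrK bitz_val; case: (b d p).
apply/ffunP=> d; have [/fwdE //|df] := boolP (d \in fwd G).
apply/ffunP=> p; rewrite -[d]flipK labeling_of_flip fwdE ?fwd_flip //.
by case/goodP: gb => h _ _; rewrite [RHS]h.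
Qed.

(** In both cases of the definition the boundary label is the label read toward the axis, the
    complement of that of the dart leaving it. *)
Lemma boundary_labelE S j : boundary_label S j = [ffun p => ~~ labeling_of S
  (bd G j) p].
Proof.
apply/ffunP=> p; rewrite /labeling_of !ffunE /sgn_at.
by case: (bd G j \in fwd G) => //=; rewrite negbK.
Qed.

Section Valid.
Variable S : strandings.
Hypotheses (sS : is_stranding S) (vS : valid S).

Lemma alpha_flip d c : alpha S (flip G d) c = - alpha S d c.
Proof. by rewrite /alpha flipK opprB. Qed.

Lemma alpha01 d c : [\/ alpha S d c = 0, alpha S d c = 1 | alpha S d c = -1].
Proof.
by rewrite /alpha; do 2 case: (in_color _ _ _);
  [constructor 1|constructor 2|constructor 3|constructor 1].
Qed.

(** The tail sums of an alternating sequence are bits. By [sum_dbit_weight] the weight condition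
    then fixes the number of ones, the sign of the largest color being the last bit. *)
Lemma labeling_of_fwd d : d \in fwd G -> (forall c, dbit (labeling_of S d) c
  = alpha S d c) /\ ones (labeling_of S d) = wt G d.
Proof.
move=> df; have /andP[/forallP alt /existsP[cm /andP[cmx wc]]] :=
  forall_inP vS d df.
have [h1 h2] := is_cmaxP _ _ _ cmx.
have alt' c c' : (c < c')%N -> alpha S d c != 0 -> alpha S d c' != 0 ->
    (forall c'', (c < c'' < c')%N -> alpha S d c'' = 0) -> alpha S d c'
      = - alpha S d c.
  move=> k1 k2 k3 k4; apply/eqP/(implyP (forallP (alt c) c')).
  by rewrite k1 k2 k3; apply/forallP=> c''; apply/implyP=> /k4 ->.
have lE : labeling_of S d = bits_of (alpha S d) cm.
  apply/ffunP=> p; rewrite !ffunE df /last_bit /directed df.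
  congr (((_ : bool) : nat)%:Z + _ == 1);
    apply/existsP/idP=> [[c /andP[cc /eqP e]]|e].
    by rewrite (is_cmax_uniq cmx cc) e.
  by exists cm; rewrite cmx.
have n0 : (0 < n)%N by case/andP: (wt_bounds d) => _; apply: leq_ltn_trans.
have dE c : dbit (labeling_of S d) c = alpha S d c.
  by rewrite lE dbit_bits_of //; apply: alpha01.
split=> //; have := sum_dbit_weight (labeling_of S d) n0.
under eq_bigr do rewrite dE.
rewrite (eqP wc) lE bitz_bits_of //; last exact: alpha01.
by case: (alpha01 d cm) h1 => -> //= _; lia.
Qed.

Lemma dbit_labeling_of d c : dbit (labeling_of S d) c = alpha S d c.
Proof.
have [df|df] := boolP (d \in fwd G); first by have [-> _] := labeling_of_fwd df.
have := fwd_flip d; rewrite df => /labeling_of_fwd[/(_ c) + _].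
rewrite alpha_flip /dbit !labeling_of_flip;
  by do 2 case: (labeling_of S d _) => /=; lia.
Qed.

Lemma strand_path A : is_simple_strand A -> exists s : seq dart, [/\
  A =i s, uniq s & closed_path s || open_path s].
Proof.
case/andP=> _ /existsP[s /andP[/eqP AE h]]; exists s; split=> //.
  by move=> x; have := congr1 (fun B : {set dart} => x \in B) AE;
    rewrite /= inE.
case/orP: h => [/and3P[_ _ /map_uniq //]|].
rewrite /open_path; case: (tval s) => // d s' /and4P[_ _ _].
by rewrite rcons_uniq => /andP[_ /map_uniq].
Qed.

Lemma sum_seq_count A (s : seq dart) (f : dart -> {set dart}) d : A =i s ->
  uniq s ->
  \sum_(x in A) (f x == vtx d)%:R = (count_mem (vtx d) (map f s))%:R :> rat.
Proof.
move=> As us; rewrite (eq_bigl _ _ As) -big_uniq // count_map -sum1_count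
  natr_sum [RHS]big_mkcond.
by apply: eq_bigr => x _ /=; case: (_ == _).
Qed.

(** A path leaves each vertex as often as it enters it, except at its two ends, which lie on the
    axis. *)
Lemma simple_strand_cons A d : is_simple_strand A -> d \notin bdry ->
  \sum_(x in vtx d) curve_flow A x = 0.
Proof.
move=> sA db; have [s [As us h]] := strand_path sA.
have -> : \sum_(x in vtx d) curve_flow A x =
   \sum_(x in A) (vtx x == vtx d)%:R - \sum_(x in A) (vtx (flip G x) == vtx
     d)%:R.
  rewrite /curve_flow sumrB; congr (_ - _).
    rewrite [LHS]big_mkcond [RHS]big_mkcond /=; apply: eq_bigr => x _;
      rewrite vtx_eq.
    by case: (x \in vtx d); case: (x \in A).
  rewrite [LHS]big_mkcond [RHS]big_mkcond /= (reindex_inj flip_inj) /=;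
    apply: eq_bigr => x _.
  by rewrite vtx_eq flipK; case: (_ \in vtx d); case: (x \in A).
rewrite (sum_seq_count _ _ As us) (sum_seq_count (fun x => vtx (flip G x)) _ As
  us).
have fE x (w : seq dart) : path (@follows m G) x w ->
    map (@vtx m G) w = map (fun y => vtx (flip G y)) (belast x w).
  by elim: w x => //= y w IH x /andP[/eqP <- /IH ->].
suff -> : count_mem (vtx d) (map (@vtx m G) s) =
    count_mem (vtx d) (map (fun x => vtx (flip G x)) s) by rewrite subrr.
case/orP: h => [/and3P[_ cy _]|].
  case: s cy {As us} => // y w cy; have := fE y (rcons w y) cy.
  by rewrite belast_rcons => <-; rewrite map_rcons -cats1 count_cat /= addn0
    addnC.
case: s {As us} => // y w /and4P[hp yb lb _].
rewrite [in RHS]lastI map_rcons -(fE _ _ hp) -cats1 count_cat /=.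
have nb z : z \in bdry -> (vtx z == vtx d) = false.
  by move=> zb; apply/eqP=> /(vtx_bdry zb) e; rewrite -e zb in db.
by rewrite !nb // !addn0.
Qed.

Lemma stranding_simple c A : (c, A) \in S -> is_simple_strand A.
Proof. by move=> h; have /andP[/forall_inP/(_ _ h)] := sS. Qed.

Lemma stranding_eq c A B v : (c, A) \in S -> (c, B) \in S ->
  v \in touched A -> v \in touched B -> A = B.
Proof.
move=> hA hB vA vB; have /andP[_ /forall_inP/(_ _ hA)/forall_inP/(_ _ hB)] :=
  sS.
rewrite /= eqxx /=; case: eqP => [[-> //]|_] /=.
by rewrite -setI_eq0 => /eqP/setP/(_ v); rewrite inE vA vB inE.
Qed.

Lemma touched_vtx A x : x \in A -> vtx x \in touched A.
Proof. by move=> xA; rewrite in_setU imset_f. Qed.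

Lemma touched_vtx_flip A x : x \in A -> vtx (flip G x) \in touched A.
Proof. by move=> xA; rewrite in_setU orbC (imset_f (fun d => vtx (flip G d))).
  Qed.

Lemma in_color_sum c x : (in_color S c x)%:R = \sum_(cA in S | cA.1 == c)
  (x \in cA.2)%:R :> rat.
Proof.
case: (boolP (in_color S c x)) => [/existsP[[c' A] /= /and3P[AS /eqP cc xA]]|].
  rewrite cc in AS *; rewrite (bigD1 (c, A)) /= ?AS ?eqxx // xA big1 ?addr0 //.
  case=> c'' B /= /andP[/andP[BS /eqP cc2] ne]; case: (boolP (x \in B)) => //
    xB.
  rewrite cc2 in BS ne; case/eqP: ne; congr (_, _).
  exact: stranding_eq BS AS (touched_vtx xB) (touched_vtx xA).
move/existsPn=> h; rewrite big1 // => -[c' A] /= /andP[AS cc].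
by have := h (c', A); rewrite AS cc /= => /negbTE ->.
Qed.

Lemma alpha_cons d c : d \notin bdry -> \sum_(x in vtx d) alpha S x c = 0.
Proof.
move=> db; apply: (@intr_inj rat); rewrite rmorph_sum /=.
rewrite (eq_bigr (fun x => \sum_(cA in S | cA.1 == c) curve_flow cA.2 x));
  last first.
  move=> x _; rewrite /alpha rmorphB /= /curve_flow sumrB -!in_color_sum.
  by [].
rewrite exchange_big /= big1 // => -[c' A] /andP[AS _].
by apply: simple_strand_cons => //; apply: stranding_simple AS.
Qed.

Lemma labeling_of_good : good (labeling_of S).
Proof.
apply/goodP; split=> [d p|d df|d db]; first exact: labeling_of_flip.
  by have [_ ->] := labeling_of_fwd df.
suff h p : (\sum_(x in vtx d) labeling_of S x p)%N%:Z = \sum_(x in vtx d) bitz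
  (labeling_of S x) n.-1.
  by move=> p p'; apply/eqP; rewrite -eqz_nat !h.
rewrite (big_morph Posz PoszD (erefl _)); apply/eqP; rewrite -subr_eq0 -sumrB.
rewrite (eq_bigr (fun x => \sum_(c < n.-1 | (p <= c)%N) alpha S x c));
  last first.
  move=> x _; under eq_bigr do rewrite -dbit_labeling_of.
  rewrite sum_dbit_ge ?bitz_val //.
  by rewrite -ltnS prednK // (leq_ltn_trans _ (ltn_ord p)).
by rewrite exchange_big /= big1 // => c _; rewrite alpha_cons.
Qed.

Lemma in_color_anti c x : in_color S c x -> ~~ in_color S c (flip G x).
Proof.
case/existsP=> -[c' A] /= /and3P[AS /eqP cc xA]; rewrite cc in AS.
apply/negP=> /existsP[[c'' B] /= /and3P[BS /eqP cc2 xB]]; rewrite cc2 in BS.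
have e : A = B.
  apply: (stranding_eq AS BS (touched_vtx xA)).
  by have := touched_vtx_flip xB; rewrite flipK.
have /andP[/forall_inP/(_ x) + _] := stranding_simple AS.
by rewrite xA e xB => /(_ isT).
Qed.

Lemma label_flow_labeling_of c x : (x \in label_flow (labeling_of S) (pos_i c)
  (pos_i1 c)) = in_color S c x.
Proof.
have := dbit_labeling_of x c; rewrite inE /dbit /alpha.
case: (boolP (in_color S c x)) => [/in_color_anti/negbTE -> /=|_].
  by do 2 case: (labeling_of S x _).
by case: (in_color S c (flip G x)); do 2 case: (labeling_of S x _).
Qed.

Lemma strand_connected A x y : is_simple_strand A -> x \in A -> y \in A ->
  connect (linked A) x y.
Proof.
move=> sA; have [s [As us h]] := strand_path sA.
suff [z hz] : exists z, forall y, y \in A -> connect (linked A) z y.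
  by move=> xA yA; apply: connect_trans (hz _ yA); rewrite linked_csym;
    apply: hz.
case: s As us h => [|d s] As us h; first by exists x => w; rewrite As.
exists d => w; rewrite As.
have hp : path (@follows m G) d s.
  case/orP: h => [/and3P[_ + _]|/and4P[]//]; rewrite /= rcons_path => /andP[]//.
have : path (linked A) d s.
  have sub : {subset d :: s <= A} by move=> z; rewrite As.
  elim: s d sub hp {As us h} => //= z s IH d sub /andP[dz hp].
  rewrite IH ?andbT //; last by move=> u uz; apply: sub; rewrite inE uz orbT.
  by apply: linked_vtx; [apply: sub; rewrite mem_head|apply: sub;
    rewrite !inE eqxx orbT|apply/eqP].
by move/path_connect; apply.
Qed.

Lemma labeling_ofK : stranding_of (labeling_of S) = S.
Proof.
(* Paths of one color have no common vertex, so a link between darts of that color never leaves its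
   path; conversely a path is linked throughout. *)
have strandE c A x : (c, A) \in S -> x \in A ->
    strand (label_flow (labeling_of S) (pos_i c) (pos_i1 c)) x = A.
  move=> AS xA; set U := label_flow _ _ _.
  have AU y : y \in A -> y \in U.
    by move=> yA; rewrite label_flow_labeling_of; apply/existsP; exists (c, A);
      rewrite AS eqxx.
  apply/setP=> y; rewrite inE; apply/idP/idP=> [/andP[yU]|yA].
    case/connectP=> p + ->; elim: p x xA {y yU} => //= z p IH x xA
      /andP[/and3P[xU zU l]].
    apply: IH; move: zU;
      rewrite label_flow_labeling_of => /existsP[[c' B] /= /and3P[BS /eqP cc
      zB]].
    rewrite cc in BS; move: l; rewrite -setI_eq0 => /set0Pn[v];
      rewrite inE => /andP[v1 v2].
    rewrite (stranding_eq AS BS (subsetP (touched_sub xA) _ v1)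
      (subsetP (touched_sub zB) _ v2)).
    exact: zB.
  rewrite AU //=; apply: (@linked_map A U id) => //.
  exact: strand_connected (stranding_simple AS) xA yA.
apply/setP=> -[c A]; rewrite inE /=; apply/strandsP/idP=> [[x + ->]|AS].
  rewrite label_flow_labeling_of => /existsP[[c' B] /= /and3P[BS /eqP cc xB]].
  by rewrite cc in BS; rewrite (strandE _ _ _ BS xB).
have [s [As us h]] := strand_path (stranding_simple AS).
case: s As us h => // x s As us h; have xA : x \in A by rewrite As mem_head.
by exists x; rewrite ?(strandE _ _ _ AS xA) // label_flow_labeling_of;
  apply/existsP; exists (c, A); rewrite AS eqxx.
Qed.

Lemma ij_dartsE (i j : 'I_n) : (i < j)%N -> ij_darts S i j = label_flow
  (labeling_of S) i j.
Proof.
move=> ij; apply/setP=> d; rewrite !inE.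
rewrite (eq_bigr (dbit (labeling_of S d))) => [|c _];
  last by rewrite dbit_labeling_of.
rewrite sum_dbit; last by rewrite ltnW //= -ltnS prednK //
  (leq_ltn_trans _ (ltn_ord j)).
by rewrite !bitz_val; do 2 case: (labeling_of S d _).
Qed.

Lemma stat_winding : (y_stat S)%:Z - (x_stat S)%:Z =
  \sum_(pp : 'I_n * 'I_n | (pp.1 < pp.2)%N) strands_winding
    (label_flow (labeling_of S) pp.1 pp.2).
Proof.
rewrite -(pair_big_dep predT (fun i j : 'I_n => (i < j)%N)
  (fun i j : 'I_n => strands_winding (label_flow (labeling_of S) i j))) /=.
rewrite /y_stat /x_stat !(big_morph Posz PoszD (erefl _)) -sumrB;
  apply: eq_bigr => i _.
rewrite !(big_morph Posz PoszD (erefl _)) -sumrB; apply: eq_bigr => j ij.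
rewrite /strands_winding /ij_strands ij_dartsE // /strand_winding -/(strands _)
  sumrB.
congr (_ - _); rewrite card_sum (big_morph Posz PoszD (erefl _))
  [RHS]big_mkcond;
  apply: eq_bigr => K _; by rewrite inE; case: (K \in _).
Qed.

End Valid.

(** * Cancellation in the web vector *)

Section WebVector.
Variables (F : fieldType) (q : F).

Definition boundary_bits b : {ffun 'I_m -> bvec n} :=
  [ffun j => [ffun p => ~~ b (bd G j) p]].

Definition total_winding b : int :=
  \sum_(pp : 'I_n * 'I_n | (pp.1 < pp.2)%N) strands_winding (label_flow b pp.1
    pp.2).

Lemma web_vector_labelings : web_vector q n G =
  \sum_(b | good b) (- q) ^ (- total_winding b) *: xtens F (boundary_bits b).
Proof.
have valP S : S \in valid_strandings n G -> is_stranding S /\ valid S.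
  by rewrite inE => /andP.
rewrite /web_vector (reindex_onto stranding_of labeling_of) /=; last first.
  by move=> S /valP[sS vS]; apply: labeling_ofK.
apply: eq_big => [b|b /andP[/valP[sS vS] /eqP e]].
  apply/andP/idP=> [[/valP[sS vS] /eqP <-]|gb]; first exact: labeling_of_good.
  by rewrite inE stranding_of_stranding // stranding_of_valid // stranding_ofK.
rewrite -[_ - _]opprB stat_winding // e; congr (_ *: xtens F _).
by apply/ffunP=> j; rewrite !ffunE boundary_labelE e.
Qed.

Lemma boundary_bitsE b j p : boundary_bits b j p = ~~ b (bd G j) p.
Proof. by rewrite ffunE ffunE. Qed.

Hypotheses (q0 : q != 0) (two : 2%:R != 0 :> F).

Section Cancel.
Variable c : 'I_n.-1.
Notation p0 := (pos_i c).
Notation p1 := (pos_i1 c).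

Definition boundary_flow b j : int :=
  (bd G j \in label_flow b p0 p1 : nat)%:Z - (flip G (bd G j) \in label_flow b
    p0 p1 : nat)%:Z.

Lemma kexp_boundary_bits b j : good b -> kexp c (boundary_bits b j)
  = - boundary_flow b j.
Proof.
move=> gb; rewrite /kexp !boundary_bitsE /boundary_flow -in_reversal
  label_flow_reversal // !inE.
by case: (b _ p0); case: (b _ p1).
Qed.

(* The contributions of the labeling [b] and the factor [j] to [E_c] and [F_c]
   applied to the web vector. *)
Definition termE b j := ((- q) ^ (- total_winding b) *
  q ^ (\sum_(l < m | (j < l)%N) kexp c (boundary_bits b l))) *: xtens F
    (swap_at c (boundary_bits b) j).
Definition termF b j := ((- q) ^ (- total_winding b) *
  q ^ (- \sum_(l < m | (l < j)%N) kexp c (boundary_bits b l))) *: xtens F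
    (swap_at c (boundary_bits b) j).

Section Step.
Variables (b : labeling) (a e : 'I_m).
Hypothesis gb : good b.
Let U := label_flow b p0 p1.
Hypothesis aU : bd G a \in U.
Hypothesis eK : flip G (bd G e) \in strand U (bd G a).
Let b' := exchange c b a.
Hypothesis ae : (a < e)%N.

Let gb' : good b'. Proof. exact: exchange_good gb aU. Qed.
Let fU : is_flow U := label_flow_flow p0 p1 gb.

Let boundary_flow_off l : l != a -> l != e -> boundary_flow b' l
  = boundary_flow b l.
Proof.
move=> la le; have h := exchange_bd gb aU eK la le.
rewrite /boundary_flow -!in_reversal !label_flow_reversal // !inE.
by rewrite -/b' in h; rewrite h.
Qed.

Let boundary_flow_a : boundary_flow b a = 1.
Proof. by rewrite /boundary_flow aU (negbTE (flow_anti fU aU)). Qed.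

Let boundary_flow_e : boundary_flow b e = -1.
Proof.
have eU := subsetP (strand_sub _ _) _ eK.
by rewrite /boundary_flow -/U eU -[bd G e]flipK (negbTE (flow_anti fU eU)).
Qed.

Let boundary_flow_between : \sum_(l < m | (a < l < e)%N) boundary_flow b l = 0.
Proof.
have aK : bd G a \in strand U (bd G a) by rewrite inE aU connect0.
apply: (@intr_inj rat); rewrite rmorph_sum /= -[RHS](hub_between fU aU aK eK).
rewrite (minn_idPl (ltnW ae)) (maxn_idPr (ltnW ae)).
by apply: eq_bigr => l _; rewrite /boundary_flow rmorphB.
Qed.

Let ea : (e == a) = false.
Proof. by rewrite -(inj_eq val_inj) /= gtn_eqF. Qed.

Let boundary_bits_exchange l p : boundary_bits b' l p =
  if (l == a) || (l == e) then boundary_bits b l (tperm p0 p1 p)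
    else boundary_bits b l p.
Proof.
rewrite !boundary_bitsE /b'; case: (boolP ((l == a) || (l == e))) => [h|].
  by rewrite (exchange_bd_ends gb aU eK h) swap_bitsE.
by rewrite negb_or => /andP[la le]; rewrite (exchange_bd gb aU eK la le).
Qed.

Let swap_eqE : swap_at c (boundary_bits b') e = swap_at c (boundary_bits b) a.
Proof.
apply/ffunP=> l; apply/ffunP=> p; rewrite !swap_atE !boundary_bits_exchange
  tpermK.
have [->|le] := eqVneq l e; first by rewrite orbT ea.
by rewrite orbF; case: eqP.
Qed.

Let swap_eqF : swap_at c (boundary_bits b') a = swap_at c (boundary_bits b) e.
Proof.
apply/ffunP=> l; apply/ffunP=> p; rewrite !swap_atE !boundary_bits_exchange
  tpermK.
have [->|la] := eqVneq l a; first by rewrite eq_sym ea.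
by case: (l == e).
Qed.

Let winding_eq : total_winding b' = total_winding b - 1.
Proof.
rewrite /total_winding /b' (winding_exchange gb aU eK) ae.
by rewrite ltnNge (ltnW ae) /= addr0.
Qed.

Let coeff_eq N : (- q) ^ (- total_winding b') * q ^ N
  = - ((- q) ^ (- total_winding b) * q ^ (N + 1)).
Proof.
have nq0 : - q != 0 by rewrite oppr_eq0.
rewrite winding_eq opprB addrC (expfzDr _ _ nq0) (expfzDr _ _ q0) !expr1z.
by move: (_ ^ _) (_ ^ _) => u v; ring.
Qed.

(** Raising [b] at its start [a] and [b'] at its start [e] gives the same basis vector. The factors
    between the ends cancel, and the factor [e] gives the term of [b] an extra [q]; the winding
    drops by one under the exchange, which gives the term of [b'] an extra [-q]. *)
Lemma termE_lt : termE b' e = - termE b a.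
Proof.
rewrite /termE swap_eqE -scaleNr; congr (_ *: _); rewrite coeff_eq;
  congr (- (_ * q ^ _)).
under eq_bigr do rewrite kexp_boundary_bits //.
under [RHS]eq_bigr do rewrite kexp_boundary_bits //.
rewrite !sumrN [X in _ = - X](bigD1 e) //= boundary_flow_e
  [X in _ = - (_ + X)](bigID (fun l : 'I_m => (l < e)%N)) /=.
rewrite [X in _ = - (_ + (X + _))](eq_bigl (fun l : 'I_m => (a < l < e)%N));
  last first.
  by move=> l; rewrite -(inj_eq val_inj) /=; case: (ltngtP l e) => h;
    rewrite ?andbF ?andbT.
rewrite boundary_flow_between add0r opprD opprK addrC; congr (1 - _).
apply: eq_big => [l|l el].
  rewrite -(inj_eq val_inj) /=; case: (ltngtP e l) => /= [el|el|<-];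
    rewrite ?andbF //.
  by rewrite (ltn_trans ae el).
by apply: boundary_flow_off; apply/eqP=> h; move: el ae;
  rewrite h ?ltnn // => *; lia.
Qed.

(** [F_c] acts where strands end and takes its powers of [q] from the factors to the left, so here
    the factor [a] supplies the extra [q]. *)
Lemma termF_lt : termF b' a = - termF b e.
Proof.
rewrite /termF swap_eqF -scaleNr; congr (_ *: _); rewrite coeff_eq;
  congr (- (_ * q ^ _)).
under eq_bigr do rewrite kexp_boundary_bits //.
under [X in _ = - X]eq_bigr do rewrite kexp_boundary_bits //.
rewrite !sumrN !opprK [RHS](bigD1 a) //= boundary_flow_a
  [in RHS](bigID (fun l : 'I_m => (a < l)%N)) /=.
rewrite [X in _ = _ + (X + _)](eq_bigl (fun l : 'I_m => (a < l < e)%N));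
  last first.
  move=> l; rewrite -(inj_eq val_inj) /=; case: (ltngtP a l) => /=;
    rewrite ?andbF ?andbT //.
rewrite boundary_flow_between add0r addrC; congr (1 + _).
apply: eq_big => [l|l la].
  rewrite -(inj_eq val_inj) /=; case: (ltngtP l a) => [al|al|al];
    rewrite ?andbF //=.
  by rewrite (ltn_trans al ae).
by apply: boundary_flow_off; apply/eqP=> h; move: la ae;
  rewrite h ?ltnn // => *; lia.
Qed.

End Step.

Lemma start_end b a : good b -> bd G a \in label_flow b p0 p1 ->
  exists e, flip G (bd G e) \in strand (label_flow b p0 p1) (bd G a).
Proof.
move=> gb aU; apply/existsP.
rewrite -(flow_start_end (strand_flow _ (label_flow_flow p0 p1 gb))).
by apply/existsP; exists a; rewrite inE aU connect0.
Qed.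

Lemma end_start b e : good b -> flip G (bd G e) \in label_flow b p0 p1 ->
  exists a, bd G a \in label_flow b p0 p1 /\ flip G (bd G e) \in strand
    (label_flow b p0 p1) (bd G a).
Proof.
move=> gb eU; have fU := label_flow_flow p0 p1 gb.
have : [exists a, bd G a \in strand (label_flow b p0 p1) (flip G (bd G e))].
  rewrite (flow_start_end (strand_flow _ fU)); apply/existsP; exists e.
  by rewrite inE eU connect0.
case/existsP=> a aK;
  exists a; split; first exact: (subsetP (strand_sub _ _) _ aK).
by rewrite (strand_mem aK) inE eU connect0.
Qed.

(** One involution serves both operators: on pairs with a strand starting at the given vertex for
    [E_c], and ending there for [F_c]. Reversal turns the far end into a vertex of the same kind. *)
Let iota (x : labeling * 'I_m) := (exchange c x.1 x.2, other_end c x.1 x.2).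

Lemma tensE_web_vector : tensE q c (web_vector q n G) = 0.
Proof.
rewrite web_vector_labelings tensE_sum.
rewrite (eq_bigr (fun b => \sum_(j | bd G j \in label_flow b p0 p1) termE b
  j)); last first.
  move=> b gb; rewrite tensE_basis // scaler_sumr; apply: eq_big => [j|j _].
    by rewrite !boundary_bitsE negbK inE.
  by rewrite scalerA.
rewrite (pair_big_dep _ _ termE) /=.
have stepP (x : labeling * 'I_m) : good x.1 &&
  (bd G x.2 \in label_flow x.1 p0 p1) ->
    exists e, [/\ good x.1, bd G x.2 \in label_flow x.1 p0 p1,
      flip G (bd G e) \in strand (label_flow x.1 p0 p1) (bd G x.2) & iota x
        = (exchange c x.1 x.2, e)].
  case/andP=> gb aU; have [e eK] := start_end gb aU; exists e; split=> //.
  by rewrite /iota (other_end_start gb aU eK).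
have main (x : labeling * 'I_m) : good x.1 &&
  (bd G x.2 \in label_flow x.1 p0 p1) ->
   [/\ good (iota x).1 && (bd G (iota x).2 \in label_flow (iota x).1 p0 p1),
       iota (iota x) = x & (x.2 < (iota x).2)%N -> termE (iota x).1 (iota x).2
         = - termE x.1 x.2].
  move=> /stepP[e [gb aU eK ->]]; rewrite /= (exchange_good gb aU)
    (exchange_eU gb aU eK); split=> //.
    have gb' := exchange_good gb aU; have eU' := exchange_eU gb aU eK;
      have aK' := exchange_aK gb aU eK.
    by rewrite /iota /= (exchangeK gb aU eK) (other_end_start gb' eU' aK')
      -surjective_pairing.
  exact: termE_lt.
apply: (@sum_involution _ _ _ _ iota _ two) => x Px.
- by have [] := main _ Px.
- by have [] := main _ Px.
have [Px' xK lt] := main _ Px.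
have [Px'' xK' lt'] := main _ Px'.
have [e [gb aU eK ix]] := stepP _ Px.
(* If the strand runs from right to left, its image runs from left to right, and the identity is
   applied to the image. *)
case: (ltngtP x.2 e) => [h|h|h]; first by apply: lt; rewrite ix.
  by rewrite -[in RHS]xK lt' ?opprK // xK ix.
have aK : bd G x.2 \in strand (label_flow x.1 p0 p1) (bd G x.2) by rewrite inE
  aU connect0.
by have := strand_ends_neq (label_flow_flow p0 p1 gb) aU aK eK;
  rewrite (val_inj h) eqxx.
Qed.

Lemma tensF_web_vector : tensF q c (web_vector q n G) = 0.
Proof.
rewrite web_vector_labelings tensF_sum.
rewrite (eq_bigr (fun b => \sum_(j | flip G (bd G j) \in label_flow b p0 p1)
  termF b j)); last first.
  move=> b gb; rewrite tensF_basis // scaler_sumr; apply: eq_big => [j|j _].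
    by rewrite !boundary_bitsE negbK -in_reversal label_flow_reversal // inE
      andbC.
  by rewrite scalerA.
rewrite (pair_big_dep _ _ termF) /=.
have stepP (x : labeling * 'I_m) : good x.1 &&
  (flip G (bd G x.2) \in label_flow x.1 p0 p1) ->
    exists a, [/\ good x.1, bd G a \in label_flow x.1 p0 p1,
      flip G (bd G x.2) \in strand (label_flow x.1 p0 p1) (bd G a) & iota x
        = (exchange c x.1 a, a)].
  case/andP=> gb eU; have [a [aU eK]] := end_start gb eU; exists a; split=> //.
  by rewrite /iota (other_end_end gb aU eK) (exchange_end gb aU eK).
have main (x : labeling * 'I_m) : good x.1 && (flip G (bd G x.2) \in label_flow
  x.1 p0 p1) ->
   [/\ good (iota x).1 && (flip G (bd G (iota x).2) \in label_flow (iota x).1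
     p0 p1),
       iota (iota x) = x & ((iota x).2 < x.2)%N -> termF (iota x).1 (iota x).2
         = - termF x.1 x.2].
  move=> /stepP[a [gb aU eK ->]]; rewrite /= (exchange_good gb aU).
  rewrite (subsetP (strand_sub _ _) _ (exchange_aK gb aU eK)); split=> //.
    have gb' := exchange_good gb aU; have eU' := exchange_eU gb aU eK;
      have aK' := exchange_aK gb aU eK.
    rewrite /iota /= (exchange_end gb' eU' aK') (exchangeK gb aU eK)
      (other_end_end gb' eU' aK').
    by rewrite -surjective_pairing.
  exact: termF_lt.
apply: (@sum_involution _ _ _ _ iota _ two) => x Px.
- by have [] := main _ Px.
- by have [] := main _ Px.
have [Px' xK lt] := main _ Px.
have [Px'' xK' lt'] := main _ Px'.
have [a [gb aU eK ix]] := stepP _ Px.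
(* Again the identity is applied to whichever of the two paired terms has its strand running from
   left to right. *)
case: (ltngtP a x.2) => [h|h|h]; first by apply: lt; rewrite ix.
  by rewrite -[in RHS]xK lt' ?opprK // xK ix.
have aK : bd G a \in strand (label_flow x.1 p0 p1) (bd G a) by rewrite inE aU
  connect0.
by have := strand_ends_neq (label_flow_flow p0 p1 gb) aU aK eK;
  rewrite (val_inj h) eqxx.
Qed.

Lemma tensK_web_vector : tensK q c (web_vector q n G) = web_vector q n G.
Proof.
rewrite web_vector_labelings /tensK tensor_op_sum; apply: eq_bigr => b gb;
  congr (_ *: _).
rewrite -/(tensK q c _) tensK_basis // (_ : \sum_l _ = 0) ?expr0z ?scale1r //.
under eq_bigr do rewrite kexp_boundary_bits //.
rewrite sumrN; apply/eqP; rewrite oppr_eq0; apply/eqP/(@intr_inj rat).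
rewrite rmorph_sum /= -[RHS](flow_ends (label_flow_flow p0 p1 gb)).
by apply: eq_bigr => l _; rewrite /boundary_flow rmorphB.
Qed.

End Cancel.

Lemma in_V_web_vector (k : 'I_m -> nat) : (forall j, boundary_weight n G j
  = k j) ->
  in_V k (web_vector q n G).
Proof.
move=> hk v; rewrite web_vector_labelings sum_ffunE => nz j; rewrite -hk.
have [b gb hb] : exists2 b, good b & v = boundary_bits b.
  case: (boolP [exists b, good b && (v == boundary_bits b)])
    => [/existsP[b /andP[gb /eqP h]]|].
    by exists b.
  move/existsPn=> h; case/eqP: nz; apply: big1 => b gb; rewrite !ffunE.
  by have := h b; rewrite gb /= => /negbTE ->; rewrite scaler0.
rewrite hb /boundary_weight /sgn_at; case/goodP: (gb) => h1 h2 _.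
have wtf : wt G (flip G (bd G j)) = wt G (bd G j).
  by case: webG => _ _ _ h _; case: (h (bd G j)).
case: (boolP (bd G j \in fwd G)) => jf /=; last first.
  rewrite -wtf -h2 ?fwd_flip //; apply: eq_card => p.
  by rewrite !inE boundary_bitsE h1.
have : n = (ones (b (bd G j)) + ones (boundary_bits b j))%N.
  rewrite -[LHS]card_ord -(cardsC [set p | b (bd G j) p]); congr (_ + _)%N.
  by apply: eq_card => p; rewrite !inE boundary_bitsE.
by rewrite -h2 //; move: (ones (b _)) (ones (boundary_bits b j)) => s t; lia.
Qed.

End WebVector.

End Planar.

(** * Invariance under isotopy *)

Lemma connect_map (T T' : finType) (h : T -> T') (e : rel T) (e' : rel T') :
  (forall x y, e x y -> e' (h x) (h y)) ->
  forall x y, connect e x y -> connect e' (h x) (h y).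
Proof.
move=> he x y /connectP[p + ->]; elim: p x => [|z p IH] x /=;
  first by rewrite connect0.
by case/andP=> /he/connect1 c /IH; apply: connect_trans.
Qed.

Lemma connect_bij (T T' : finType) (h : T -> T') (e : rel T) (e' : rel T')
  : bijective h ->
  (forall x y, e' (h x) (h y) = e x y) ->
  forall x y, connect e' (h x) (h y) = connect e x y.
Proof.
case=> h' hK h'K he x y; apply/idP/idP; last first.
  by apply: connect_map => u v; rewrite he.
move=> c; rewrite -[x]hK -[y]hK; apply: connect_map c => u v.
by rewrite -{1}[u]h'K -{1}[v]h'K he.
Qed.

Lemma forall_bij (T T' : finType) (h : T -> T') (P : pred T') : bijective h ->
  [forall x, P (h x)] = [forall y, P y].
Proof.
case=> h' hK h'K; apply/forallP/forallP=> H x; last exact: H.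
by rewrite -[x]h'K; apply: H.
Qed.

Section Isotopy.
Variables (n m : nat) (G H : plane_map m).
Variables (h : 'I_(ndart G) -> 'I_(ndart H)) (g : 'I_(nreg G).+1 ->
  'I_(nreg H).+1).
Hypotheses (hB : bijective h) (gB : bijective g) (g0 : g ord0 = ord0).
Hypothesis hbd : forall j, h (bd G j) = bd H j.
Hypothesis hflip : forall d, h (flip G d) = flip H (h d).
Hypothesis h_rot : forall d, h (rot G d) = rot H (h d).
Hypothesis hfwd : forall d, (h d \in fwd H) = (d \in fwd G).
Hypothesis hwt : forall d, wt H (h d) = wt G d.
Hypothesis hreg : forall d, reg H (h d) = g (reg G d).
Let hI : injective h := bij_inj hB.

Definition pullback (U : {set 'I_(ndart H)}) : {set 'I_(ndart G)} :=
  [set d | h d \in U].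

Lemma in_pullback U d : (d \in pullback U) = (h d \in U).
Proof. by rewrite inE. Qed.

Lemma pullback_inj : injective pullback.
Proof.
case: hB => h' _ h'K U V e; apply/setP=> d; rewrite -[d]h'K.
by rewrite -!in_pullback e.
Qed.

Lemma vtx_iso x y : (h x \in vtx (h y)) = (x \in vtx y).
Proof.
have rE i : h ((rot G ^+ i)%g y) = (rot H ^+ i)%g (h y).
  by rewrite !permX; elim: i => //= i <-.
rewrite !vtxE; apply/porbitP/porbitP=> [] [i e]; exists i.
  by apply: hI; rewrite rE.
by rewrite e rE.
Qed.

Lemma vtx_eq_iso x y : (vtx (h x) == vtx (h y)) = (vtx x == vtx y).
Proof. by rewrite !vtx_eq vtx_iso. Qed.

Lemma bdry_iso d : (h d \in codom (bd H)) = (d \in codom (bd G)).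
Proof.
apply/codomP/codomP=> [] [j e]; exists j; last by rewrite e hbd.
by apply: hI; rewrite hbd.
Qed.

(** Equality of vertices is the form in which [linked] transports along [h], since the vertex sets
    of the two maps live in different types. *)
Lemma touched_disjoint (L : plane_map m) (x y : 'I_(ndart L)) :
  [disjoint touched [set x] & touched [set y]] =
  ~~ [|| vtx x == vtx y, vtx x == vtx (flip L y), vtx (flip L x) == vtx y
       | vtx (flip L x) == vtx (flip L y)].
Proof.
rewrite -[LHS]negbK; congr (~~ _); rewrite -setI_eq0; apply/set0Pn/idP.
  case=> v; rewrite !touched1 !inE => /andP[] /orP[] /eqP -> /orP[] /eqP ->;
    by rewrite eqxx ?orbT.
rewrite !touched1 => /or4P[] /eqP e.
- by exists (vtx x); rewrite !inE eqxx e eqxx.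
- by exists (vtx x); rewrite !inE eqxx e eqxx orbT.
- by exists (vtx (flip L x)); rewrite !inE eqxx e eqxx orbT.
by exists (vtx (flip L x)); rewrite !inE eqxx e eqxx !orbT.
Qed.

Lemma linked_iso U x y : linked U (h x) (h y) = linked (pullback U) x y.
Proof.
by rewrite /linked /= !in_pullback !touched_disjoint -!hflip !vtx_eq_iso.
Qed.

Lemma strand_iso U x : strand (pullback U) x = pullback (strand U (h x)).
Proof.
apply/setP=> y; rewrite !inE; congr (_ && _).
by rewrite -(connect_bij hB (linked_iso U)).
Qed.

Lemma strands_iso U : strands (pullback U) = [set pullback K | K in strands U].
Proof.
case: hB => h' hK h'K; apply/setP=> K; apply/imsetP/imsetP=> [[x xU ->]|[L]].
  exists (strand U (h x)); last exact: strand_iso.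
  by apply/imsetP; exists (h x); rewrite ?in_pullback // -in_pullback.
case/imsetP=> x xU -> ->; exists (h' x); first by rewrite in_pullback h'K.
by have := strand_iso U (h' x); rewrite h'K.
Qed.

Lemma adjacent_iso K r r' : adjacent_off K (g r) (g r') = adjacent_off
  (pullback K) r r'.
Proof.
apply/existsP/existsP=> [] [d].
  case: hB => h' hK h'K; case/and4P=> h1 h2 h3 h4; exists (h' d).
  rewrite !in_pullback hflip h'K h1 h2 -!(inj_eq (bij_inj gB)) -!hreg hflip h'K.
  by rewrite h3 h4.
case/and4P; rewrite !in_pullback hflip => h1 h2 /eqP <- /eqP <-; exists (h d).
by rewrite h1 h2 -!hreg hflip !eqxx.
Qed.

Lemma outside_iso K r : outside K (g r) = outside (pullback K) r.
Proof. by rewrite /outside -g0; apply: (connect_bij gB);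
  apply: adjacent_iso. Qed.

Lemma strand_winding_iso K : strand_winding (pullback K) = strand_winding K.
Proof.
have stE a : starts_at (pullback K) a = starts_at K a by rewrite /starts_at
  in_pullback hbd.
have enE a : ends_at (pullback K) a = ends_at K a by rewrite /ends_at
  in_pullback hflip hbd.
have cl : is_closed (pullback K) = is_closed K.
  by apply: eq_forallb => a; rewrite stE enE.
rewrite /strand_winding /closed_counterclockwise /closed_clockwise cl;
  congr (_%:Z - _%:Z); congr nat_of_bool.
  congr (_ && _ || _).
    rewrite -(forall_bij _ hB); apply: eq_forallb => d.
    by rewrite in_pullback -hflip hreg outside_iso.
  by apply: eq_existsb => a; apply: eq_existsb => b; rewrite stE enE.
congr (_ && _); rewrite -(forall_bij _ hB); apply: eq_forallb => d.
by rewrite in_pullback hreg outside_iso.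
Qed.

Lemma strands_winding_iso U : strands_winding (pullback U) = strands_winding U.
Proof.
rewrite /strands_winding strands_iso big_imset /=; last by move=> K L _ _;
  apply: pullback_inj.
by apply: eq_bigr => K _; rewrite strand_winding_iso.
Qed.

Definition pullback_labeling (b : labeling n H) : labeling n G :=
  [ffun d => b (h d)].

Lemma good_iso b : good (pullback_labeling b) = good b.
Proof.
congr [&& _, _ & _].
- rewrite -[RHS](forall_bij _ hB); apply: eq_forallb => d;
  apply: eq_forallb => p.
  by rewrite !ffunE hflip.
- rewrite -[RHS](forall_bij _ hB); apply: eq_forallb => d.
  by rewrite hfwd hwt ffunE.
rewrite -[RHS](forall_bij _ hB); apply: eq_forallb => d.
rewrite bdry_iso; congr (_ ==> _); apply: eq_forallb => p;
  apply: eq_forallb => p'.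
have sE p'' : (\sum_(x in vtx d) pullback_labeling b x p''
  = \sum_(x in vtx (h d)) b x p'')%N.
  rewrite [RHS](reindex h) /=; last exact: onW_bij.
  by apply: eq_big => x; rewrite ?vtx_iso // ffunE.
by rewrite !sE.
Qed.

Lemma label_flow_iso b p p' : label_flow (pullback_labeling b) p p' = pullback
  (label_flow b p p').
Proof. by apply/setP=> d; rewrite !inE ffunE. Qed.

Lemma total_winding_iso b : total_winding (pullback_labeling b) = total_winding
  b.
Proof. by apply: eq_bigr => pp _; rewrite label_flow_iso strands_winding_iso.
  Qed.

Lemma boundary_bits_iso b : boundary_bits (pullback_labeling b) = boundary_bits
  b.
Proof. by apply/ffunP=> j; apply/ffunP=> p; rewrite !boundary_bitsE ffunE hbd.
  Qed.

Lemma web_vector_iso (F : fieldType) (q : F) : is_web n G -> is_web n H ->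
  web_vector q n G = web_vector q n H.
Proof.
move=> wG wH; rewrite !web_vector_labelings //.
case: hB => h' hK h'K; rewrite (reindex pullback_labeling) /=; last first.
  exists (fun b : labeling n G => [ffun d => b (h' d)]) => b _; apply/ffunP=> d;
  by rewrite !ffunE ?h'K ?hK.
by apply: eq_big => b; rewrite ?good_iso // total_winding_iso boundary_bits_iso.
Qed.

End Isotopy.

Lemma web_vector_isotopic (F : fieldType) (q : F) n m (G H : plane_map m) :
  is_web n G -> is_web n H -> isotopic G H -> web_vector q n G = web_vector q n
    H.
Proof.
move=> wG wH [h [g [hB gB g0 hbd hE]]].
by apply: (web_vector_iso hB gB g0 hbd) => // d; have [] := hE d.
Qed.

Lemma web_in_Inv (F : fieldType) (q : F) n m (k : 'I_m -> nat) (G : web n k) :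
  q != 0 -> 2%:R != 0 :> F -> in_Inv q k (web_vector q n G).
Proof.
move=> q0 two; case: G => G [wG hk] /=; split; first exact: in_V_web_vector.
move=> c; split;
  [exact: tensE_web_vector|exact: tensF_web_vector|exact: tensK_web_vector].
Qed.

Lemma in_Inv_sum (F : fieldType) (q : F) n m (k : 'I_m -> nat) (I : Type)
  (s : seq I)
    (a : I -> F) (w : I -> tens F n m) : (forall i, in_Inv q k (w i)) ->
  in_Inv q k (\sum_(i <- s) a i *: w i).
Proof.
case: s => [|i0 s] hw; last first.
  rewrite (big_nth i0) big_mkord; split.
    move=> b; rewrite sum_ffunE => nz.
    have [i hi] : exists i : 'I_(size (i0 :: s)), w (nth i0 (i0 :: s) i) b != 0.
      apply/existsP; apply: contraR nz => /existsPn h; rewrite big1 // => i _.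
      by rewrite ffunE; have := h i; rewrite negbK => /eqP ->; rewrite scaler0.
    by have [h _] := hw (nth i0 (i0 :: s) i); apply: h hi.
  move=> c; rewrite tensE_sum tensF_sum /tensK tensor_op_sum; split.
  - by apply: big1 => i _; have [_ /(_ c)[-> _ _]] := hw (nth i0 (i0 :: s) i);
    rewrite scaler0.
  - by apply: big1 => i _; have [_ /(_ c)[_ -> _]] := hw (nth i0 (i0 :: s) i);
    rewrite scaler0.
  apply: eq_bigr => i _; congr (_ *: _).
  by have [_ /(_ c)[_ _ h]] := hw (nth i0 (i0 :: s) i).
(* Zero is written as a sum over the empty type, so that the same linearity lemmas apply. *)
have := @tensE_sum F q n m void predT; have := @tensF_sum F q n m void predT.
have := @tensor_op_sum F n m void predT.
rewrite big_nil => hO hF hE; split; first by move=> b; rewrite ffunE eqxx.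
have z : \sum_(i : void) (fun=> 0 : F) i *: (fun=> 0 : tens F n m) i = 0
  by apply: big1 => -[].
move=> c; split; rewrite -z ?hE ?hF /tensK ?hO; by rewrite !big1 // => -[].
Qed.

(** * The field of rational functions and the linear extension *)

Lemma qvar_neq0 (R : realType) : qvar R != 0.
Proof. by rewrite /qvar tofrac_eq0 polyX_eq0. Qed.

Lemma two_neq0 (R : realType) : 2%:R != 0 :> Cq R.
Proof.
rewrite -[2%:R](rmorph_nat (@tofrac {poly R[i]})) tofrac_eq0 -polyC_natr
  polyC_eq0.
by rewrite pnatr_eq0.
Qed.

Theorem theorem50 (R : realType) (n m : nat) (k : 'I_m -> nat)
    (hn : (2 <= n)%N) (hk : forall j : 'I_m, (1 <= k j <= n - 1)%N) :
  (forall G : web n k, in_Inv (qvar R) k (web_vector (qvar R) n G)) /\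
  exists f : {linear free_webs R n k -> tens (Cq R) n m},
    (forall w : free_webs R n k, in_Inv (qvar R) k (f w)) /\
    (forall G : web n k, f (free_web R G) = web_vector (qvar R) n G).
Proof.
have inv (G : web n k) : in_Inv (qvar R) k (web_vector (qvar R) n G).
  by apply: web_in_Inv; [exact: qvar_neq0 | exact: two_neq0].
split=> //.
pose v (x : webs n k) := web_vector (qvar R) n (repr x).
pose f (w : free_webs R n k) : tens (Cq R) n m := \sum_(x <- msupp w) w@_x *: v
  x.
(* Vanishing coefficients allow any larger finite support; a common one for [w], [w'] and their
   combination makes linearity termwise. *)
have fE (w : free_webs R n k) (D : {fset webs n k}) : (msupp w `<=` D)%fset ->
    f w = \sum_(x <- D) w@_x *: v x.
  move=> sD; rewrite /f (big_fset_incl _ sD) //= => x _ xw.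
  by rewrite mcoeff_outdom ?scale0r.
have lin : linear f.
  move=> a w w'.
  pose D := (msupp w `|` msupp w' `|` msupp (a *: w + w'))%fset.
  rewrite !(fE _ D); last first.
  - by rewrite /D; apply/fsubsetP=> x; rewrite !in_fsetU => ->; rewrite orbT.
  - by rewrite /D; apply/fsubsetP=> x; rewrite !in_fsetU => ->; rewrite ?orbT.
  - by rewrite /D; apply/fsubsetP=> x; rewrite !in_fsetU => ->; rewrite ?orbT.
  rewrite scaler_sumr -big_split /=; apply: eq_bigr => x _.
  by rewrite mcoeffD mcoeffZ scalerDl scalerA.
pose fL := GRing.isLinear.Build _ _ _ _ f lin.
pose F : {linear free_webs R n k -> tens (Cq R) n m} := HB.pack f fL.
exists F; split=> [w|G]; first by apply: in_Inv_sum => x; apply: inv.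
rewrite /F /= /f /free_web msuppU oner_eq0 big_seq_fset1 mcoeffUU scale1r /v.
(* The representative chosen in the class of [G] is only isotopic to [G]. *)
apply: web_vector_isotopic; [by case: (repr _) => ? [] | by case: G => ? [] |].
by have /eqmodP/asboolP := reprK (\pi_(webs n k)%qT G).
Qed.
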